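(* Let $\Omega\subset\mathbb R^2$ be a domain that is locally connected at every point of $\partial\Omega$. Then the identity mapping $i:\Omega\to\Omega$ extends to a homeomorphism $\widetilde i_\rho:\overline\Omega\to\widetilde\Omega_\rho$ if and only if the realization $s_h$ of every boundary element $h\in H_\rho$ is a single point.
   Context: The conformal capacity of a condenser is $\mathrm{cap}(F_0,F_1;\Omega)=\inf\int_\Omega|\nabla v|^2dx$, where the infimum is over nonnegative continuous $v$ with square integrable weak gradient, $v=0$ near $F_0$, and $v\ge1$ near $F_1$. Fix a continuum $F\subset\Omega$ and a domain $V$ with $F\subset V\subset\overline V\subset\Omega$, $\overline V$ compact, and $\partial V$ a quasiconformal image of the unit circle. The conformal capacitary metric is $$\rho(x,y)=\rho_{(F,V)}(x,y)=\inf_{l(x,y)}\big\{\mathrm{cap}^{1/2}(F,l\setminus V;\Omega)+\mathrm{cap}^{1/2}(\partial\Omega,l\cap V;\Omega)\big\},$$ where the infimum is over rectifiable curves $l$ in $\Omega$ joining $x$ and $y$. Let $\widetilde\Omega_\rho$ be the completion of $(\Omega,\rho)$ and $H_\rho=\widetilde\Omega_\rho\setminus\Omega$. For $h\in H_\rho$, the realization is $s_h=\bigcap_{\varepsilon>0}\overline{D(h,\varepsilon)\cap\Omega}$, where $D(h,\varepsilon)$ is the $\rho$-ball about $h$ and the closure is Euclidean. Local connectedness at $x\in\partial\Omega$ means that $x$ has arbitrarily small neighborhoods $U$ with $U\cap\Omega$ connected. *)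

(* Defs.v *)
From HB Require Import structures.
From mathcomp Require Import all_boot all_order all_algebra.
From mathcomp Require Import all_classical all_reals all_analysis.
Set Implicit Arguments. Unset Strict Implicit. Unset Printing Implicit Defensive.
Import Order.TTheory GRing.Theory Num.Theory.
Import numFieldNormedType.Exports.
Local Open Scope classical_set_scope.
Local Open Scope ring_scope.

Section Plane.
Variable R : realType.
Local Notation P := (R * R)%type.

Definition edist (x y : P) : R :=
  Num.sqrt ((x.1 - y.1) ^+ 2 + (x.2 - y.2) ^+ 2).

Definition leb2 := (@lebesgue_measure R \x @lebesgue_measure R)%E.

Definition domain (O : set P) : Prop := open O /\ connected O /\ O !=set0.

Definition bdry (O : set P) : set P := closure O `\` interior O.

Definition locally_connected_at (O : set P) (x : P) : Prop :=
  forall e : R, 0 < e -> exists U : set P,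
    nbhs x U /\ U `<=` [set y | edist x y < e] /\ connected (U `&` O).

Definition continuum (K : set P) : Prop :=
  compact K /\ connected K /\ exists a b, K a /\ K b /\ a <> b.

Definition d1 (f : P -> R) (p : P) : R := derive f p (1, 0).
Definition d2 (f : P -> R) (p : P) : R := derive f p (0, 1).

Fixpoint Ck (k : nat) (f : P -> R) : Prop :=
  continuous f /\
  match k with
  | 0%N => True
  | k'.+1 => (forall p, derivable f p (1, 0) /\ derivable f p (0, 1)) /\
             Ck k' (d1 f) /\ Ck k' (d2 f)
  end.

Definition test_function (O : set P) (phi : P -> R) : Prop :=
  (forall k, Ck k phi) /\
  exists K : set P, compact K /\ K `<=` O /\ (forall p, ~ K p -> phi p = 0).

Definition L2_weak_gradient (O : set P) (v : P -> R) (g : P -> P) : Prop :=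
  measurable_fun O (fun p => (g p).1) /\ measurable_fun O (fun p => (g p).2) /\
  (\int[leb2]_(p in O) (((g p).1) ^+ 2)%:E < +oo)%E /\
  (\int[leb2]_(p in O) (((g p).2) ^+ 2)%:E < +oo)%E /\
  forall phi, test_function O phi ->
    (\int[leb2]_(p in O) (v p * d1 phi p)%:E =
       - \int[leb2]_(p in O) ((g p).1 * phi p)%:E)%E /\
    (\int[leb2]_(p in O) (v p * d2 phi p)%:E =
       - \int[leb2]_(p in O) ((g p).2 * phi p)%:E)%E.

Definition cap_admissible (F0 F1 O : set P) (v : P -> R) : Prop :=
  (forall p, O p -> 0 <= v p) /\
  {in O, continuous v} /\
  (exists U, open U /\ F0 `<=` U /\ forall p, U p -> O p -> v p = 0) /\
  (exists U, open U /\ F1 `<=` U /\ forall p, U p -> O p -> 1 <= v p).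

Definition cap (F0 F1 O : set P) : \bar R :=
  ereal_inf [set (\int[leb2]_(p in O) (((g p).1) ^+ 2 + ((g p).2) ^+ 2)%:E)%E
            | g in [set g | exists v, cap_admissible F0 F1 O v /\
                                       L2_weak_gradient O v g]].

Definition plane_homeo (f : P -> P) : Prop :=
  exists g : P -> P, cancel f g /\ cancel g f /\ continuous f /\ continuous g.

(* quasiconformal homeomorphisms of the plane (metric definition:
   limsup_{r->0} L_f(x,r)/l_f(x,r) bounded uniformly in x) *)
Definition quasiconformal (f : P -> P) : Prop :=
  plane_homeo f /\
  exists H : R, forall x : P, exists2 d : R, 0 < d & forall r : R, 0 < r < d ->
    forall y z : P, edist x y = r -> edist x z = r ->
      edist (f x) (f y) <= H * edist (f x) (f z).

Definition unit_circle : set P := [set p | p.1 ^+ 2 + p.2 ^+ 2 = 1].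

Definition quasicircle (C : set P) : Prop :=
  exists f, quasiconformal f /\ C = f @` unit_circle.

Definition rect_curve (O : set P) (x y : P) (gam : R -> P) : Prop :=
  {within `[0, 1], continuous gam} /\
  (forall t, 0 <= t <= 1 -> O (gam t)) /\ gam 0 = x /\ gam 1 = y /\
  exists M : R, forall (n : nat) (t : nat -> R),
    (forall i, (i < n)%N -> 0 <= t i /\ t i <= t i.+1 /\ t i.+1 <= 1) ->
    \sum_(i < n) edist (gam (t i)) (gam (t i.+1)) <= M.

Definition trace (gam : R -> P) : set P := gam @` `[0, 1].

Definition rho (O F V : set P) (x y : P) : \bar R :=
  ereal_inf [set (sqrte (cap F (trace gam `\` V) O) +
                  sqrte (cap (bdry O) (trace gam `&` V) O))%E
            | gam in rect_curve O x y].

Definition rho_cauchy (O F V : set P) (u : nat -> P) : Prop :=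
  (forall n, O (u n)) /\
  forall e : R, 0 < e -> exists N, forall n m, (N <= n)%N -> (N <= m)%N ->
    (rho O F V (u n) (u m) < e%:E)%E.

Definition rho_equiv (O F V : set P) (u w : nat -> P) : Prop :=
  forall e : R, 0 < e -> exists N, forall n, (N <= n)%N ->
    (rho O F V (u n) (w n) < e%:E)%E.

Definition cclass (O F V : set P) (u : nat -> P) : set (nat -> P) :=
  [set w | rho_cauchy O F V w /\ rho_equiv O F V u w].

Definition completion (O F V : set P) : set (set (nat -> P)) :=
  [set C | exists u, rho_cauchy O F V u /\ C = cclass O F V u].

Definition embed (O F V : set P) (x : P) : set (nat -> P) :=
  cclass O F V (fun _ => x).

(* the extended metric on the completion: lim rho(u_n, w_n) *)
Definition crho (O F V : set P) (C D : set (nat -> P)) : \bar R :=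
  ereal_inf [set r | exists u w, C u /\ D w /\
                     r = limn_esup (fun n => rho O F V (u n) (w n))].

Definition Hrho (O F V : set P) : set (set (nat -> P)) :=
  completion O F V `\` (embed O F V @` O).

Definition realization (O F V : set P) (h : set (nat -> P)) : set P :=
  \bigcap_(e in [set e : R | 0 < e])
     closure [set x | O x /\ (crho O F V h (embed O F V x) < e%:E)%E].

Definition identity_extends_homeo (O F V : set P) : Prop :=
  exists i : P -> set (nat -> P),
    (forall x, O x -> i x = embed O F V x) /\
    (forall x, closure O x -> completion O F V (i x)) /\
    (forall x y, closure O x -> closure O y -> i x = i y -> x = y) /\
    (forall h, completion O F V h -> exists2 x, closure O x & i x = h) /\
    (forall x, closure O x -> forall e : R, 0 < e -> exists2 d : R, 0 < d &
        forall y, closure O y -> edist x y < d -> (crho O F V (i x) (i y) < e%:E)%E) /\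
    (forall x, closure O x -> forall e : R, 0 < e -> exists2 d : R, 0 < d &
        forall y, closure O y -> (crho O F V (i x) (i y) < d%:E)%E -> edist x y < e).

End Plane.

(* Main.v *)
Require Import Defs.

(* Points and infinity have zero capacity in the plane: the logarithmic cut-off
   phi((ln(1 + |p - c|^2 / s^2)) / n - 1), with phi a smooth step, has energy
   O(1/n).  With local connectedness, this makes two points of O that are near
   the same point of closure O close for rho, so limits of sequences in O define
   a continuous i : closure O -> completion.

   For the converse estimate, a function v of small energy varies little along
   almost every horizontal and vertical line (absolute continuity on lines,
   obtained by testing the weak gradient against products of smooth bumps).
   Carrying this through chains of boxes, starting from F, or from bdry O when O
   is bounded, where v vanishes, shows that v has small mean near a given y in
   O. If a curve leaves a box around y while both capacities in the definition
   of rho are small, then at each of its points one of the two corresponding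
   potentials is at least 1, so their sum is at least about 1 on the lines
   through its projection, hence in mean on the box: a contradiction. So rho
   separates y from the points far from it.

   If the realization of h is a single point x, the balls about h shrink to x:
   they are path connected up to a factor, so otherwise they would accumulate on
   the boundary of a small box about x.  Finally O has to be bounded, for
   otherwise a sequence going to infinity through nested components of O minus
   large boxes is Cauchy, and it defines a boundary element whose realization is
   not a point. *)

From HB Require Import structures.
From mathcomp Require Import all_boot all_order all_algebra.
From mathcomp Require Import all_classical all_reals all_analysis.
From mathcomp Require Import measurable_realfun ring lra.
(* mathcomp-analysis exports another [edist]. *)
Import Defs.
Set Implicit Arguments. Unset Strict Implicit. Unset Printing Implicit Defensive.
Import Order.TTheory GRing.Theory Num.Theory.
Import numFieldNormedType.Exports.
Local Open Scope classical_set_scope.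
Local Open Scope ring_scope.

(** * Boxes in the plane *)

Section Plane.
Variable R : realType.
Local Notation P := (R * R)%type.
Implicit Types (O U : set P) (x y z p : P).

(** Values of [rho] are never added. The proof uses the relation [capclose O F V d x y]: a single
    curve from x to y along which both capacities are below d^2. The sum of two admissible functions
    is admissible for the union of two curves, and |a + b|^2 <= 2|a|^2 + 2|b|^2, so two such curves
    in a row give the relation with 2d. The later factors 3, 4, 24 and 48 only count these doublings
    and the passage to upper limits. The obstacle is that inside V a curve is controlled by bdry O
    alone, which may be too small: if O is the whole plane, every capacity from its empty boundary
    is 0, and [rho] vanishes between points joined by a curve in V. Separation is therefore
    available at once only outside closure V, where the continuum F controls the curve. The
    boundedness of O has to be derived from that much, and only afterwards are the points of V
    separated. Smallness of a potential is expressed by integrals over boxes and is transported by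
    comparing values on a common horizontal or vertical line. *)

Definition cbox x (e : R) : set P := `[x.1 - e, x.1 + e] `*` `[x.2 - e, x.2 + e].
Definition obox x (e : R) : set P := `]x.1 - e, x.1 + e[ `*` `]x.2 - e, x.2 + e[.

Lemma oboxP x e y : obox x e y <-> `|x.1 - y.1| < e /\ `|x.2 - y.2| < e.
Proof.
rewrite /obox /setX /= !in_itv /= !ltr_norml.
by split=> -[/andP[a b] /andP[c d]]; split; apply/andP; split; lra.
Qed.

Lemma cboxP x e y : cbox x e y <-> `|x.1 - y.1| <= e /\ `|x.2 - y.2| <= e.
Proof.
rewrite /cbox /setX /= !in_itv /= !ler_norml.
by split=> -[/andP[a b] /andP[c d]]; split; apply/andP; split; lra.
Qed.

Lemma obox_ball x e : obox x e = ball x e.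
Proof. by apply/seteqP; split=> y /oboxP. Qed.

Lemma cbox_compact x e : compact (cbox x e).
Proof. by apply: compact_setX; exact: segment_compact. Qed.

Lemma obox_cbox x e : obox x e `<=` cbox x e.
Proof. by move=> y /oboxP[/ltW a /ltW b]; apply/cboxP. Qed.

Lemma cbox_obox x e e' : e < e' -> cbox x e `<=` obox x e'.
Proof.
by move=> ee' y /cboxP[a b]; apply/oboxP; split; apply: le_lt_trans ee'.
Qed.

Lemma obox_center x e : 0 < e -> obox x e x.
Proof. by move=> e0; apply/oboxP; rewrite !subrr normr0. Qed.

Lemma nbhs_obox x U : nbhs x U <-> exists2 e : R, 0 < e & obox x e `<=` U.
Proof.
rewrite -nbhs_ballE; split=> -[e /= e0 eU]; exists e => //.
  by rewrite obox_ball.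
by rewrite -obox_ball.
Qed.

Lemma open_obox O x : open O -> O x -> exists2 e : R, 0 < e & obox x e `<=` O.
Proof. by move=> oO Ox; apply/nbhs_obox; exact: open_nbhs_nbhs. Qed.

Lemma open_cbox O x : open O -> O x -> exists2 e : R, 0 < e & cbox x e `<=` O.
Proof.
move=> oO Ox; have [e e0 eO] := open_obox oO Ox.
exists (e / 2); first by rewrite divr_gt0.
by apply: subset_trans eO; apply: cbox_obox; lra.
Qed.

Lemma openP O : (forall x, O x -> exists2 e : R, 0 < e & obox x e `<=` O) -> open O.
Proof.
move=> h; rewrite openE => x /h[e e0 eO]; rewrite /interior.
by apply/nbhs_obox; exists e.
Qed.

Lemma obox_min x a b p : obox x (Num.min a b) p -> obox x a p /\ obox x b p.
Proof.
by move=> /oboxP[]; rewrite !lt_min => /andP[? ?] /andP[? ?]; split; apply/oboxP.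
Qed.

Lemma obox_open x e : open (obox x e).
Proof.
apply: openP => y /oboxP[a b].
exists (Num.min (e - `|x.1 - y.1|) (e - `|x.2 - y.2|)).
  by rewrite lt_min !subr_gt0 a.
move=> z /oboxP[]; rewrite !lt_min => /andP[c _] /andP[_ d]; apply/oboxP; split.
  by have := ler_distD y.1 x.1 z.1; lra.
by have := ler_distD y.2 x.2 z.2; lra.
Qed.

Lemma closureP U x : closure U x <-> forall e : R, 0 < e -> exists2 y, U y & obox x e y.
Proof.
split=> [cU e e0|h B /nbhs_obox[e e0 eB]].
  have /cU[y [Uy xy]] : nbhs x (obox x e) by apply/nbhs_obox; exists e.
  by exists y.
by have [y Uy xy] := h _ e0; exists y; split=> //; apply: eB.
Qed.

Lemma edist_ge0 x y : 0 <= edist x y.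
Proof. exact: sqrtr_ge0. Qed.

Lemma edist1 x y : `|x.1 - y.1| <= edist x y.
Proof.
rewrite /edist -sqrtr_sqr ler_sqrt; last by rewrite addr_ge0// sqr_ge0.
by rewrite lerDl sqr_ge0.
Qed.

Lemma edist2 x y : `|x.2 - y.2| <= edist x y.
Proof.
rewrite /edist -sqrtr_sqr ler_sqrt; last by rewrite addr_ge0// sqr_ge0.
by rewrite lerDr sqr_ge0.
Qed.

Lemma edist_le x y : edist x y <= `|x.1 - y.1| + `|x.2 - y.2|.
Proof.
rewrite /edist -[leRHS]ger0_norm ?addr_ge0// -sqrtr_sqr ler_sqrt ?sqr_ge0//.
have := mulr_ge0 (normr_ge0 (x.1 - y.1)) (normr_ge0 (x.2 - y.2)).
have := real_normK (num_real (x.1 - y.1)); have := real_normK (num_real (x.2 - y.2)).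
nra.
Qed.

Lemma edist_obox x e y : edist x y < e -> obox x e y.
Proof.
by move=> h; apply/oboxP; split; apply: le_lt_trans h; rewrite (edist1,edist2).
Qed.

Lemma obox_edist x e y : obox x (e / 2) y -> edist x y < e.
Proof. by move=> /oboxP[a b]; apply: le_lt_trans (edist_le _ _) _; lra. Qed.

Lemma edistC x y : edist x y = edist y x.
Proof. by rewrite /edist -(sqrrN (x.1 - _)) -(sqrrN (x.2 - _)) !opprB. Qed.

(** After squaring this is Cauchy-Schwarz, which Lagrange's identity reduces to the square of ad -
    bc. It bounds the length of concatenated curves through [edist_add]. *)
Lemma sqrt_sumsq_add (a b c d : R) :
  Num.sqrt ((a + c) ^+ 2 + (b + d) ^+ 2) <=
  Num.sqrt (a ^+ 2 + b ^+ 2) + Num.sqrt (c ^+ 2 + d ^+ 2).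
Proof.
set p := Num.sqrt (a ^+ 2 + _); set q := Num.sqrt (c ^+ 2 + _).
have p0 : 0 <= p by exact: sqrtr_ge0.
have q0 : 0 <= q by exact: sqrtr_ge0.
have pE : p ^+ 2 = a ^+ 2 + b ^+ 2 by rewrite sqr_sqrtr// addr_ge0 ?sqr_ge0.
have qE : q ^+ 2 = c ^+ 2 + d ^+ 2 by rewrite sqr_sqrtr// addr_ge0 ?sqr_ge0.
rewrite -[leRHS]ger0_norm ?addr_ge0// -sqrtr_sqr ler_sqrt ?sqr_ge0//.
suff : a * c + b * d <= p * q by nra.
apply: (le_trans (ler_norm _)).
rewrite -[leRHS]ger0_norm ?mulr_ge0// -ler_sqr ?nnegrE// !real_normK ?num_real//.
rewrite exprMn pE qE; have := sqr_ge0 (a * d - b * c); nra.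
Qed.

Lemma edist_gt0_neq x y : x <> y -> 0 < edist x y.
Proof.
move=> xy; rewrite lt_neqAle edist_ge0 andbT eq_sym; apply/eqP => d0.
apply: xy; case: x y d0 => x1 x2 [y1 y2] d0.
have := edist1 (x1, x2) (y1, y2); have := edist2 (x1, x2) (y1, y2).
rewrite d0 !normr_le0 !subr_eq0 /= => /eqP-> /eqP->; reflexivity.
Qed.

Lemma ratr_between (a b : R) : a < b -> exists q : rat, a < ratr q < b.
Proof. by move=> /rat_in_itvoo[q]; rewrite in_itv /= => h; exists q. Qed.

Definition rbox (q : (rat * rat) * (rat * rat)) : set P :=
  `[ratr q.1.1, ratr q.1.2] `*` `[ratr q.2.1, ratr q.2.2].

Lemma open_rbox O x : open O -> O x ->
  exists q, [/\ rbox q `<=` O, ratr q.1.1 < x.1 < ratr q.1.2 & ratr q.2.1 < x.2 < ratr q.2.2].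
Proof.
move=> oO Ox; have [e e0 eO] := open_cbox oO Ox.
have [a /andP[a1 a2]] : exists q : rat, x.1 - e < ratr q < x.1 by apply: ratr_between; lra.
have [b /andP[b1 b2]] : exists q : rat, x.1 < ratr q < x.1 + e by apply: ratr_between; lra.
have [c /andP[c1 c2]] : exists q : rat, x.2 - e < ratr q < x.2 by apply: ratr_between; lra.
have [d /andP[d1 d2]] : exists q : rat, x.2 < ratr q < x.2 + e by apply: ratr_between; lra.
exists ((a, b), (c, d)); split => /=; rewrite ?a2 ?b1 ?c2 ?d1//.
apply: subset_trans eO => -[u v]; rewrite /rbox /cbox /setX /= !in_itv /=.
move=> [/andP[u1 u2] /andP[v1 v2]]; split; apply/andP; split; lra.
Qed.

Lemma rbox_measurable q : measurable (rbox q : set P).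
Proof. by apply: measurableX; exact: measurable_itv. Qed.

(** Measurability refers to the product sigma-algebra, so the set is written as the union of the
    countably many closed rational rectangles inside it. *)
Lemma open_measurable_plane O : open O -> measurable (O : set P).
Proof.
move=> oO.
have -> : O = \bigcup_(q in [set q | rbox q `<=` O]) rbox q.
  apply/seteqP; split=> [x Ox|x [q qO qx]]; last exact: qO.
  have [q [qO /andP[/ltW a /ltW b] /andP[/ltW c /ltW d]]] := open_rbox oO Ox.
  by exists q => //; rewrite /rbox /setX /= !in_itv /= a b c d.
rewrite bigcup_mkcond; apply: countable_bigcupT_measurable => [|q]; first exact: countableP.
by case: ifP => // _; exact: rbox_measurable.
Qed.
End Plane.

(** * A smooth step and mollifiers *)

Section Smooth.
Variable R : realType.
Implicit Types (b c f : R -> R) (k : nat).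

(** The derivatives are given as witnesses, so that closure under sums, products, inverses and
    affine changes of variable is an induction on k. [Ck_tensor] carries this over to the plane. *)
Fixpoint diffk k b : Prop :=
  match k with
  | 0%N => True
  | k'.+1 => exists b', (forall x : R, is_derive x 1 b (b' x)) /\ diffk k' b'
  end.

Definition smooth b := forall k, diffk k b.

Lemma diffk_le k b : diffk k.+1 b -> diffk k b.
Proof.
by elim: k b => // k IH b [b' [db /IH kb']]; exists b'.
Qed.

Lemma diffkD k b c : diffk k b -> diffk k c -> diffk k (fun x => b x + c x).
Proof.
elim: k b c => // k IH b c [b' [db kb]] [c' [dc kc]].
exists (fun x => b' x + c' x); split; last exact: IH.
by move=> x; exact: (is_deriveD (db x) (dc x)).
Qed.

Lemma diffkM k b c : diffk k b -> diffk k c -> diffk k (fun x => b x * c x).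
Proof.
elim: k b c => // k IH b c bk ck; have [b' [db kb]] := bk; have [c' [dc kc]] := ck.
exists (fun x => b x * c' x + c x * b' x); split; last first.
  by apply: diffkD; apply: IH => //; exact: diffk_le.
by move=> x; exact: (is_deriveM (db x) (dc x)).
Qed.

Lemma diffk_cst k (a : R) : diffk k (fun=> a).
Proof. by elim: k a => // k IH a; exists (fun=> 0); split=> // x; exact: is_derive_cst. Qed.

Lemma diffkZ k (a : R) b : diffk k b -> diffk k (fun x => a * b x).
Proof. by apply: diffkM; exact: diffk_cst. Qed.

Lemma is_derive_affine b b' (s t x : R) : is_derive (s * x + t) 1 b (b' (s * x + t)) ->
  is_derive x 1 (fun y => b (s * y + t)) (s * b' (s * x + t)).
Proof.
move=> db; rewrite mulrC.
apply: (@is_derive1_comp _ b (fun y => s * y + t)) => //.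
by apply: is_derive_eq; rewrite addr0 /GRing.scale /= mulr1.
Qed.

Lemma diffk_affine k (s t : R) b : diffk k b -> diffk k (fun x => b (s * x + t)).
Proof.
elim: k b => // k IH b [b' [db kb]].
exists (fun x => s * b' (s * x + t)); split; last by apply: diffkZ; exact: IH.
by move=> x; exact: is_derive_affine.
Qed.

Lemma diffkV k b : (forall x, b x != 0) -> diffk k b -> diffk k (fun x => (b x)^-1).
Proof.
move=> b0; elim: k => // k IH bk; have [b' [db kb]] := bk.
have iv := IH (diffk_le bk).
exists (fun x => - (b x) ^- 2 *: b' x); split; first by move=> x; apply: is_deriveV.
have -> : (fun x => - (b x) ^- 2 *: b' x) =
    (fun x => (-1) * ((b x)^-1 * ((b x)^-1 * b' x))).
  by apply/funext => x; rewrite /GRing.scale /= mulN1r mulNr mulrA -invfM -expr2.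
by apply: diffkZ; apply: diffkM => //; apply: diffkM.
Qed.

(** The functions x^-j exp(-1/x), continued by 0: their span is closed under differentiation, so
    smoothness is proved for all j at once. *)
Definition flat (j : nat) (x : R) : R := if 0 < x then x^-1 ^+ j * expR (- x^-1) else 0.

(** The single term u^(j+1)/(j+1)! of the series of exp u, at u = 1/x, suffices. The linear bound
    makes the difference quotient of [flat j] at 0, which is [flat j.+1] on the right, tend to 0. *)
Lemma flat_bound j (x : R) : `|flat j x| <= (j.+1)`!%:R * `|x|.
Proof.
rewrite /flat; case: ltP => [x0|_]; last by rewrite normr0 mulr_ge0.
rewrite !ger0_norm ?mulr_ge0 ?exprn_ge0 ?invr_ge0 ?expR_ge0 ?(ltW x0)//.
have := @expR_ge1Dxn R x^-1 j; rewrite invr_ge0 ltW// => /(_ isT) h.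
rewrite expRN ler_pdivrMr ?expR_gt0//.
have f0 : 0 < (j.+1)`!%:R :> R by rewrite ltr0n fact_gt0.
apply: (@le_trans _ _ ((j.+1)`!%:R * x * (x^-1 ^+ j.+1 / (j.+1)`!%:R))).
  rewrite exprSr; rewrite le_eqVlt; apply/orP; left; apply/eqP; field.
  by rewrite !gt_eqF//.
by rewrite ler_pM2l ?mulr_gt0//; apply: le_trans h; rewrite lerDr.
Qed.

Lemma is_derive_flat j (x : R) :
  is_derive x 1 (flat j) (flat j.+2 x - j%:R * flat j.+1 x).
Proof.
have [x0|x0|<-] := ltgtP 0 x.
- have nf : \forall y \near x, (fun y => y^-1 ^+ j * expR (- y^-1)) y = flat j y.
    near=> y; rewrite /flat ifT//; near: y; exact: lt_nbhsr.
  apply: (near_eq_is_derive nf); rewrite /flat x0.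
  have xn0 : x != 0 by rewrite gt_eqF.
  have dV : is_derive x 1 (fun y : R => y^-1) (- x ^- 2 *: 1).
    by apply: is_deriveV.
  have dX : is_derive x 1 (fun y : R => y^-1 ^+ j) ((j%:R * x^-1 ^+ j.-1) *: (- x ^- 2 *: 1)).
    have -> : (fun y : R => y^-1 ^+ j) = (fun y : R => y^-1) ^+ j by rewrite exprfctE.
    exact: (is_deriveX j dV).
  have dN : is_derive x 1 (fun y : R => - y^-1) (- (- x ^- 2 *: 1)).
    exact: (is_deriveN dV).
  have dE : is_derive x 1 (fun y : R => expR (- y^-1)) (expR (- x^-1) * - (- x ^- 2 *: 1)).
    exact: (@is_derive1_comp _ expR (fun y : R => - y^-1) x _ _ _ dN).
  apply: is_derive_eq (is_deriveM dX dE) _.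
  rewrite /GRing.scale /=; case: j {nf dX} => [|j]; rewrite ?exprSr ?expr0 ?exprS/=; field => //.
- have nf : \forall y \near x, (fun=> 0) y = flat j y.
    near=> y; rewrite /flat ltNge ifF//; apply/negbTE; rewrite negbK.
    by apply/ltW; near: y; exact: lt_nbhsl.
  apply: (near_eq_is_derive nf); rewrite /flat !(ltNge 0) ltW//= mulr0 subr0.
  exact: is_derive_cst.
- have f0 i : flat i 0 = 0 by rewrite /flat ltxx.
  rewrite !f0 mulr0 subr0.
  have c : h^-1 *: ((flat j \o shift 0) (h *: (1 : R)) - flat j 0) @[h --> 0^'] --> (0 : R).
    apply/cvgr0Pnorm_le => e e0; near=> h.
    rewrite f0 subr0 /= addr0 /GRing.scale /= mulr1.
    have [h0|h0] := ltP 0 h; last by rewrite /flat ltNge h0 mulr0 normr0 ltW.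
    have -> : h^-1 * flat j h = flat j.+1 h by rewrite /flat h0 exprS mulrA.
    apply: le_trans (flat_bound _ _) _.
    rewrite mulrC -ler_pdivlMr ?ltr0n ?fact_gt0//.
    near: h; apply: dnbhs0_le; rewrite divr_gt0 ?ltr0n ?fact_gt0//.
  by apply: DeriveDef; [apply/cvg_ex; exists 0|exact/cvg_lim].
Unshelve. all: end_near. Qed.

Lemma smooth_flat k j : diffk k (flat j).
Proof.
elim: k j => // k IH j.
exists (fun x => flat j.+2 x + - j%:R * flat j.+1 x); split; last first.
  by apply: diffkD => //; exact: diffkZ.
by move=> x; have := is_derive_flat j x; rewrite mulNr.
Qed.

Lemma flat_ge0 j x : 0 <= flat j x.
Proof.
rewrite /flat; case: ltP => // x0.
by rewrite mulr_ge0 ?exprn_ge0 ?invr_ge0 ?expR_ge0 ?(ltW x0).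
Qed.

(** The usual smooth transition from 0 to 1 on [0, 1]; the denominator is positive because x and 1 -
    x are never both nonpositive. *)
Definition step (x : R) : R := flat 0 x / (flat 0 x + flat 0 (1 - x)).

Definition dstep (x : R) : R :=
  (flat 2 x * flat 0 (1 - x) + flat 0 x * flat 2 (1 - x)) /
  (flat 0 x + flat 0 (1 - x)) ^+ 2.

Lemma step_den_gt0 x : 0 < flat 0 x + flat 0 (1 - x).
Proof.
have p y : 0 < y -> 0 < flat 0 y by move=> y0; rewrite /flat y0 expr0 mul1r expR_gt0.
have [x0|x0] := ltP 0 x.
  by rewrite ltr_wpDr ?flat_ge0 ?p.
by rewrite ltr_wpDl ?flat_ge0 ?p//; lra.
Qed.

Lemma step0 x : x <= 0 -> step x = 0.
Proof. by move=> x0; rewrite /step /flat ltNge x0 mul0r. Qed.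

Lemma step1 x : 1 <= x -> step x = 1.
Proof.
move=> x1; have := step_den_gt0 x; rewrite /step.
have -> : flat 0 (1 - x) = 0 by rewrite /flat ltNge ifF//; apply/negbTE; rewrite negbK; lra.
by rewrite addr0 => /lt0r_neq0 h; rewrite divff.
Qed.

Lemma step_ge0 x : 0 <= step x.
Proof. by rewrite divr_ge0 ?flat_ge0// ltW// step_den_gt0. Qed.

Lemma step_le1 x : step x <= 1.
Proof. by rewrite ler_pdivrMr ?step_den_gt0// mul1r lerDl flat_ge0. Qed.

Lemma dstep_ge0 x : 0 <= dstep x.
Proof. by rewrite divr_ge0 ?sqr_ge0// addr_ge0// mulr_ge0// flat_ge0. Qed.

Lemma dstep_out x : x <= 0 \/ 1 <= x -> dstep x = 0.
Proof.
move=> x01; suff [a b] : flat 2 x * flat 0 (1 - x) = 0 /\ flat 0 x * flat 2 (1 - x) = 0.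
  by rewrite /dstep a b addr0 mul0r.
case: x01 => [x0|x1].
  by rewrite /flat ltNge x0 !mul0r.
have h : (0 < 1 - x) = false by apply/negbTE; rewrite -leNgt; lra.
by rewrite /flat h !mulr0.
Qed.

Lemma is_derive_flat0 (x : R) : is_derive x 1 (flat 0) (flat 2 x).
Proof. by have := is_derive_flat 0 x; rewrite mul0r subr0. Qed.

Lemma smooth_step : smooth step.
Proof.
move=> k; apply: diffkM; first exact: smooth_flat.
apply: (@diffkV k (fun x => flat 0 x + flat 0 (1 - x))) => [x|].
  by rewrite gt_eqF// step_den_gt0.
apply: diffkD; first exact: smooth_flat.
have -> : (fun x => flat 0 (1 - x)) = (fun x => flat 0 (-1 * x + 1)).
  by apply/funext => x; rewrite mulN1r addrC.
by apply: diffk_affine; exact: smooth_flat.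
Qed.

Lemma is_derive_step (x : R) : is_derive x 1 step (dstep x).
Proof.
have d1 := is_derive_flat0.
have d2 : is_derive x 1 (fun y => flat 0 (1 - y)) (- flat 2 (1 - x)).
  have := @is_derive_affine (flat 0) (flat 2) (-1) 1 x (d1 _).
  rewrite !mulN1r addrC.
  by have -> : (fun y => flat 0 (-1 * y + 1)) = (fun y => flat 0 (1 - y))
    by apply/funext => y; rewrite mulN1r addrC.
have n0 : flat 0 x + flat 0 (1 - x) != 0 by rewrite gt_eqF// step_den_gt0.
have d3 : is_derive x 1 (fun y => flat 0 y + flat 0 (1 - y)) (flat 2 x + - flat 2 (1 - x)).
  exact: is_deriveD (d1 x) d2.
have d4 := @is_deriveV R (fun y => flat 0 y + flat 0 (1 - y)) _ _ _ n0 d3.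
apply: is_derive_eq (is_deriveM (d1 x) d4) _.
rewrite /GRing.scale /= /dstep; field; exact: n0.
Qed.

Lemma smooth_dstep : smooth dstep.
Proof.
move=> k; have [b' [db kb]] := smooth_step k.+1.
suff -> : dstep = b' by [].
apply/funext => x; have := is_derive_step x; have := db x.
by move=> [_ <-] [_ <-].
Qed.

Lemma is_derive_continuous b b' : (forall x : R, is_derive x 1 b (b' x)) -> continuous b.
Proof.
move=> db x; apply: differentiable_continuous; apply/derivable1_diffP.
by have [] := db x.
Qed.

Lemma smooth_continuous b : smooth b -> continuous b.
Proof. by move=> /(_ 1%N)[b' [db _]]; exact: is_derive_continuous db. Qed.

Lemma dstep_bounded : exists2 C : R, 0 < C & forall x, dstep x <= C.
Proof.
have cd : {within `[0, 1], continuous dstep}.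
  by apply: continuous_subspaceT; exact: smooth_continuous smooth_dstep.
have [c _ hc] := EVT_max ler01 cd.
exists (dstep c + 1); first by rewrite ltr_wpDl// dstep_ge0.
move=> x; have [x0|x0] := ltP x 0.
  by rewrite dstep_out ?addr_ge0// ?dstep_ge0//; left; exact: ltW.
have [x1|x1] := ltP 1 x.
  by rewrite dstep_out ?addr_ge0// ?dstep_ge0//; right; exact: ltW.
by apply: le_trans (hc x _) _; rewrite ?in_itv /= ?x0 ?x1// lerDl.
Qed.

Lemma FTC b b' (s t : R) : s <= t -> (forall x : R, is_derive x 1 b (b' x)) -> continuous b' ->
  (\int[lebesgue_measure]_(x in `[s, t]) (b' x)%:E)%E = (b t - b s)%:E.
Proof.
rewrite le_eqVlt => /predU1P[->|st] db cb.
  by rewrite set_itv1 integral_set1 subrr.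
have cB := is_derive_continuous db.
apply: continuous_FTC2 => //.
- exact: continuous_subspaceT.
- by split => [x _||]; [have [] := db x|exact: cvg_at_right_filter (cB _)|
    exact: cvg_at_left_filter (cB _)].
- by move=> x _; rewrite derive1E; have [_ ->] := db x.
Qed.

End Smooth.

(** * Integration on the plane: coordinate swap, iterated integrals, measurability *)

Section Integrals.
Variable R : realType.
Local Notation T := (measurableTypeR R).
Local Notation P := (T * T)%type.
Local Notation mu := (@lebesgue_measure R).
Local Notation leb2 := (mu \x mu)%E.
Implicit Types (O U : set P) (p : P).

(** Exchanging the coordinates turns each estimate along rows into one along columns, so only rows
    are treated directly. *)
Definition pswap p : P := (p.2, p.1).

Lemma pswapK : involutive pswap. Proof. by case. Qed.

Lemma measurable_pswap : measurable_fun [set: P] pswap.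
Proof. by apply: measurable_fun_pair; [exact: measurable_snd|exact: measurable_fst]. Qed.

Local Open Scope ereal_scope.

Lemma integral_pswapT_ge0 (f : P -> \bar R) : measurable_fun [set: P] f -> (forall p, 0 <= f p) ->
  \int[leb2]_p f (pswap p) = \int[leb2]_p f p.
Proof.
move=> mf f0.
have mfs : measurable_fun [set: P] (f \o pswap) by exact: measurableT_comp measurable_pswap.
have fs0 p : 0 <= (f \o pswap) p by exact: f0.
by rewrite [RHS](fubini_tonelli2 f)//; exact: (fubini_tonelli1 (f \o pswap)).
Qed.

Lemma integral_pswapT (f : P -> \bar R) : measurable_fun [set: P] f ->
  \int[leb2]_p f (pswap p) = \int[leb2]_p f p.
Proof.
move=> mf; rewrite integralE [RHS]integralE.
have -> : (fun p => f (pswap p))^\+ = (fun p => f^\+ (pswap p)) by apply/funext => p; rewrite !funeposE.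
have -> : (fun p => f (pswap p))^\- = (fun p => f^\- (pswap p)) by apply/funext => p; rewrite !funenegE.
by rewrite !integral_pswapT_ge0//; [exact: measurable_funeneg|exact: measurable_funepos].
Qed.

Lemma integral_pswap O (f : P -> \bar R) : measurable O -> measurable_fun O f ->
  \int[leb2]_(p in pswap @^-1` O) f (pswap p) = \int[leb2]_(p in O) f p.
Proof.
move=> mO mf; rewrite integral_mkcond [RHS]integral_mkcond.
have mF := (measurable_restrictT f mO).1 mf.
by rewrite -[RHS]integral_pswapT.
Qed.

Lemma tonelli_sec O (f : P -> \bar R) : measurable O -> measurable_fun O f ->
  (forall p, O p -> 0 <= f p) ->
  \int[leb2]_(p in O) f p = \int[mu]_y \int[mu]_x (f \_ O) (x, y).
Proof.
move=> mO mf f0; rewrite integral_mkcond fubini_tonelli2//.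
  exact: (measurable_restrictT f mO).1.
by move=> p; rewrite patchE; case: ifPn => // /[!inE]; exact: f0.
Qed.

Lemma tonelli_rect (A B : set T) (f : P -> \bar R) : measurable A -> measurable B ->
  measurable_fun (A `*` B) f -> (forall p, (A `*` B) p -> 0 <= f p) ->
  \int[leb2]_(p in A `*` B) f p = \int[mu]_(y in B) \int[mu]_(x in A) f (x, y).
Proof.
move=> mA mB mf f0; rewrite (tonelli_sec (measurableX mA mB) mf f0).
rewrite [RHS]integral_mkcond; apply: eq_integral => y _.
rewrite patchE; case: ifPn => [yB|yB].
  rewrite [RHS]integral_mkcond; apply: eq_integral => x _.
  by rewrite !patchE in_setX yB andbT.
by rewrite integral0_eq// => x _; rewrite patchE in_setX (negbTE yB) andbF.
Qed.

Lemma leb2_rect (A B : set T) : measurable A -> measurable B -> leb2 (A `*` B) = mu A * mu B.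
Proof. exact: product_measure1E. Qed.

Lemma continuous_measurable_plane (O : set (R * R)) (f : R * R -> R) :
  open O -> {in O, continuous f} -> measurable_fun (O : set P) (f : P -> R).
Proof.
move=> oO cf _; apply: (measurability _ (RGenOpens.measurableE R)) => //.
move=> _ [_ [a [b ->] <-]]; apply: open_measurable_plane.
(* The preimage need not be open, as nothing is known of f outside O; its interior has the same
   trace on O. *)
have -> : O `&` f @^-1` `]a, b[ = O `&` (f @^-1` `]a, b[)°.
  apply/seteqP; split=> p [Op fp]; split=> //; last exact: interior_subset.
  by apply: cf; [rewrite inE|apply: open_nbhs_nbhs; split=> //; exact: itv_open].
  by apply: openI => //; exact: open_interior.
exact: open_measurable_plane.
Qed.

End Integrals.

(** * Products of one-variable bumps as test functions *)

Section Mollify.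
Variable R : realType.
Local Notation T := (measurableTypeR R).
Local Notation P := (T * T)%type.
Local Notation mu := (@lebesgue_measure R).
Implicit Types (f : R * R -> R) (p : R * R) (b c : R -> R) (h s t x : R).

Lemma derive_slice1 f p (l : R) :
  is_derive p (1, 0) f l <-> is_derive (p.1 : R) 1 (fun x : R => f (x, p.2)) l.
Proof.
have E : (fun h : R => h^-1 *: ((f \o shift p) (h *: (1, 0)) - f p)) =
  (fun h : R => h^-1 *: (((fun x : R => f (x, p.2)) \o shift p.1) (h *: 1) - f (p.1, p.2))).
  apply/funext => h; rewrite /= -surjective_pairing; congr (_ *: (f _ - f _)).
  by apply: injective_projections => //=; rewrite scaler0 add0r.
split=> -[]; rewrite /derivable /derive /= => dv de; split.
- by rewrite /derivable -E.
- by rewrite /derive -E.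
- by rewrite /derivable E.
- by rewrite /derive E.
Qed.

Lemma derive_slice2 f p (l : R) :
  is_derive p (0, 1) f l <-> is_derive (p.2 : R) 1 (fun x : R => f (p.1, x)) l.
Proof.
have E : (fun h : R => h^-1 *: ((f \o shift p) (h *: (0, 1)) - f p)) =
  (fun h : R => h^-1 *: (((fun x : R => f (p.1, x)) \o shift p.2) (h *: 1) - f (p.1, p.2))).
  apply/funext => h; rewrite /= -surjective_pairing; congr (_ *: (f _ - f _)).
  by apply: injective_projections => //=; rewrite scaler0 add0r.
split=> -[]; rewrite /derivable /derive /= => dv de; split.
- by rewrite /derivable -E.
- by rewrite /derive -E.
- by rewrite /derivable E.
- by rewrite /derive E.
Qed.

Lemma smooth_derive b b' : smooth b -> (forall x : R, is_derive x 1 b (b' x)) -> smooth b'.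
Proof.
move=> sb db k; have [b'' [db' kb]] := sb k.+1.
suff -> : b' = b'' by [].
by apply/funext => x; have [_ <-] := db x; have [_ <-] := db' x.
Qed.

Lemma smooth_ex b : smooth b -> exists2 b', smooth b' & forall x : R, is_derive x 1 b (b' x).
Proof.
move=> sb; have [b' [db _]] := sb 1%N; exists b' => //; exact: smooth_derive db.
Qed.

Lemma is_derive_tensor b b' c p : (forall x : R, is_derive x 1 b (b' x)) ->
  is_derive p (1, 0) (fun q : R * R => b q.1 * c q.2) (b' p.1 * c p.2).
Proof.
move=> db; apply/derive_slice1.
apply: is_derive_eq (is_deriveM (db p.1) (is_derive_cst (c p.2) p.1 1)) _.
by rewrite scaler0 add0r /GRing.scale /= mulrC.
Qed.

Lemma is_derive_tensor2 b c c' p : (forall x : R, is_derive x 1 c (c' x)) ->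
  is_derive p (0, 1) (fun q : R * R => b q.1 * c q.2) (b p.1 * c' p.2).
Proof.
move=> dc; apply/derive_slice2.
apply: is_derive_eq (is_deriveM (is_derive_cst (b p.1) p.2 1) (dc p.2)) _.
by rewrite scaler0 addr0.
Qed.

Lemma tensor_continuous b c : smooth b -> smooth c ->
  continuous (fun p : R * R => b p.1 * c p.2).
Proof.
move=> sb sc p; apply: (@continuousM _ _ (fun q : R * R => b q.1) (fun q : R * R => c q.2)).
  by apply: continuous_comp; [exact: cvg_fst|exact: smooth_continuous].
by apply: continuous_comp; [exact: cvg_snd|exact: smooth_continuous].
Qed.

(** Both partial derivatives of such a product are again such products, so the induction closes.
    Absolute continuity on lines is obtained from these test functions alone. *)
Lemma Ck_tensor k b c : smooth b -> smooth c -> Ck k (fun p => b p.1 * c p.2).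
Proof.
elim: k b c => [|k IH] b c sb sc /=.
  by split=> //; exact: tensor_continuous.
have [b' sb' db] := smooth_ex sb; have [c' sc' dc] := smooth_ex sc.
have d1b : d1 (fun p => b p.1 * c p.2) = (fun p => b' p.1 * c p.2).
  by apply/funext => p; rewrite /d1; have [_ ->] := is_derive_tensor c p db.
have d2b : d2 (fun p => b p.1 * c p.2) = (fun p => b p.1 * c' p.2).
  by apply/funext => p; rewrite /d2; have [_ ->] := is_derive_tensor2 b p dc.
split; first exact: tensor_continuous.
split; last by rewrite d1b d2b; split; apply: IH.
by move=> p; split; [have [] := is_derive_tensor c p db|have [] := is_derive_tensor2 b p dc].
Qed.

(** Rises from 0 to 1 on [s, s + h]. Its derivative [moll h s] is a one-sided mollifier of mass 1
    carried by that interval. *)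
Definition sstep h s x := step (h^-1 * x + - (h^-1 * s)).
Definition moll h s x := h^-1 * dstep (h^-1 * x + - (h^-1 * s)).

Lemma is_derive_sstep h s x : is_derive x 1 (sstep h s) (moll h s x).
Proof. exact: (@is_derive_affine _ (@step R) (@dstep R) _ _ _ (is_derive_step _)). Qed.

Lemma smooth_sstep h s : smooth (sstep h s).
Proof. by move=> k; apply: diffk_affine; exact: smooth_step. Qed.

Lemma smooth_moll h s : smooth (moll h s).
Proof. by apply: smooth_derive (@is_derive_sstep h s); exact: smooth_sstep. Qed.

Lemma moll_ge0 h s x : 0 < h -> 0 <= moll h s x.
Proof. by move=> h0; rewrite mulr_ge0 ?dstep_ge0// invr_ge0 ltW. Qed.

Lemma sstep_lo h s x : 0 < h -> x <= s -> sstep h s x = 0.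
Proof.
by move=> h0 xs; apply: step0; rewrite -mulrBr pmulr_rle0 ?invr_gt0// subr_le0.
Qed.

Lemma sstep_hi h s x : 0 < h -> s + h <= x -> sstep h s x = 1.
Proof.
move=> h0 xs; apply: step1; rewrite -mulrBr ler_pdivlMl// mulr1; lra.
Qed.

Lemma moll_out h s x : 0 < h -> x <= s \/ s + h <= x -> moll h s x = 0.
Proof.
move=> h0 xs; rewrite /moll dstep_out ?mulr0//.
case: xs => xs; [left|right].
  by rewrite -mulrBr pmulr_rle0 ?invr_gt0// subr_le0.
by rewrite -mulrBr ler_pdivlMl// mulr1; lra.
Qed.

Lemma integral_moll h s : 0 < h -> (\int[mu]_x (moll h s x)%:E = 1)%E.
Proof.
move=> h0; transitivity (\int[mu]_(x in `[s, (s + h)%R]) (moll h s x)%:E)%E.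
  rewrite [RHS]integral_mkcond; apply: eq_integral => x _; rewrite patchE.
  case: ifPn => //; rewrite notin_setE /= in_itv /= => /negP; rewrite negb_and -!ltNge.
  by move=> /orP[/ltW|/ltW] hx; rewrite moll_out//; [left|right].
rewrite (FTC _ (@is_derive_sstep h s)); last 2 first.
  by rewrite lerDl ltW.
  exact: smooth_continuous (@smooth_moll h s).
by rewrite sstep_hi// sstep_lo// subr0.
Qed.

End Mollify.

(** * Absolute continuity on lines *)

Section HasIntegral.
Context d (X : measurableType d) (R : realType) (m : {measure set X -> \bar R}).
Implicit Types (D : set X) (f g : X -> R) (a b k : R).

(** Integrability together with a real value: sums and differences of integrals are then computed in
    R, away from infinite values. *)
Definition hasint D f a := m.-integrable D (EFin \o f) /\ (\int[m]_(x in D) (f x)%:E = a%:E)%E.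

Lemma hasint_ex D f : measurable D -> m.-integrable D (EFin \o f) -> exists a, hasint D f a.
Proof.
move=> mD fi; exists (fine (\int[m]_(x in D) (f x)%:E)); split=> //.
by rewrite fineK//; exact: integrable_fin_num fi.
Qed.

Lemma hasintD D f g a b : measurable D -> hasint D f a -> hasint D g b ->
  hasint D (fun x => f x + g x) (a + b).
Proof.
move=> mD [fi fa] [gi gb]; split; first exact: (integrableD mD fi gi).
have := integralD_EFin mD fi gi; rewrite /= => E.
by under eq_integral do rewrite EFinD; rewrite E fa gb.
Qed.

Lemma hasintZ D f k a : measurable D -> hasint D f a -> hasint D (fun x => k * f x) (k * a).
Proof.
move=> mD [fi fa]; split; first exact: (integrableZl mD k fi).
by under eq_integral do rewrite EFinM; rewrite (integralZl mD fi) fa.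
Qed.

Lemma hasintB D f g a b : measurable D -> hasint D f a -> hasint D g b ->
  hasint D (fun x => f x - g x) (a - b).
Proof.
move=> mD fa gb; have := hasintD mD fa (hasintZ (-1) mD gb).
rewrite mulN1r; congr (hasint _ _ _).
by apply/funext => x; rewrite mulN1r.
Qed.

Lemma hasint_dom D f g b : measurable D -> measurable_fun D f -> hasint D g b ->
  (forall x, D x -> `|f x| <= g x) -> exists2 a, hasint D f a & `|a| <= b.
Proof.
move=> mD mf [gi gb] fg.
have mf' : measurable_fun D (EFin \o f) by exact/measurable_EFinP.
have fi : m.-integrable D (EFin \o f).
  apply: le_integrable gi => // x Dx; rewrite lee_fin.
  by apply: le_trans (fg _ Dx) _; exact: ler_norm.
have [a fa] := hasint_ex mD fi; exists a => //; have [_ E] := fa.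
rewrite -lee_fin -abse_EFin -E -gb.
apply: le_trans (le_abse_integral m mD mf') _.
apply: ge0_le_integral => //.
- exact: measurableT_comp.
- by have /integrableP[] := gi.
Qed.

Lemma hasint_ge0 D f a : measurable D -> measurable_fun D f -> (forall x, D x -> 0 <= f x) ->
  (\int[m]_(x in D) (f x)%:E = a%:E)%E -> hasint D f a.
Proof.
move=> mD mf f0 E; split=> //; apply/integrableP; split; first exact/measurable_EFinP.
under eq_integral => x /[!inE] Dx do rewrite /= ger0_norm ?f0//.
by rewrite E ltry.
Qed.

Lemma hasint_lty D f : measurable D -> measurable_fun D f -> (forall x, D x -> 0 <= f x) ->
  (\int[m]_(x in D) (f x)%:E < +oo)%E -> exists2 a, hasint D f a & 0 <= a.
Proof.
move=> mD mf f0 foo.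
have i0 : (0 <= \int[m]_(x in D) (f x)%:E)%E by apply: integral_ge0 => x Dx; rewrite lee_fin f0.
exists (fine (\int[m]_(x in D) (f x)%:E)); last exact: fine_ge0.
by apply: hasint_ge0 => //; rewrite fineK// ge0_fin_numE.
Qed.

End HasIntegral.

Section ACL.
Variable R : realType.
Local Notation T := (measurableTypeR R).
Local Notation P := (T * T)%type.
Local Notation mu := (@lebesgue_measure R).
Local Notation leb2 := (mu \x mu)%E.

Lemma integral_supp d (X : measurableType d) (m : {measure set X -> \bar R}) (D : set X)
  (f : X -> \bar R) : (forall x, ~ D x -> f x = 0%E) ->
  (\int[m]_(x in D) f x = \int[m]_x f x)%E.
Proof.
move=> f0; rewrite integral_mkcond; apply: eq_integral => x _; rewrite patchE.
by case: ifPn => // xD; rewrite f0// => Dx; move: xD; rewrite mem_set.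
Qed.

Definition sob (O : set (R * R)) (v : R * R -> R) (g : R * R -> R * R) :=
  [/\ open O, {in O, continuous v} & L2_weak_gradient O v g].

(** The integral of |g.1| over the whole slice of O at height y. It bounds the variation of v on
    every segment of that slice, for almost all y. *)
Definition rowint (O : set P) (g : P -> P) (y : T) : \bar R :=
  (\int[mu]_x ((fun p : P => `|(g p).1|%:E) \_ O) (x, y))%E.

Lemma hasint_tensor (b c : R -> R) : smooth b -> smooth c ->
  (forall x, 0 <= b x) -> (forall x, 0 <= c x) ->
  (\int[mu]_x (b x)%:E = 1 -> \int[mu]_x (c x)%:E = 1 ->
   hasint leb2 setT (fun p : P => (b p.1 * c p.2)%R) 1)%E.
Proof.
move=> sb sc b0 c0 b1 c1.
have mf : measurable_fun [set: P] (fun p : P => b p.1 * c p.2).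
  apply: continuous_measurable_plane; first exact: openT.
  by move=> p _; exact: tensor_continuous.
apply: hasint_ge0 => //; first by move=> p _; rewrite mulr_ge0.
rewrite (fubini_tonelli2 (fun p : P => (b p.1 * c p.2)%:E))/=; last 2 first.
- exact/measurable_EFinP.
- by move=> p; rewrite lee_fin mulr_ge0.
rewrite -[RHS]c1; apply: eq_integral => y _; rewrite /fubini_G /=.
under eq_integral do rewrite EFinM.
rewrite ge0_integralZr ?b1 ?mul1e//.
- apply/measurable_EFinP; apply: continuous_measurable_fun; exact: smooth_continuous.
- by move=> x _; rewrite lee_fin.
- by rewrite lee_fin.
Qed.

End ACL.

Section ACL.
Variable R : realType.
Local Notation T := (measurableTypeR R).
Local Notation P := (T * T)%type.
Local Notation mu := (@lebesgue_measure R).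
Local Notation leb2 := (mu \x mu)%E.

(** For h small this is a trapezoid on [s, t + h]: its derivative is a mollifier at s minus one at
    t, so testing v against it compares v near the two ends. *)
Lemma smooth_trap (h s t : R) : smooth (fun x => sstep h s x - sstep h t x).
Proof.
move=> k.
have -> : (fun x => sstep h s x - sstep h t x) = (fun x => sstep h s x + -1 * sstep h t x).
  by apply/funext => x; rewrite mulN1r.
apply: diffkD; first exact: smooth_sstep.
by apply: diffkZ; exact: smooth_sstep.
Qed.

Lemma is_derive_trap (h s t x : R) :
  is_derive x 1 (fun x => sstep h s x - sstep h t x) (moll h s x - moll h t x).
Proof. exact: is_deriveB (is_derive_sstep h s x) (is_derive_sstep h t x). Qed.

Lemma trap_out (h s t x : R) : 0 < h -> s <= t -> x < s \/ t + h < x ->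
  sstep h s x - sstep h t x = 0.
Proof.
move=> h0 st [xs|xt].
  by rewrite !sstep_lo ?subrr//; lra.
by rewrite !sstep_hi ?subrr//; lra.
Qed.

Lemma trap_le1 (h s t x : R) : `|sstep h s x - sstep h t x| <= 1.
Proof.
have := step_ge0 (h^-1 * x + - (h^-1 * s)); have := step_le1 (h^-1 * x + - (h^-1 * s)).
have := step_ge0 (h^-1 * x + - (h^-1 * t)); have := step_le1 (h^-1 * x + - (h^-1 * t)).
by rewrite ler_norml /sstep => *; apply/andP; split; lra.
Qed.

Lemma moll_supp (h s x : R) : 0 < h -> ~~ (s <= x <= s + h) -> moll h s x = 0.
Proof.
move=> h0; rewrite negb_and -!ltNge => /orP[/ltW|/ltW] q; rewrite moll_out//.
  by left.
by right.
Qed.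

Variables (O : set (R * R)) (v : R * R -> R) (g : R * R -> R * R).
Hypothesis sO : sob O v g.

Let oO : open O. Proof. by case: sO. Qed.
Let mO : measurable (O : set P). Proof. exact: open_measurable_plane. Qed.
Let cv : {in O, continuous v}. Proof. by case: sO. Qed.
Let mg1 : measurable_fun (O : set P) (fun p : P => (g p).1 : T).
Proof. by case: sO => _ _ []. Qed.
Let mv : measurable_fun (O : set P) (v : P -> T).
Proof. exact: continuous_measurable_plane. Qed.
Let mag : measurable_fun (O : set P) (fun p : P => (`|(g p).1|)%:E).
Proof. by apply/measurable_EFinP; apply: measurableT_comp mg1. Qed.

Lemma weak_tensor (b b' c : R -> R) (A B : set R) : smooth b -> smooth c ->
  (forall x : R, is_derive x 1 b (b' x)) -> compact A -> compact B -> A `*` B `<=` O ->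
  (forall x, ~ A x -> b x = 0) -> (forall x, ~ B x -> c x = 0) ->
  (\int[leb2]_(p in (O : set P)) (v p * (b' p.1 * c p.2))%:E =
   - \int[leb2]_(p in (O : set P)) ((g p).1 * (b p.1 * c p.2))%:E)%E.
Proof.
move=> sb sc db cA cB ABO bA cB0.
have tf : test_function O (fun p => b p.1 * c p.2).
  split; first by move=> k; exact: Ck_tensor.
  exists (A `*` B); split; [exact: compact_setX|split=> //].
  move=> p np; have [Ap|/bA->] := pselect (A p.1); last by rewrite mul0r.
  by rewrite cB0 ?mulr0// => Bp; apply: np.
have [_ _ [_ [_ [_ [_ /(_ _ tf)[E _]]]]]] := sO.
rewrite -E; apply: eq_integral => p _; congr (_ * _)%:E.
by rewrite /d1; have [_ ->] := is_derive_tensor c p db.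
Qed.

(** The weak gradient is tested against the trapezoid in x times a mollifier in y. The side with v
    is a difference of averages of v near (s, y0) and (t, y0); on the side with g the trapezoid is
    at most 1, which leaves the mollified row integrals. *)
Lemma acl_moll (y0 s t h eps : R) : s <= t -> 0 < h ->
  `[s, t + h] `*` `[y0, y0 + h] `<=` O ->
  (forall x y, s <= x <= s + h -> y0 <= y <= y0 + h -> `|v (x, y) - v (s, y0)| <= eps) ->
  (forall x y, t <= x <= t + h -> y0 <= y <= y0 + h -> `|v (x, y) - v (t, y0)| <= eps) ->
  (`|v (s, y0) - v (t, y0)|%:E <= (2 * eps)%:E + \int[mu]_y ((moll h y0 y)%:E * rowint O g y))%E.
Proof.
move=> st h0 KO vs vt.
pose c := moll h y0.
have sc : smooth c by exact: smooth_moll.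
have c0 x : 0 <= c x by exact: moll_ge0.
have mt (u : R) : hasint leb2 setT (fun p : P => moll h u p.1 * c p.2) 1.
  apply: hasint_tensor => //; [exact: smooth_moll|by move=> x; exact: moll_ge0|..];
  exact: integral_moll.
have w_out u p : s <= u -> u <= t -> ~ O p -> moll h u p.1 * c p.2 = 0.
  move=> su ut Op; have [/andP[a1 a2]|] := boolP (u <= p.1 <= u + h); last first.
    by move=> /(moll_supp h0) ->; rewrite mul0r.
  have [/andP[b1 b2]|] := boolP (y0 <= p.2 <= y0 + h); last first.
    by rewrite /c => /(moll_supp h0) ->; rewrite !mulr0.
  by exfalso; apply: Op; apply: KO; split => /=; rewrite in_itv /=; apply/andP; split; lra.
have mw u : measurable_fun (O : set P) (fun p : P => moll h u p.1 * c p.2).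
  apply: continuous_measurable_plane => // p _.
  by apply: tensor_continuous => //; exact: smooth_moll.
have hw u : s <= u -> u <= t -> hasint leb2 O (fun p : P => moll h u p.1 * c p.2) 1.
  move=> su ut; apply: hasint_ge0 => //; first by move=> p _; rewrite mulr_ge0// moll_ge0.
  by rewrite integral_supp; [case: (mt u)|move=> p /(w_out _ _ su ut) ->].
(* [A] is [D] with v frozen at the two corners. Since both mollifiers have mass 1, A integrates to v
   (s, y0) - v (t, y0) and the error D - A to at most 2 eps. *)
pose D p := v p * ((moll h s p.1 - moll h t p.1) * c p.2).
pose A p := v (s, y0) * (moll h s p.1 * c p.2) - v (t, y0) * (moll h t p.1 * c p.2).
have hs : hasint leb2 O (fun p : P => moll h s p.1 * c p.2) 1 by apply: hw.
have ht : hasint leb2 O (fun p : P => moll h t p.1 * c p.2) 1 by apply: hw.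
have hA : hasint leb2 O A (v (s, y0) * 1 - v (t, y0) * 1).
  exact: (hasintB mO (hasintZ _ mO hs) (hasintZ _ mO ht)).
have mD : measurable_fun (O : set P) (D : P -> T).
  apply: measurable_funM => //.
  have -> : (fun p : P => (moll h s p.1 - moll h t p.1) * c p.2) =
    (fun p : P => moll h s p.1 * c p.2 - moll h t p.1 * c p.2).
    by apply/funext => p; rewrite mulrBl.
  exact: measurable_funB.
have mA : measurable_fun (O : set P) (A : P -> T).
  by case: hA => /integrableP[/measurable_EFinP].
have close u p : 0 <= eps -> (forall x y, u <= x <= u + h -> y0 <= y <= y0 + h -> `|v (x, y) - v (u, y0)| <= eps) ->
    `|(v p - v (u, y0)) * (moll h u p.1 * c p.2)| <= eps * (moll h u p.1 * c p.2).
  move=> e0 vu.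
  have w0 : 0 <= moll h u p.1 * c p.2 by apply: mulr_ge0 => //; exact: moll_ge0.
  rewrite normrM (ger0_norm w0).
  have [a|] := boolP (u <= p.1 <= u + h); last first.
    by move=> /(moll_supp h0) ->; rewrite !mul0r !mulr0.
  have [b|] := boolP (y0 <= p.2 <= y0 + h); last first.
    by rewrite /c => /(moll_supp h0) ->; rewrite !mulr0.
  apply: ler_wpM2r => //.
  by case: p a b {w0} => p1 p2 a b; exact: vu.
have eps0 : 0 <= eps.
  apply: le_trans (normr_ge0 _) (vs s y0 _ _); by rewrite lexx lerDl ltW.
have hE : hasint leb2 O (fun p : P => eps * (moll h s p.1 * c p.2) + eps * (moll h t p.1 * c p.2))
    (eps * 1 + eps * 1).
  exact: (hasintD mO (hasintZ _ mO hs) (hasintZ _ mO ht)).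
have [e he elt] : exists2 e, hasint leb2 O (fun p : P => D p - A p) e & `|e| <= eps * 1 + eps * 1.
  have mDA : measurable_fun (O : set P) (fun p : P => D p - A p) by exact: measurable_funB.
  apply: (hasint_dom mO mDA hE) => q _.
  have -> : D q - A q = (v q - v (s, y0)) * (moll h s q.1 * c q.2) -
     (v q - v (t, y0)) * (moll h t q.1 * c q.2) by rewrite /D /A; ring.
  apply: le_trans (ler_normB _ _) _; by apply: lerD; apply: close.
have hD : hasint leb2 O D (e + (v (s, y0) * 1 - v (t, y0) * 1)).
  have := hasintD mO he hA; congr (hasint _ _ _); apply/funext => p; ring.
have wk : (\int[leb2]_(p in (O : set P)) (D p)%:E =
   - \int[leb2]_(p in (O : set P)) ((g p).1 * ((sstep h s p.1 - sstep h t p.1) * c p.2))%:E)%E.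
  apply: (@weak_tensor (fun x => sstep h s x - sstep h t x)
    (fun x => moll h s x - moll h t x) c `[s, t + h]%classic `[y0, y0 + h]%classic) => //.
  - exact: smooth_trap.
  - exact: is_derive_trap.
  - exact: segment_compact.
  - exact: segment_compact.
  - move=> x; rewrite /= in_itv /= => /negP; rewrite negb_and -!ltNge => /orP q.
    exact: trap_out.
  - move=> y; rewrite /= in_itv /= => /negP; rewrite negb_and -!ltNge => /orP q.
    by rewrite /c moll_out//; case: q => /ltW; [left|right].
have bound : (`| \int[leb2]_(p in (O : set P)) ((g p).1 * ((sstep h s p.1 - sstep h t p.1) * c p.2))%:E |
    <= \int[mu]_y ((c y)%:E * rowint O g y))%E.
  have mtr : measurable_fun (O : set P) (fun p : P => (sstep h s p.1 - sstep h t p.1) * c p.2).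
    apply: continuous_measurable_plane => // p _.
    exact: (tensor_continuous (@smooth_trap h s t) sc).
  have mc : measurable_fun (O : set P) (fun p : P => c p.2).
    apply: continuous_measurable_plane => // p _.
    by apply: (@continuous_comp _ _ _ snd c); [exact: cvg_snd|exact: smooth_continuous].
  apply: le_trans (le_abse_integral leb2 mO _) _.
    by apply/measurable_EFinP; apply: measurable_funM.
  apply: (@le_trans _ _ (\int[leb2]_(p in (O : set P)) ((c p.2)%:E * (`|(g p).1|)%:E))%E).
    apply: ge0_le_integral => //.
    - apply/measurable_EFinP; apply: measurableT_comp => //; exact: measurable_funM.
    - by apply: emeasurable_funM => //; exact/measurable_EFinP.
    - move=> p _; rewrite /= lee_fin normrM mulrC; apply: ler_wpM2r => //.
      rewrite normrM (ger0_norm (c0 _)); apply: ler_piMl => //; exact: trap_le1.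
  rewrite tonelli_sec//; last 2 first.
  - by apply: emeasurable_funM => //; exact/measurable_EFinP.
  - by move=> p _; rewrite mule_ge0 ?lee_fin.
  rewrite le_eqVlt; apply/orP; left; apply/eqP; apply: eq_integral => y _.
  rewrite /rowint -ge0_integralZl ?lee_fin//.
  - apply: eq_integral => x _; rewrite !patchE; case: ifPn => //= _; by rewrite mule0.
  - have mF := (measurable_restrictT _ mO).1 mag.
    exact: (measurableT_comp mF (pair2_measurable y)).
  - by move=> x _; rewrite patchE; case: ifPn => //; rewrite lee_fin.
have [_ ED] := hD.
move: bound; rewrite -[X in (`|X|)%E]oppeK abseN -wk ED /= => bound.
apply: (@le_trans _ _ ((2 * eps)%:E + `|e + (v (s, y0) * 1 - v (t, y0) * 1)|%:E)%E).
  rewrite -EFinD lee_fin !mulr1; move: elt; rewrite !mulr1 => elt.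
  have := ler_normB (e + (v (s, y0) - v (t, y0))) e.
  by rewrite [e + _]addrC addrK; lra.
by apply: leeD.
Qed.

End ACL.

Section ACL.
Variable R : realType.
Local Notation T := (measurableTypeR R).
Local Notation P := (T * T)%type.
Local Notation mu := (@lebesgue_measure R).
Local Notation leb2 := (mu \x mu)%E.

(** A tube lemma: by compactness one h serves for boxes of radius 2h about all points of the
    segment, and these cover the rectangle. *)
Lemma segment_tube (O : set (R * R)) (s t y : R) : open O -> s <= t ->
  (forall x, s <= x <= t -> O (x, y)) ->
  \forall h \near (0:R)^'+, `[s, t + h] `*` `[y, y + h] `<=` O.
Proof.
move=> oO st sO.
have nc : \forall h \near (0:R)^'+, forall x, `[s, t]%classic x -> obox (x, y) (2 * h) `<=` O.
  have /compact_near_coveringP := @segment_compact R s t.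
  move=> /(_ R (0:R)^'+ (fun h x => obox (x, y) (2 * h) `<=` O) _); apply => x.
  rewrite /= in_itv /= => /sO Oxy.
  have [e e0 eO] := open_obox oO Oxy.
  exists (ball x (e / 2), [set h : R | h < e / 4]) => /=; first split.
  - by apply: nbhsx_ballx; rewrite divr_gt0.
  - by apply: nbhs_right_lt; rewrite divr_gt0.
  - move=> [x' h] /= [bx hh] q /oboxP[/= q1 q2]; apply: eO; apply/oboxP => /=.
    rewrite /ball /= in bx; split; last by lra.
    have := ler_distD x' x q.1; lra.
near=> h.
have h0 : 0 < h by [].
have hO : forall x, `[s, t]%classic x -> obox (x, y) (2 * h) `<=` O by near: h.
move=> [a b]; rewrite /= !in_itv /= => -[/andP[a1 a2] /andP[b1 b2]].
(* The point of [s, t] nearest to a, which may exceed t by at most h. *)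
have m1 : s <= Num.min a t <= t by rewrite le_min a1 st ge_min lexx orbT.
apply: (hO (Num.min a t)); first by rewrite /= in_itv.
apply/oboxP => /=; split; last by rewrite ler0_norm; lra.
have [ta|ta] := leP a t; first by rewrite subrr normr0; lra.
by rewrite ltr0_norm; lra.
Unshelve. all: end_near. Qed.

(** The mollifier is at most C/h and is carried by the ball of radius 2h, of length 4h. So the error
    is at most 4C times the mean of |f - f y0| over that ball, and this mean tends to 0 at a
    Lebesgue point. *)
Lemma lebesgue_moll (f : R -> R) (y0 eta : R) : measurable_fun [set: T] (f : T -> T) ->
  (forall y, 0 <= f y) -> lebesgue_pt f y0 -> 0 < eta ->
  \forall h \near (0:R)^'+, (\int[mu]_y ((moll h y0 y)%:E * (f y)%:E) <= (f y0 + eta)%:E)%E.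
Proof.
move=> mf f0 lf eta0.
have [C C0 hC] := dstep_bounded R.
have nd : \forall r \near (0:R)^'+, (davg f y0 r < (eta / (4 * C))%:E)%E.
  have := lf; move/fine_cvgP => [fin cv]; near=> r.
  have fr : davg f y0 r \is a fin_num by near: r.
  rewrite -(fineK fr) lte_fin; apply: le_lt_trans (ler_norm _) _.
  by near: r; apply: (cvgr0_norm_lt _ cv); rewrite divr_gt0// mulr_gt0.
have nd2 : \forall h \near (0:R)^'+, (davg f y0 (2 * h) < (eta / (4 * C))%:E)%E.
  have [e /= e0 he] := nd; exists (e / 2); first by rewrite /= divr_gt0.
  move=> h /=; rewrite sub0r normrN => hh h0; apply: he => /=; last by lra.
  by rewrite sub0r normrN gtr0_norm; move: hh; rewrite gtr0_norm//; lra.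
near=> h.
have h0 : 0 < h by [].
have : (davg f y0 (2 * h) < (eta / (4 * C))%:E)%E by near: h.
have h2 : 0 <= 2 * h by lra.
rewrite /davg /iavg lebesgue_measure_ball// inver mulrn_eq0 /= gt_eqF; last by lra.
set I := (\int[mu]_(y in ball y0 (2 * h)) _)%E => hI.
have mfb (A : set T) : measurable A -> measurable_fun A (fun y : T => `|f y - f y0|%:E).
  move=> mA; apply/measurable_EFinP; apply: measurableT_comp => //.
  by apply: measurable_funB => //; exact: measurable_funS mf.
have IE : I = (\int[mu]_(y in ball y0 (2 * h)) `|f y - f y0|%:E)%E by [].
have mb : measurable (ball y0 (2 * h) : set T) by exact: measurable_ball.
have mm : measurable_fun [set: T] (fun y : T => moll h y0 y).
  by apply: continuous_measurable_fun; apply: smooth_continuous; exact: smooth_moll.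
apply: (@le_trans _ _ (\int[mu]_y ((f y0)%:E * (moll h y0 y)%:E +
   (C / h)%:E * ((fun y : T => `|f y - f y0|%:E) \_ (ball y0 (2 * h))) y))%E).
  apply: ge0_le_integral => //.
  - by move=> y _; rewrite lee_fin mulr_ge0// moll_ge0.
  - by apply: emeasurable_funM; exact/measurable_EFinP.
  - apply: emeasurable_funD.
      by apply: emeasurable_funM => //; exact/measurable_EFinP.
    apply: emeasurable_funM => //.
    by apply/(measurable_restrictT _ mb); exact: mfb.
  - move=> y _; rewrite patchE; case: ifPn => yb.
      rewrite -!EFinM -EFinD lee_fin.
      have m0 := moll_ge0 y0 y h0.
      have mC : moll h y0 y <= C / h by rewrite /moll mulrC ler_wpM2r// invr_ge0 ltW.
      have := ler_norm (f y - f y0); have := normr_ge0 (f y - f y0); nra.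
    have -> : moll h y0 y = 0.
      apply: moll_supp => //; apply: contra yb => /andP[a b].
      by rewrite inE /ball /= ler0_norm; lra.
    by rewrite mul0e !mule0 adde0.
rewrite ge0_integralD//; last 4 first.
- by move=> y _; rewrite lee_fin mulr_ge0// moll_ge0.
- by apply: emeasurable_funM => //; exact/measurable_EFinP.
- move=> y _; apply: mule_ge0; first by rewrite lee_fin divr_ge0// ltW.
  by rewrite patchE; case: ifPn; rewrite ?lee_fin.
- by apply: emeasurable_funM => //; apply/(measurable_restrictT _ mb); exact: mfb.
rewrite ge0_integralZl//; last 3 first.
- exact/measurable_EFinP.
- by move=> y _; rewrite lee_fin moll_ge0.
- by rewrite lee_fin.
rewrite integral_moll// mule1 EFinD leeD2l//.
rewrite ge0_integralZl//; last 3 first.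
- by apply/(measurable_restrictT _ mb); exact: mfb.
- by move=> y _; rewrite patchE; case: ifPn; rewrite ?lee_fin.
- by rewrite lee_fin divr_ge0// ltW.
rewrite -integral_mkcond -IE.
have I0 : (0 <= I)%E by apply: integral_ge0 => y _; rewrite lee_fin.
have If : I \is a fin_num.
  rewrite ge0_fin_numE// ltey; apply/eqP => Ioo; move: hI; rewrite Ioo.
  by rewrite gt0_muley ?lte_fin ?invr_gt0 ?mulrn_wgt0//; lra.
move: hI; rewrite -(fineK If) -!EFinM lte_fin lee_fin => hI.
have hp : 0 < h * 4 by lra.
have E : (2 * h *+ 2) = h * 4 by ring.
move: hI; rewrite E mulrC ltr_pdivrMr// => hI.
apply: (@le_trans _ _ (C / h * (eta / (4 * C) * (h * 4)))).
  by apply: ler_wpM2l; [rewrite divr_ge0 ?ltW|exact: ltW].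
by rewrite le_eqVlt; apply/orP; left; apply/eqP; field; rewrite !gt_eqF.
Unshelve. all: end_near. Qed.

End ACL.

(** * Weak gradients under restriction and coordinate swap *)

Section Sob.
Variable R : realType.
Local Notation T := (measurableTypeR R).
Local Notation P := (T * T)%type.
Local Notation mu := (@lebesgue_measure R).
Local Notation leb2 := (mu \x mu)%E.
Implicit Types (O U K : set (R * R)) (phi : R * R -> R).

Lemma compact_closed_plane K : compact K -> closed K.
Proof. by apply: compact_closed; exact: norm_hausdorff. Qed.

Lemma test_facts O phi : test_function O phi ->
  [/\ continuous phi, continuous (d1 phi), continuous (d2 phi),
      (forall p, derivable phi p (1, 0) /\ derivable phi p (0, 1)) &
   exists K, [/\ compact K, K `<=` O &
     forall p, ~ K p -> [/\ phi p = 0, d1 phi p = 0 & d2 phi p = 0]]].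
Proof.
move=> [sphi [K [cK [KO phi0]]]].
have [c [dv [[c1 _] [c2 _]]]] := sphi 1%N.
split=> //; exists K; split=> // p nK.
(* Off the closed set K the function is locally zero, so its derivatives vanish there as well. *)
have nz : \forall q \near p, cst 0 q = phi q.
  have oK : open (~` K) by apply: closed_openC; exact: compact_closed_plane.
  by near=> q; rewrite phi0//; near: q; exact: open_nbhs_nbhs.
split; first exact: phi0.
- by rewrite /d1 -(near_eq_derive _ nz) derive_cst.
- by rewrite /d2 -(near_eq_derive _ nz) derive_cst.
Unshelve. all: end_near. Qed.

(** A test function in U is also one in O, and all the integrands vanish off its support. *)
Lemma sob_sub O U v g : open U -> U `<=` O -> sob O v g -> sob U v g.
Proof.
move=> oU UO [oO cv [m1 [m2 [i1 [i2 wk]]]]].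
have mO : measurable (O : set P) by exact: open_measurable_plane.
have mU : measurable (U : set P) by exact: open_measurable_plane.
have sq (f : P -> R) : measurable_fun (O : set P) (f : P -> T) ->
  (\int[leb2]_(p in O) (f p ^+ 2)%:E < +oo -> \int[leb2]_(p in U) (f p ^+ 2)%:E < +oo)%E.
  move=> mf; apply: le_lt_trans; apply: ge0_subset_integral => //.
    by apply/measurable_EFinP; exact: measurable_funX.
  by move=> p _; rewrite lee_fin sqr_ge0.
split=> //.
  by move=> p /[!inE] /UO Op; apply: cv; rewrite inE.
split; first exact: measurable_funS m1.
split; first exact: measurable_funS m2.
split; first exact: (sq (fun p => (g p).1)).
split; first exact: (sq (fun p => (g p).2)).
move=> phi tphi.
have tphiO : test_function O phi.
  by case: tphi => ? [K [? [KU ?]]]; split=> //; exists K; split=> //; split=> //; exact: subset_trans UO.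
have [_ _ _ _ [K [_ KU K0]]] := test_facts tphi.
have sw (f : P -> R) : (forall p, ~ K p -> f p = 0) ->
  (\int[leb2]_(p in U) (f p)%:E = \int[leb2]_(p in O) (f p)%:E)%E.
  move=> f0; rewrite integral_supp; last first.
    by move=> p np; rewrite f0// => Kp; apply: np; exact: KU.
  rewrite [RHS]integral_supp// => p np; rewrite f0// => Kp; apply: np.
  by apply: UO; apply: KU.
have [w1 w2] := wk _ tphiO.
split; [move: w1|move: w2]; rewrite -!(sw (fun p : P => _ * _)) //.
- by move=> p /K0[-> _ _]; rewrite mulr0.
- by move=> p /K0[_ -> _]; rewrite mulr0.
- by move=> p /K0[-> _ _]; rewrite mulr0.
- by move=> p /K0[_ _ ->]; rewrite mulr0.
Qed.

Lemma derive_pswap phi p (l : R) :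
  (is_derive (pswap p) (0, 1) phi l -> is_derive p (1, 0) (phi \o @pswap R) l) *
  (is_derive (pswap p) (1, 0) phi l -> is_derive p (0, 1) (phi \o @pswap R) l).
Proof.
by split=> h; [apply/derive_slice1; move/derive_slice2 : h|apply/derive_slice2; move/derive_slice1 : h].
Qed.

Lemma pswap_continuous : continuous (@pswap R : R * R -> R * R).
Proof.
move=> p A /nbhs_obox[e e0 eA]; apply/nbhs_obox; exists e => // q /oboxP[a b].
by apply: eA; apply/oboxP.
Qed.

Lemma d1_pswap phi p : derivable phi (pswap p) (0, 1) -> d1 (phi \o @pswap R) p = d2 phi (pswap p).
Proof. by move=> d; case: ((derive_pswap phi p (d2 phi (pswap p))).1 (DeriveDef d erefl)). Qed.

Lemma d2_pswap phi p : derivable phi (pswap p) (1, 0) -> d2 (phi \o @pswap R) p = d1 phi (pswap p).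
Proof. by move=> d; case: ((derive_pswap phi p (d1 phi (pswap p))).2 (DeriveDef d erefl)). Qed.

Lemma Ck_pswap k phi : Ck k phi -> Ck k (phi \o @pswap R).
Proof.
elim: k phi => [|k IH] phi /=.
  by move=> [c _]; split=> // p; apply: continuous_comp; [exact: pswap_continuous|exact: c].
move=> [c [dv [c1 c2]]]; split.
  by move=> p; apply: continuous_comp; [exact: pswap_continuous|exact: c].
have D1 (p : R * R) : is_derive p (1, 0) (phi \o @pswap R) ((d2 phi \o @pswap R) p).
  by apply/(derive_pswap _ _ _).1; exact: (DeriveDef (dv (pswap p)).2 erefl).
have D2 (p : R * R) : is_derive p (0, 1) (phi \o @pswap R) ((d1 phi \o @pswap R) p).
  by apply/(derive_pswap _ _ _).2; exact: (DeriveDef (dv (pswap p)).1 erefl).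
split; first by move=> p; split; [case: (D1 p)|case: (D2 p)].
have -> : d1 (phi \o @pswap R) = d2 phi \o @pswap R.
  by apply/funext => p; case: (D1 p).
have -> : d2 (phi \o @pswap R) = d1 phi \o @pswap R.
  by apply/funext => p; case: (D2 p).
by split; apply: IH.
Qed.

Lemma open_pswap O : open O -> open (@pswap R @^-1` O).
Proof. by move=> oO; apply: open_comp => // p _; exact: pswap_continuous. Qed.

Lemma sob_pswap O v g : sob O v g ->
  sob (@pswap R @^-1` O) (v \o @pswap R) (@pswap R \o g \o @pswap R).
Proof.
move=> [oO cv [m1 [m2 [i1 [i2 wk]]]]].
have mO : measurable (O : set P) by exact: open_measurable_plane.
have oO' := open_pswap oO.
have mv : measurable_fun (O : set P) (v : P -> T) by exact: continuous_measurable_plane.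
have mO' : measurable (@pswap R @^-1` O : set P) by exact: open_measurable_plane.
have msw (f : P -> T) : measurable_fun (O : set P) f -> measurable_fun (@pswap R @^-1` O : set P) (f \o @pswap R).
  move=> mf; apply: (measurable_comp mO _ mf) => //; first by move=> _ [p Op <-].
  by apply: measurable_funTS; exact: measurable_pswap.
split=> //.
  move=> p /[!inE] Op; apply: continuous_comp; first exact: pswap_continuous.
  by apply: cv; rewrite inE.
have mm1 := msw _ m1; have mm2 := msw _ m2.
have sq (f : P -> R) : measurable_fun (O : set P) (f : P -> T) ->
  (\int[leb2]_(p in O) (f p)%:E = \int[leb2]_(p in @pswap R @^-1` O) (f (pswap p))%:E)%E.
  by move=> mf; rewrite -(integral_pswap mO)//; exact/measurable_EFinP.
split; first exact: mm2.
split; first exact: mm1.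
split; first by rewrite /= -(sq (fun p => (g p).2 ^+ 2))//; exact: measurable_funX.
split; first by rewrite /= -(sq (fun p => (g p).1 ^+ 2))//; exact: measurable_funX.
move=> phi tphi; have [c c1 c2 dv [K [cK KO K0]]] := test_facts tphi.
have mcs (f : R * R -> R) : continuous f -> measurable_fun (O : set P) (f \o @pswap R : P -> T).
  move=> cf; apply: continuous_measurable_plane => // p _.
  by apply: continuous_comp; [exact: pswap_continuous|exact: cf].
have ts : test_function O (phi \o @pswap R).
  case: tphi => sphi _; split; first by move=> k; exact: Ck_pswap.
  exists (@pswap R @` K); split.
    by apply: continuous_compact => //; apply: continuous_subspaceT; exact: pswap_continuous.
  split; first by move=> _ [p Kp <-]; have := KO _ Kp.
  move=> p np; have nK : ~ K (pswap p).
    by move=> Kp; apply: np; exists (pswap p) => //; exact: pswapK.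
  by have [e _ _] := K0 _ nK.
have [w1 w2] := wk _ ts.
have m3 := measurable_funM mv (mcs _ c1); have m4 := measurable_funM mv (mcs _ c2).
have m5 := measurable_funM m1 (mcs _ c); have m6 := measurable_funM m2 (mcs _ c).
have sqe (f h : P -> R) : measurable_fun (O : set P) (f : P -> T) -> (forall p, h p = f (pswap p)) ->
  (\int[leb2]_(p in @pswap R @^-1` O) (h p)%:E = \int[leb2]_(p in O) (f p)%:E)%E.
  by move=> mf hf; rewrite sq//; apply: eq_integral => p _; rewrite hf.
have f1 := sqe _ (fun p => v (pswap p) * d1 phi p) m3; have f2 := sqe _ (fun p => v (pswap p) * d2 phi p) m4.
have f3 := sqe _ (fun p => (g (pswap p)).1 * phi p) m5; have f4 := sqe _ (fun p => (g (pswap p)).2 * phi p) m6.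
split.
- transitivity (\int[leb2]_(p in O) (v p * d1 phi (pswap p))%:E)%E; first by apply: f1 => p /=; rewrite pswapK.
  transitivity (\int[leb2]_(p in O) (v p * d2 (phi \o @pswap R) p)%:E)%E.
    by apply: eq_integral => p _; rewrite (d2_pswap (dv (pswap p)).1).
  transitivity (- \int[leb2]_(p in O) ((g p).2 * phi (pswap p))%:E)%E; first exact: w2.
  by congr (- _)%E; apply/esym/f4 => p /=; rewrite pswapK.
- transitivity (\int[leb2]_(p in O) (v p * d2 phi (pswap p))%:E)%E; first by apply: f2 => p /=; rewrite pswapK.
  transitivity (\int[leb2]_(p in O) (v p * d1 (phi \o @pswap R) p)%:E)%E.
    by apply: eq_integral => p _; rewrite (d1_pswap (dv (pswap p)).2).
  transitivity (- \int[leb2]_(p in O) ((g p).1 * phi (pswap p))%:E)%E; first exact: w1.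
  by congr (- _)%E; apply/esym/f3 => p /=; rewrite pswapK.
Qed.

End Sob.

Section ACL.
Variable R : realType.
Local Notation T := (measurableTypeR R).
Local Notation P := (T * T)%type.
Local Notation mu := (@lebesgue_measure R).
Local Notation leb2 := (mu \x mu)%E.

Lemma sob_near O (v : R * R -> R) g p (eta : R) : sob O v g -> O p -> 0 < eta ->
  \forall h \near (0:R)^'+, forall x y, p.1 <= x <= p.1 + h -> p.2 <= y <= p.2 + h ->
    `|v (x, y) - v p| <= eta.
Proof.
move=> [_ cv _] Op eta0.
have := cv p; rewrite inE => /(_ Op) /cvgrPdist_le /(_ _ eta0) /nbhs_obox[e e0 he].
near=> h => x y xh yh; rewrite distrC; apply: he; apply/oboxP => /=.
have he' : h < e by near: h; exact: nbhs_right_lt.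
by rewrite !ler0_norm; lra.
Unshelve. all: end_near. Qed.

(** At heights that are Lebesgue points of the row integral, h tends to 0 in [acl_moll]: the
    averages of v become values of v, and the mollified row integrals become at most [Gr y]. The
    exceptional null set of heights is independent of s and t. *)
Lemma acl (O : set (R * R)) (v : R * R -> R) (g : R * R -> R * R) :
  sob O v g -> (\int[leb2]_(p in (O : set P)) (`|(g p).1|)%:E < +oo)%E ->
  exists Gr : R -> R, [/\ measurable_fun [set: T] (Gr : T -> T), forall y, 0 <= Gr y,
    (\int[mu]_y (Gr y)%:E = \int[leb2]_(p in O) (`|(g p).1|)%:E)%E &
    {ae mu, forall y : T, forall s t : R, s <= t -> (forall x, s <= x <= t -> O (x, y)) ->
       `|v (s, y) - v (t, y)| <= Gr y}].
Proof.
move=> sO gi; have [oO cv [m1 _]] := sO.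
have mO : measurable (O : set P) by exact: open_measurable_plane.
have mg1 : measurable_fun (O : set P) (fun p : P => (g p).1 : T) by exact: m1.
have mag : measurable_fun (O : set P) (fun p : P => (`|(g p).1|)%:E).
  by apply/measurable_EFinP; exact: (measurableT_comp (@normr_measurable R setT) mg1).
pose F := (fun p : P => `|(g p).1|%:E) \_ O.
have mF : measurable_fun [set: P] F by exact: (measurable_restrictT _ mO).1 mag.
have F0 p : (0 <= F p)%E by rewrite /F patchE; case: ifPn; rewrite ?lee_fin.
have mG : measurable_fun [set: T] (rowint O g) 
  by apply: (measurable_fun_fubini_tonelli_G (m1 := mu) F).
have G0 y : (0 <= rowint O g y)%E by apply: integral_ge0 => x _; exact: F0.
have iG : (\int[mu]_y rowint O g y = \int[leb2]_(p in O) (`|(g p).1|)%:E)%E.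
  by rewrite tonelli_sec// => p _; rewrite lee_fin.
have Gi : mu.-integrable [set: T] (rowint O g).
  by apply/integrableP; split=> //; under eq_integral do rewrite gee0_abs//; rewrite iG.
have [N [mN N0 hN]] := integrable_ae measurableT Gi.
have fin : {ae mu, forall y : T, rowint O g y = (fine (rowint O g y))%:E}.
  exists N; split=> // y /= ny; apply: hN => /= h; apply: ny.
  by rewrite fineK//; exact: h.
have mGr : measurable_fun [set: T] (fun y => fine (rowint O g y) : T).
  exact: measurableT_comp.
have Gr0 y : 0 <= fine (rowint O g y) by exact: fine_ge0.
have mEGr : measurable_fun [set: T] (fun y => (fine (rowint O g y))%:E).
  exact/measurable_EFinP.
have iGr : (\int[mu]_y (fine (rowint O g y))%:E = \int[leb2]_(p in O) (`|(g p).1|)%:E)%E.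
  rewrite -iG; apply: ge0_ae_eq_integral => //; first by move=> y _; rewrite lee_fin.
  by apply: filterS fin => y e _; rewrite -e.
exists (fun y => fine (rowint O g y)); split=> //.
have lp : {ae mu, forall y : T, lebesgue_pt (fun y => fine (rowint O g y)) y}.
  apply: lebesgue_differentiation; apply: open_integrable_locally; first exact: openT.
  apply/integrableP; split=> //.
  by under eq_integral do rewrite gee0_abs ?lee_fin//; rewrite iGr.
apply: (@filterS _ _ (ae_filter_ringOfSetsType mu)) lp => y0 ly s t st sOy.
apply/ler_addgt0Pr => e e0.
have e3 : 0 < e / 3 by rewrite divr_gt0.
have Os : O (s, y0) by apply: sOy; rewrite lexx.
have Ot : O (t, y0) by apply: sOy; rewrite lexx andbT.
have n1 := segment_tube oO st sOy.
have n2 := sob_near sO Os e3.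
have n3 := sob_near sO Ot e3.
have n4 := lebesgue_moll mGr Gr0 ly e3.
have [h [h0 KO vs vt im]] : exists h : R, [/\ 0 < h, `[s, t + h] `*` `[y0, y0 + h] `<=` O,
    (forall x y, s <= x <= s + h -> y0 <= y <= y0 + h -> `|v (x, y) - v (s, y0)| <= e / 3),
    (forall x y, t <= x <= t + h -> y0 <= y <= y0 + h -> `|v (x, y) - v (t, y0)| <= e / 3) &
    (\int[mu]_y ((moll h y0 y)%:E * (fine (rowint O g y))%:E) <=
       (fine (rowint O g y0) + e / 3)%:E)%E].
  near (0:R)^'+ => h; exists h; split; [by []|by near: h..].
have mm : measurable_fun [set: T] (fun y : T => (moll h y0 y)%:E).
  apply/measurable_EFinP; apply: continuous_measurable_fun; apply: smooth_continuous; exact: smooth_moll.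
have := acl_moll sO st h0 KO vs vt.
(* The row integral may be infinite on a null set of rows; the integral does not distinguish it from
   its finite representative. *)
have -> : (\int[mu]_y ((moll h y0 y)%:E * rowint O g y) =
    \int[mu]_y ((moll h y0 y)%:E * (fine (rowint O g y))%:E))%E.
  apply: ge0_ae_eq_integral => //.
  - exact: emeasurable_funM.
  - exact: emeasurable_funM.
  - by move=> y _; rewrite mule_ge0// lee_fin moll_ge0.
  - by move=> y _; rewrite mule_ge0// lee_fin// moll_ge0.
  - by apply: filterS fin => y e' _; rewrite -e'.
move=> /le_trans/(_ (leeD (lexx _) im)); rewrite -EFinD lee_fin; lra.
Unshelve. all: end_near. Qed.

End ACL.

(** * Functions of small energy *)

Section Rows.
Variable R : realType.
Local Notation T := (measurableTypeR R).
Local Notation P := (T * T)%type.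
Local Notation mu := (@lebesgue_measure R).
Local Notation leb2 := (mu \x mu)%E.
Implicit Types (A B I J : set T).

Local Open Scope ereal_scope.

Lemma measurable_row (F : P -> \bar R) y : measurable_fun [set: P] F ->
  measurable_fun [set: T] (fun x : T => F (x, y)).
Proof. by move=> mF; exact: (measurableT_comp mF (pair2_measurable y)). Qed.

(** By Tonelli, an inequality on almost every row can be integrated over the rectangle; this is how
    the conclusion of [acl] is used. *)
Lemma ae_rows_le A B (f1 f2 : P -> \bar R) : measurable A -> measurable B ->
  measurable_fun (A `*` B) f1 -> measurable_fun (A `*` B) f2 ->
  (forall p, (A `*` B) p -> 0 <= f1 p) -> (forall p, (A `*` B) p -> 0 <= f2 p) ->
  {ae mu, forall y : T, B y -> forall x, A x -> f1 (x, y) <= f2 (x, y)} ->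
  \int[leb2]_(p in A `*` B) f1 p <= \int[leb2]_(p in A `*` B) f2 p.
Proof.
move=> mA mB mf1 mf2 f10 f20 ae12.
have mAB : measurable (A `*` B : set P) by exact: measurableX.
have mF1 := (measurable_restrictT _ mAB).1 mf1.
have mF2 := (measurable_restrictT _ mAB).1 mf2.
have F0 (f : P -> \bar R) : (forall p, (A `*` B) p -> 0 <= f p) -> forall p, 0 <= (f \_ (A `*` B)) p.
  by move=> f0 p; rewrite patchE; case: ifPn => // /[!inE]; exact: f0.
rewrite (tonelli_sec mAB mf1 f10) (tonelli_sec mAB mf2 f20); apply: ae_ge0_le_integral => //.
- by move=> y _; apply: integral_ge0 => x _; exact: F0.
- by apply: (measurable_fun_fubini_tonelli_G (m1 := mu) (f1 \_ (A `*` B))) => // p; exact: F0.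
- by move=> y _; apply: integral_ge0 => x _; exact: F0.
- by apply: (measurable_fun_fubini_tonelli_G (m1 := mu) (f2 \_ (A `*` B))) => // p; exact: F0.
apply: (@filterS _ _ (ae_filter_ringOfSetsType mu)) ae12 => y h _.
apply: ge0_le_integral => //.
- by move=> x _; exact: F0.
- exact: measurable_row.
- exact: measurable_row.
- move=> x _; rewrite !patchE; case: ifPn => // /[!inE] -[Ax By]; exact: h.
Qed.

Lemma int_row A B (H : T -> \bar R) : measurable A -> measurable B ->
  measurable_fun [set: T] H -> (forall y, 0 <= H y) ->
  \int[leb2]_(p in A `*` B) H p.2 = mu A * \int[mu]_(y in B) H y.
Proof.
move=> mA mB mH H0.
rewrite (tonelli_rect (f := fun p : P => H p.2))//=; last first.
  apply: measurable_funTS; exact: (measurableT_comp mH (@measurable_snd _ _ T T)).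
under eq_integral => y _ do rewrite integral_cst//.
by rewrite ge0_integralZr 1?muleC//; exact: measurable_funTS.
Qed.

End Rows.

(** * From bounds on lines to integrals over strips of a box *)

Section Strips.
Variable R : realType.
Local Notation T := (measurableTypeR R).
Local Notation P := (T * T)%type.
Local Notation mu := (@lebesgue_measure R).
Local Notation leb2 := (mu \x mu)%E.
Implicit Types (O U : set (R * R)) (v : R * R -> R) (g : R * R -> R * R).

Definition xint (x : R * R) (r : R) : set R := `]x.1 - r, x.1 + r[%classic.
Definition yint (x : R * R) (r : R) : set R := `]x.2 - r, x.2 + r[%classic.

Lemma leb_int (c r : R) : 0 < r -> mu `]c - r, c + r[ = (2 * r)%:E.
Proof.
move=> r0; rewrite lebesgue_measure_itv /= lte_fin ifT; last by lra.
by rewrite -EFinB; congr EFin; lra.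
Qed.

Lemma leb2_obox x r : 0 < r -> leb2 (obox x r) = ((2 * r) * (2 * r))%:E.
Proof. by move=> r0; rewrite leb2_rect// !leb_int. Qed.

(** Pointwise |f| <= eta + f^2/eta: a form of Cauchy-Schwarz with a free parameter, enough to make
    the L1 norm small along with the energy. *)
Lemma L1_le (A : set P) (f : P -> R) (eta : R) : measurable A -> measurable_fun A (f : P -> T) -> 0 < eta ->
  (\int[leb2]_(p in A) `|f p|%:E <= eta%:E * leb2 A + (eta^-1)%:E * \int[leb2]_(p in A) (f p ^+ 2)%:E)%E.
Proof.
move=> mA mf eta0.
have msq : measurable_fun A (fun p => (f p ^+ 2)%:E) by apply/measurable_EFinP; exact: measurable_funX.
rewrite -integral_cst// -ge0_integralZl//; last 2 first.
- by move=> p _; rewrite lee_fin sqr_ge0.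
- by rewrite lee_fin invr_ge0 ltW.
rewrite -ge0_integralD//; last 3 first.
- by move=> p _; rewrite lee_fin ltW.
- by move=> p _; rewrite mule_ge0// lee_fin ?sqr_ge0// invr_ge0 ltW.
- exact: emeasurable_funM.
apply: ge0_le_integral => //.
- by apply/measurable_EFinP; exact: measurableT_comp.
- by apply: emeasurable_funD => //; exact: emeasurable_funM.
move=> p _; rewrite -EFinM -EFinD lee_fin -real_normK ?num_real//.
rewrite -subr_ge0; have -> : eta + eta^-1 * `|f p| ^+ 2 - `|f p| =
   eta^-1 * ((`|f p| - eta / 2) ^+ 2 + 3 / 4 * eta ^+ 2) by field; rewrite gt_eqF.
by rewrite mulr_ge0 ?invr_ge0 ?addr_ge0 ?sqr_ge0// ?(ltW eta0)// mulr_ge0 ?sqr_ge0//; lra.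
Qed.

Lemma sob_L1 O v g : sob O v g -> (leb2 O < +oo)%E ->
  (\int[leb2]_(p in (O : set P)) (`|(g p).1|)%:E < +oo)%E.
Proof.
move=> [oO cv [m1 [m2 [i1 [i2 wk]]]]] fO.
have mO : measurable (O : set P) by exact: open_measurable_plane.
apply: (le_lt_trans (L1_le mO (m1 : measurable_fun (O : set P) (fun p : P => (g p).1 : T)) ltr01)).
rewrite invr1 !mul1e; apply: lte_add_pinfty => //; exact: i1.
Qed.

Section OneStrip.
Variables (x : R * R) (r : R) (r0 : 0 < r).
Let B := obox x r.
Let I := xint x r.
Let J := yint x r.

Let mI : measurable (I : set T). Proof. exact: measurable_itv. Qed.
Let mJ : measurable (J : set T). Proof. exact: measurable_itv. Qed.
Let mB : measurable (B : set P). Proof. exact: measurableX. Qed.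
Let muI : mu I = (2 * r)%:E. Proof. exact: leb_int. Qed.
Let fB : (leb2 B < +oo)%E. Proof. by rewrite leb2_obox ?ltry. Qed.

Lemma obox_row v g : sob B v g -> exists G : R -> R, 
  [/\ measurable_fun [set: T] (G : T -> T), forall y, 0 <= G y,
    (\int[mu]_y (G y)%:E = \int[leb2]_(p in B) (`|(g p).1|)%:E)%E &
    {ae mu, forall y : T, forall s t, J y -> I s -> I t -> v (s, y) <= v (t, y) + G y}].
Proof.
move=> sB; have [G [mG G0 iG aeG]] := acl sB (sob_L1 sB fB).
exists G; split=> //.
apply: (@filterS _ _ (ae_filter_ringOfSetsType mu)) aeG => y h s t Jy Is It.
have st a b : I a -> I b -> a <= b -> `|v (a, y) - v (b, y)| <= G y.
  move=> Ia Ib ab; apply: h => // z /andP[az zb]; split=> //=.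
  by move: Ia Ib; rewrite /I /xint /= !in_itv /= => /andP[? ?] /andP[? ?]; apply/andP; split; lra.
have [/(st _ _ Is It)|/ltW/(st _ _ It Is)] := leP s t; rewrite ler_norml => /andP[]; lra.
Qed.

Let Bsub (A1 A2 : set T) : A1 `<=` I -> A2 `<=` J -> A1 `*` A2 `<=` B.
Proof. by move=> h1 h2 p [/h1 ? /h2 ?]. Qed.

Let mvB v g A1 A2 : sob B v g -> measurable (A1 : set T) -> measurable (A2 : set T) ->
  A1 `<=` I -> A2 `<=` J -> measurable_fun (A1 `*` A2 : set P) (fun p => (v p)%:E).
Proof.
move=> [oB cv _] m1 m2 h1 h2; apply/measurable_EFinP.
apply: (@measurable_funS _ _ _ _ B) => //; first exact: Bsub.
exact: continuous_measurable_plane.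
Qed.

(** On almost every row v (s, y) <= v (t, y) + G y. Averaging over t in A and integrating over s in
    I and y in J' spreads a bound from the columns over A to the full width of the box. *)
Lemma strip1 v g (A J' : set T) : sob B v g -> (forall p, B p -> 0 <= v p) ->
  measurable A -> A `<=` I -> measurable J' -> J' `<=` J ->
  (mu A * \int[leb2]_(p in (I : set T) `*` J') (v p)%:E <=
   mu I * (\int[leb2]_(p in A `*` J') (v p)%:E + mu A * \int[leb2]_(p in B) (`|(g p).1|)%:E))%E.
Proof.
move=> sB v0 mA AI mJ' JJ; have [G [mG G0 iG aeG]] := obox_row sB.
have mv1 := mvB sB mA mJ' AI JJ.
have mv2 := mvB sB mI mJ' (@subset_refl _ I) JJ.
have mAJ : measurable (A `*` J' : set P) by exact: measurableX.
pose F := (fun p => (v p)%:E) \_ (A `*` J').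
have F0 p : (0 <= F p)%E.
  by rewrite /F patchE; case: ifPn => // /[!inE] /(Bsub AI JJ) /v0; rewrite lee_fin.
have mF : measurable_fun [set: P] F by exact: (measurable_restrictT _ mAJ).1 mv1.
pose Phi (y : T) := (\int[mu]_z F (z, y))%E.
have mPhi : measurable_fun [set: T] Phi by apply: (measurable_fun_fubini_tonelli_G (m1 := mu) F).
have Phi0 y : (0 <= Phi y)%E by apply: integral_ge0 => z _; exact: F0.
have iPhi : (\int[mu]_(y in J') Phi y = \int[leb2]_(p in A `*` J') (v p)%:E)%E.
  rewrite tonelli_sec//; last by move=> p /(Bsub AI JJ)/v0; rewrite lee_fin.
  apply: integral_supp => y nJ; rewrite /Phi integral0_eq// => z _.
  by rewrite /F patchE ifF//; apply/negbTE; rewrite in_setX negb_and (memNset nJ) orbT.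
have mEG : measurable_fun [set: T] (fun y => (G y)%:E) by exact/measurable_EFinP.
have mH : measurable_fun [set: T] (fun y => Phi y + mu A * (G y)%:E)%E.
  by apply: emeasurable_funD => //; exact: emeasurable_funM.
have muA : (mu A < +oo)%E.
  by apply: (@le_lt_trans _ _ (mu I)); [apply: le_measure; rewrite ?inE|rewrite muI ltry].
have muAf : mu A \is a fin_num by rewrite ge0_fin_numE.
rewrite -(fineK muAf) -ge0_integralZl//; last 3 first.
- exact: measurableX.
- by move=> p /(Bsub (@subset_refl _ I) JJ)/v0; rewrite lee_fin.
- by rewrite lee_fin fine_ge0.
apply: (@le_trans _ _ (\int[leb2]_(p in (I : set T) `*` J') (Phi p.2 + mu A * (G p.2)%:E))%E).
  apply: ae_rows_le => //.
  - by apply: emeasurable_funM.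
  - apply: measurable_funTS; exact: (measurableT_comp mH (@measurable_snd _ _ T T)).
  - by move=> p /(Bsub (@subset_refl _ I) JJ)/v0 ?; rewrite mule_ge0// lee_fin// fine_ge0.
  - by move=> p _; rewrite adde_ge0// mule_ge0// lee_fin.
  apply: (@filterS _ _ (ae_filter_ringOfSetsType mu)) aeG => y h Jy z Iz.
  rewrite fineK// muleC -integral_cst//=.
  have -> : Phi y = (\int[mu]_(t in A) (v (t, y))%:E)%E.
    rewrite [RHS]integral_mkcond; apply: eq_integral => t _.
    by rewrite /F !patchE in_setX (mem_set Jy) andbT.
  rewrite [X in (_ + X)%E]muleC -[X in (_ + X)%E]integral_cst//.
  have mvy : measurable_fun A (fun t : T => (v (t, y))%:E).
    have mR := measurable_row y mF.
    apply/(measurable_restrictT _ mA).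
    have -> // : ((fun t : T => (v (t, y))%:E) \_ A) = (fun t => F (t, y)).
    by apply/funext => t; rewrite /F !patchE in_setX (mem_set Jy) andbT.
  have vA t : A t -> 0 <= v (t, y) by move=> At; apply/v0/(Bsub AI JJ).
  rewrite -ge0_integralD//.
  apply: ge0_le_integral => //.
  - by move=> t _; rewrite lee_fin; apply/v0/(Bsub (@subset_refl _ I) JJ).
  - exact: emeasurable_funD.
  - by move=> t At; rewrite -EFinD lee_fin; apply: h => //; [exact: JJ|exact: AI].
  - by move=> t _; rewrite lee_fin.
rewrite (int_row (H := fun y => (Phi y + mu A * (G y)%:E)%E))//; last first.
  by move=> y; rewrite adde_ge0// mule_ge0// lee_fin.
apply: lee_wpmul2l => //.
rewrite ge0_integralD//; last 3 first.
- exact: measurable_funTS.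
- by move=> y _; rewrite mule_ge0// lee_fin.
- by apply: measurable_funTS; exact: emeasurable_funM.
rewrite iPhi leeD2l// fineK// ge0_integralZl//; last 2 first.
- exact: measurable_funTS.
- by move=> y _; rewrite lee_fin.
apply: lee_wpmul2l => //; rewrite -iG.
by apply: ge0_subset_integral => // y _; rewrite lee_fin.
Qed.

(** A zero of v on a row bounds v by G y on that entire row: the starting point of every chain of
    boxes. *)
Lemma seed1 v g (A : set T) : sob B v g -> (forall p, B p -> 0 <= v p) ->
  measurable A -> A `<=` J -> (forall y, A y -> exists2 t, I t & v (t, y) = 0) ->
  (\int[leb2]_(p in (I : set T) `*` A) (v p)%:E <= mu I * \int[leb2]_(p in B) (`|(g p).1|)%:E)%E.
Proof.
move=> sB v0 mA AJ z; have [G [mG G0 iG aeG]] := obox_row sB.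
have mv2 := mvB sB mI mA (@subset_refl _ I) AJ.
have mEG : measurable_fun [set: T] (fun y => (G y)%:E) by exact/measurable_EFinP.
apply: (@le_trans _ _ (\int[leb2]_(p in (I : set T) `*` A) (G p.2)%:E)%E).
  apply: ae_rows_le => //.
  - apply: measurable_funTS; exact: (measurableT_comp mEG (@measurable_snd _ _ T T)).
  - by move=> p /(Bsub (@subset_refl _ I) AJ)/v0; rewrite lee_fin.
  - by move=> p _; rewrite lee_fin.
  apply: (@filterS _ _ (ae_filter_ringOfSetsType mu)) aeG => y h Ay s Is.
  have [t It vt] := z _ Ay; rewrite lee_fin.
  by have := h s t (AJ _ Ay) Is It; rewrite vt add0r.
rewrite (int_row (H := fun y => (G y)%:E))//.
apply: lee_wpmul2l => //; rewrite -iG.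
by apply: ge0_subset_integral => // y _; rewrite lee_fin.
Qed.

(** On each row over A one of the two functions reaches 1, so v + v' + G + G' >= 1 along the whole
    row. Integrated over I x A this opposes small means and small gradients. *)
Lemma cross1 v g v' g' (A : set T) : sob B v g -> sob B v' g' ->
  (forall p, B p -> 0 <= v p) -> (forall p, B p -> 0 <= v' p) ->
  measurable A -> A `<=` J -> (forall y, A y -> exists2 t, I t & 1 <= v (t, y) \/ 1 <= v' (t, y)) ->
  (mu I * mu A <= \int[leb2]_(p in B) (v p)%:E + \int[leb2]_(p in B) (v' p)%:E +
    mu I * (\int[leb2]_(p in B) (`|(g p).1|)%:E + \int[leb2]_(p in B) (`|(g' p).1|)%:E))%E.
Proof.
move=> sB sB' v0 v0' mA AJ z.
have [G [mG G0 iG aeG]] := obox_row sB; have [G' [mG' G0' iG' aeG']] := obox_row sB'.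
have IA : (I : set T) `*` A `<=` B by exact: Bsub.
have mIA : measurable ((I : set T) `*` A : set P) by exact: measurableX.
have mv := mvB sB mI mA (@subset_refl _ I) AJ.
have mv' := mvB sB' mI mA (@subset_refl _ I) AJ.
have mEG : measurable_fun [set: T] (fun y => (G y)%:E) by exact/measurable_EFinP.
have mEG' : measurable_fun [set: T] (fun y => (G' y)%:E) by exact/measurable_EFinP.
have mGs : measurable_fun (I `*` A : set P) (fun p : P => (G p.2)%:E).
  apply: measurable_funTS; exact: (measurableT_comp mEG (@measurable_snd _ _ T T)).
have mGs' : measurable_fun (I `*` A : set P) (fun p : P => (G' p.2)%:E).
  apply: measurable_funTS; exact: (measurableT_comp mEG' (@measurable_snd _ _ T T)).
rewrite -leb2_rect// -[leLHS]mul1e -integral_cst//.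
have w0 p : ((I : set T) `*` A) p -> (0 <= (v p)%:E)%E by move=> /IA/v0; rewrite lee_fin.
have w0' p : ((I : set T) `*` A) p -> (0 <= (v' p)%:E)%E by move=> /IA/v0'; rewrite lee_fin.
have s1 p : ((I : set T) `*` A) p -> (0 <= (v p)%:E + (v' p)%:E)%E.
  by move=> h; rewrite adde_ge0 ?w0 ?w0'.
have s2 (p : P) : ((I : set T) `*` A) p -> (0 <= (G p.2)%:E + (G' p.2)%:E)%E.
  by move=> h; rewrite adde_ge0 ?lee_fin.
apply: (@le_trans _ _ (\int[leb2]_(p in (I : set T) `*` A)
   (((v p)%:E + (v' p)%:E) + ((G p.2)%:E + (G' p.2)%:E)))%E).
  apply: ae_rows_le => //.
  - by apply: emeasurable_funD; exact: emeasurable_funD.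
  - by move=> p h; rewrite adde_ge0 ?s1 ?s2.
  apply: (@filterS2 _ _ (ae_filter_ringOfSetsType mu)) aeG aeG' => y h h' Ay s Is.
  have [t It vt] := z _ Ay; rewrite -!EFinD lee_fin.
  have := h t s (AJ _ Ay) It Is; have := h' t s (AJ _ Ay) It Is.
  have := w0 (s, y) (conj Is Ay); have := w0' (s, y) (conj Is Ay); rewrite !lee_fin.
  by have := G0 y; have := G0' y; case: vt; lra.
rewrite ge0_integralD//.
have mo A1 f : (forall p, B p -> 0 <= f p) -> measurable_fun (B : set P) (f : P -> T) -> A1 `<=` B -> measurable (A1 : set P) ->
  (\int[leb2]_(p in A1) (f p)%:E <= \int[leb2]_(p in B) (f p)%:E)%E.
  move=> f0 mf AB mA1; apply: ge0_subset_integral => //; exact/measurable_EFinP.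
have cm w h : sob B w h -> measurable_fun (B : set P) (w : P -> T).
  by move=> [oB cw _]; exact: continuous_measurable_plane.
apply: leeD.
  rewrite ge0_integralD//; apply: leeD; apply: mo => //; [exact: cm sB|exact: cm sB'].
rewrite ge0_integralD//; last 2 first.
- by move=> p _; rewrite lee_fin.
- by move=> p _; rewrite lee_fin.
rewrite (int_row (H := fun y => (G y)%:E))//.
rewrite (int_row (H := fun y => (G' y)%:E))//.
rewrite -ge0_muleDr ?integral_ge0//; last 2 first.
- by move=> y _; rewrite lee_fin.
- by move=> y _; rewrite lee_fin.
apply: lee_wpmul2l => //; rewrite -iG -iG'; apply: leeD.
  by apply: ge0_subset_integral => // y _; rewrite lee_fin.
by apply: ge0_subset_integral => // y _; rewrite lee_fin.
all: exact: emeasurable_funD.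
Qed.

End OneStrip.
End Strips.

(** * Potentials with small energy have small means *)

Section Small.
Variable R : realType.
Local Notation T := (measurableTypeR R).
Local Notation P := (T * T)%type.
Local Notation mu := (@lebesgue_measure R).
Local Notation leb2 := (mu \x mu)%E.
Implicit Types (O U : set (R * R)) (v : R * R -> R) (g : R * R -> R * R).

Lemma obox_pswap (x : R * R) (r : R) : @pswap R @^-1` obox x r = obox (pswap x) r.
Proof. by apply/seteqP; split=> p [a b]; split. Qed.

Lemma sob_obox_pswap (x : R * R) (r : R) v g : sob (obox x r) v g ->
  sob (obox (pswap x) r) (v \o @pswap R) (@pswap R \o g \o @pswap R).
Proof. by move/sob_pswap; rewrite obox_pswap. Qed.

Lemma integral_rect_pswap (A B : set T) (v : P -> R) : measurable A -> measurable B ->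
  measurable_fun (A `*` B) (v : P -> T) ->
  (\int[leb2]_(p in B `*` A) (v (pswap p))%:E = \int[leb2]_(p in A `*` B) (v p)%:E)%E.
Proof.
move=> mA mB mv.
rewrite -(@integral_pswap R (A `*` B) (fun p => (v p)%:E)); last 2 first.
- exact: measurableX.
- exact/measurable_EFinP.
by congr integral; apply/seteqP; split=> p [a b]; split.
Qed.

Lemma sob_meas O v g : sob O v g -> measurable_fun (O : set P) (v : P -> T).
Proof. by move=> [oB cw _]; exact: continuous_measurable_plane. Qed.

Lemma obox_g2 (x : R * R) (r : R) v g : sob (obox x r) v g ->
  (\int[leb2]_(p in obox (pswap x) r) (`|((@pswap R \o g \o @pswap R) p).1|)%:E =
   \int[leb2]_(p in obox x r) (`|(g p).2|)%:E)%E.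
Proof.
move=> [_ _ [_ [m2 _]]].
have mg2 : measurable_fun (obox x r : set P) (fun p : P => (g p).2 : T) by exact: m2.
apply: (@integral_rect_pswap (xint x r) (yint x r) (fun p => `|(g p).2|)); [exact: measurable_itv..|].
exact: (measurableT_comp (@normr_measurable R setT) mg2).
Qed.

Section OneStrip2.
Variables (x : R * R) (r : R) (r0 : 0 < r).

Let mI : measurable (xint x r : set T). Proof. exact: measurable_itv. Qed.
Let mJ : measurable (yint x r : set T). Proof. exact: measurable_itv. Qed.

Let mvB v g (A1 A2 : set T) : sob (obox x r) v g -> measurable A1 -> measurable A2 ->
  A1 `<=` xint x r -> A2 `<=` yint x r -> measurable_fun (A1 `*` A2 : set P) (v : P -> T).
Proof.
move=> sB m1 m2 h1 h2; apply: (@measurable_funS _ _ _ _ (obox x r)).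
- exact: measurableX.
- by move=> p [/h1 ? /h2 ?].
- exact: sob_meas sB.
Qed.

Lemma strip2 v g (A I' : set T) : sob (obox x r) v g -> (forall p, obox x r p -> 0 <= v p) ->
  measurable A -> A `<=` yint x r -> measurable I' -> I' `<=` xint x r ->
  (mu A * \int[leb2]_(p in I' `*` (yint x r : set T)) (v p)%:E <=
   mu (yint x r) * (\int[leb2]_(p in I' `*` A) (v p)%:E +
      mu A * \int[leb2]_(p in obox x r) (`|(g p).2|)%:E))%E.
Proof.
move=> sB v0 mA AJ mI' II.
have := @strip1 R (pswap x) r r0 _ _ A I' (sob_obox_pswap sB) _ mA AJ mI' II.
rewrite (obox_g2 sB) (integral_rect_pswap mI' mJ) ?(integral_rect_pswap mI' mA).
- by apply => p; rewrite -obox_pswap => /v0.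
- exact: mvB sB _ _ _ _.
- exact: mvB sB _ _ _ _.
Qed.

Lemma seed2 v g (A : set T) : sob (obox x r) v g -> (forall p, obox x r p -> 0 <= v p) ->
  measurable A -> A `<=` xint x r -> (forall s, A s -> exists2 t, yint x r t & v (s, t) = 0) ->
  (\int[leb2]_(p in A `*` (yint x r : set T)) (v p)%:E <=
   mu (yint x r) * \int[leb2]_(p in obox x r) (`|(g p).2|)%:E)%E.
Proof.
move=> sB v0 mA AJ z.
have := @seed1 R (pswap x) r r0 _ _ A (sob_obox_pswap sB) _ mA AJ z.
rewrite (obox_g2 sB) (integral_rect_pswap mA mJ).
- by apply => p; rewrite -obox_pswap => /v0.
- exact: mvB sB _ _ _ _.
Qed.

Lemma cross2 v g v' g' (A : set T) : sob (obox x r) v g -> sob (obox x r) v' g' ->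
  (forall p, obox x r p -> 0 <= v p) -> (forall p, obox x r p -> 0 <= v' p) ->
  measurable A -> A `<=` xint x r ->
  (forall s, A s -> exists2 t, yint x r t & 1 <= v (s, t) \/ 1 <= v' (s, t)) ->
  (mu (yint x r) * mu A <=
    \int[leb2]_(p in obox x r) (v p)%:E + \int[leb2]_(p in obox x r) (v' p)%:E +
    mu (yint x r) * (\int[leb2]_(p in obox x r) (`|(g p).2|)%:E +
                     \int[leb2]_(p in obox x r) (`|(g' p).2|)%:E))%E.
Proof.
move=> sB sB' v0 v0' mA AJ z.
have := @cross1 R (pswap x) r r0 _ _ _ _ A (sob_obox_pswap sB) (sob_obox_pswap sB') _ _ mA AJ z.
rewrite (obox_g2 sB) (obox_g2 sB').
have E w h : sob (obox x r) w h ->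
  (\int[leb2]_(p in obox (pswap x) r) ((w \o @pswap R) p)%:E = \int[leb2]_(p in obox x r) (w p)%:E)%E.
  by move=> sw; apply: (integral_rect_pswap mI mJ); exact: sob_meas sw.
rewrite (E _ _ sB) (E _ _ sB').
by apply=> p; rewrite -obox_pswap; [exact: v0|exact: v0'].
Qed.

End OneStrip2.

Definition energy O g : \bar R :=
  (\int[leb2]_(p in (O : set P)) (((g p).1) ^+ 2 + ((g p).2) ^+ 2)%:E)%E.

Definition small_class (F0 O : set (R * R)) v g :=
  [/\ forall p, O p -> 0 <= v p, sob O v g &
      exists U, [/\ open U, F0 `<=` U & forall p, U p -> O p -> v p = 0]].

(** Uniformity in v is essential: the admissible functions change with the curve, while the bound on
    the energy may depend on the place only. *)
Definition nul (F0 O : set (R * R)) (A : set P) := forall e : R, 0 < e ->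
  exists2 d : R, 0 < d & forall v g, small_class F0 O v g ->
    (energy O g < d%:E)%E -> (\int[leb2]_(p in A) (v p)%:E <= e%:E)%E.

Lemma L1_small O U (e : R) : open U -> U `<=` O -> (leb2 U < +oo)%E -> 0 < e ->
  exists2 d : R, 0 < d & forall v g, sob O v g -> (energy O g < d%:E)%E ->
   (\int[leb2]_(p in (U : set P)) (`|(g p).1|)%:E <= e%:E)%E /\
   (\int[leb2]_(p in (U : set P)) (`|(g p).2|)%:E <= e%:E)%E.
Proof.
move=> oU UO fU e0.
have mU : measurable (U : set P) by exact: open_measurable_plane.
have [M M0 hM] : exists2 M : R, 0 <= M & leb2 U = M%:E.
  exists (fine (leb2 U)); first exact: fine_ge0.
  by rewrite fineK// ge0_fin_numE.
(* With this choice both terms of [L1_le] are at most e/2; the 1 added to M covers the case M =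
   0. *)
pose eta := e / (2 * (M + 1)).
have eta0 : 0 < eta by rewrite divr_gt0//; lra.
exists (e / 2 * eta); first by rewrite mulr_gt0// divr_gt0.
move=> v g [oO _ [m1 [m2 _]]] Eg.
have mO : measurable (O : set P) by exact: open_measurable_plane.
have k (f : P -> R) : measurable_fun (O : set P) (f : P -> T) ->
   (\int[leb2]_(p in (O : set P)) (f p ^+ 2)%:E <= energy O g ->
    \int[leb2]_(p in (U : set P)) (`|f p|)%:E <= e%:E)%E.
  move=> mf hf.
  have mfU : measurable_fun (U : set P) (f : P -> T) by exact: measurable_funS mf.
  apply: (le_trans (L1_le mU mfU eta0)); rewrite hM -EFinM.
  have h1 : (\int[leb2]_(p in U) (f p ^+ 2)%:E <= (e / 2 * eta)%:E)%E.
    apply: le_trans (ltW Eg); apply: le_trans hf; apply: ge0_subset_integral => //.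
      by apply/measurable_EFinP; exact: measurable_funX.
    by move=> p _; rewrite lee_fin sqr_ge0.
  apply: (@le_trans _ _ ((eta * M)%:E + (eta^-1)%:E * (e / 2 * eta)%:E)%E).
    by rewrite leeD2l// lee_wpmul2l// lee_fin invr_ge0 ltW.
  rewrite -EFinM -EFinD lee_fin mulrCA mulVf ?gt_eqF// mulr1.
  have : eta * M <= e / 2; last by lra.
  have h2 : eta * (M + 1) = e / 2 by rewrite /eta; field; rewrite gt_eqF//; lra.
  by rewrite -h2 ler_wpM2l// ?lerDl// ltW.
split.
- apply: (k (fun p => (g p).1)) => //; apply: ge0_le_integral => //.
  + by move=> p _; rewrite lee_fin sqr_ge0.
  + by apply/measurable_EFinP; exact: measurable_funX.
  + by apply/measurable_EFinP; apply: measurable_funD; exact: measurable_funX.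
  + by move=> p _; rewrite lee_fin lerDl sqr_ge0.
- apply: (k (fun p => (g p).2)) => //; apply: ge0_le_integral => //.
  + by move=> p _; rewrite lee_fin sqr_ge0.
  + by apply/measurable_EFinP; exact: measurable_funX.
  + by apply/measurable_EFinP; apply: measurable_funD; exact: measurable_funX.
  + by move=> p _; rewrite lee_fin lerDr sqr_ge0.
Qed.

Lemma leb2_obox_lty (x : R * R) (r : R) : 0 < r -> (leb2 (obox x r) < +oo)%E.
Proof. by move=> r0; rewrite leb2_obox ?ltry. Qed.

Lemma nul_sub F0 O (A A' : set P) : open O -> measurable A -> measurable A' -> A `<=` A' -> A' `<=` O ->
  nul F0 O A' -> nul F0 O A.
Proof.
move=> oO mA mA' AA AO h e /h[d d0 hd]; exists d => // v g K Eg.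
apply: le_trans (hd v g K Eg); case: K => v0 sO _.
apply: ge0_subset_integral => //.
  apply/measurable_EFinP; apply: (@measurable_funS _ _ _ _ O) => //; first exact: open_measurable_plane.
  exact: sob_meas sO.
by move=> p /AO/v0; rewrite lee_fin.
Qed.

Section Chain.
Variables (F0 O : set (R * R)) (x : R * R) (r : R) (r0 : 0 < r).
Hypothesis BO : obox x r `<=` O.

Let muI : mu (xint x r) = (2 * r)%:E. Proof. exact: leb_int. Qed.
Let muJ : mu (yint x r) = (2 * r)%:E. Proof. exact: leb_int. Qed.

(** Each of the two terms on the right is granted half of a * e, which explains the denominators
    4r. *)
Lemma strip_arith (a X Y Z : \bar R) (e : R) : 0 < e -> (0 < a)%E -> (a < +oo)%E ->
  (a * X <= (2 * r)%:E * (Y + a * Z))%E ->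
  (Y <= (e * fine a / (4 * r))%:E)%E -> (Z <= (e / (4 * r))%:E)%E -> (X <= e%:E)%E.
Proof.
move=> e0 a0 aoo; have af : a \is a fin_num by rewrite ge0_fin_numE// ltW.
have fa0 : 0 < fine a by rewrite fine_gt0// a0.
rewrite -(fineK af) => h hY hZ.
rewrite -(@lee_pmul2l _ (fine a)%:E)//.
apply: (le_trans h).
apply: (@le_trans _ _ ((2 * r)%:E * ((e * fine a / (4 * r))%:E + (fine a)%:E * (e / (4 * r))%:E))%E).
  apply: lee_wpmul2l; first by rewrite lee_fin mulr_ge0// ltW.
  by apply: leeD => //; apply: lee_wpmul2l => //; rewrite lee_fin ltW.
rewrite -!EFinM lee_fin le_eqVlt; apply/orP; left; apply/eqP.
by field; rewrite gt_eqF.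
Qed.

Lemma nul_strip1 (A J' : set T) : measurable A -> A `<=` xint x r ->
  measurable J' -> J' `<=` yint x r -> (0 < mu A)%E ->
  nul F0 O (A `*` J') -> nul F0 O ((xint x r : set T) `*` J').
Proof.
move=> mA AI mJ JJ A0 nA e e0.
have Aoo : (mu A < +oo)%E.
  apply: (@le_lt_trans _ _ (mu (xint x r))); last by rewrite muI ltry.
  by apply: le_measure; rewrite ?inE//; exact: measurable_itv.
have fA : 0 < fine (mu A) by rewrite fine_gt0// A0.
have [d d0 hd] := nA (e * fine (mu A) / (4 * r)) ltac:(by rewrite divr_gt0 ?mulr_gt0).
have [d' d0' hd'] := @L1_small O _ (e / (4 * r)) (@obox_open R x r) BO (leb2_obox_lty x r0) ltac:(by rewrite divr_gt0 ?mulr_gt0).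
exists (Num.min d d'); first by rewrite lt_min d0.
move=> v g K Eg; have [v0 sO _] := K.
have sB := sob_sub (@obox_open R x r) BO sO.
have v0B p : obox x r p -> 0 <= v p by move=> /BO; exact: v0.
have E1 : (energy O g < d%:E)%E by apply: lt_le_trans Eg _; rewrite lee_fin ge_min lexx.
have E2 : (energy O g < d'%:E)%E by apply: lt_le_trans Eg _; rewrite lee_fin ge_min lexx orbT.
have [L1 _] := hd' v g sO E2.
have := strip1 r0 sB v0B mA AI mJ JJ; rewrite muI => /(strip_arith e0 A0 Aoo); apply => //.
exact: (hd v g K E1).
Qed.

Lemma nul_strip2 (A I' : set T) : measurable A -> A `<=` yint x r ->
  measurable I' -> I' `<=` xint x r -> (0 < mu A)%E ->
  nul F0 O (I' `*` A) -> nul F0 O (I' `*` (yint x r : set T)).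
Proof.
move=> mA AI mJ JJ A0 nA e e0.
have Aoo : (mu A < +oo)%E.
  apply: (@le_lt_trans _ _ (mu (yint x r))); last by rewrite muJ ltry.
  by apply: le_measure; rewrite ?inE//; exact: measurable_itv.
have fA : 0 < fine (mu A) by rewrite fine_gt0// A0.
have [d d0 hd] := nA (e * fine (mu A) / (4 * r)) ltac:(by rewrite divr_gt0 ?mulr_gt0).
have [d' d0' hd'] := @L1_small O _ (e / (4 * r)) (@obox_open R x r) BO (leb2_obox_lty x r0) ltac:(by rewrite divr_gt0 ?mulr_gt0).
exists (Num.min d d'); first by rewrite lt_min d0.
move=> v g K Eg; have [v0 sO _] := K.
have sB := sob_sub (@obox_open R x r) BO sO.
have v0B p : obox x r p -> 0 <= v p by move=> /BO; exact: v0.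
have E1 : (energy O g < d%:E)%E by apply: lt_le_trans Eg _; rewrite lee_fin ge_min lexx.
have E2 : (energy O g < d'%:E)%E by apply: lt_le_trans Eg _; rewrite lee_fin ge_min lexx orbT.
have [_ L1] := hd' v g sO E2.
have := strip2 r0 sB v0B mA AI mJ JJ; rewrite muJ => /(strip_arith e0 A0 Aoo); apply => //.
exact: (hd v g K E1).
Qed.

(** The small box is widened along rows to a full horizontal strip, and that strip along columns to
    the whole large box. *)
Lemma nul_chain (y : R * R) (s : R) : 0 < s -> obox y s `<=` obox x r ->
  nul F0 O (obox y s) -> nul F0 O (obox x r).
Proof.
move=> s0 ys nB.
have yy : obox y s y by exact: obox_center.
have sI : xint y s `<=` xint x r by move=> t ty; have [] := ys (t, y.2) (conj ty yy.2).
have sJ : yint y s `<=` yint x r by move=> t ty; have [] := ys (y.1, t) (conj yy.1 ty).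
have mI' : measurable (xint y s : set T) by exact: measurable_itv.
have mJ' : measurable (yint y s : set T) by exact: measurable_itv.
have mI : measurable (xint x r : set T) by exact: measurable_itv.
have p1 : (0 < mu (xint y s))%E by rewrite leb_int// lte_fin mulr_gt0.
have p2 : (0 < mu (yint y s))%E by rewrite leb_int// lte_fin mulr_gt0.
exact: (nul_strip2 mJ' sJ mI (@subset_refl _ _) p2 (nul_strip1 mI' sI mJ' sJ p1 nB)).
Qed.

End Chain.

(** The points with such a box form an open set. It is closed in O as well: a box about a limit
    point contains a small box about a point of the set, and [nul_chain] enlarges it. *)
Lemma nul_connected F0 O : open O -> connected O ->
  (exists x r, [/\ O x, 0 < r, obox x r `<=` O & nul F0 O (obox x r)]) ->
  forall x, O x -> exists2 r, 0 < r & obox x r `<=` O /\ nul F0 O (obox x r).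
Proof.
move=> oO cO [x0 [s0 [Ox0 s00 s0O ns0]]].
pose A := [set x | O x /\ exists2 r, 0 < r & obox x r `<=` O /\ nul F0 O (obox x r)].
have mO : measurable (O : set P) by exact: open_measurable_plane.
suff AO : O = A by move=> x; rewrite {1}AO => -[].
have oA : open A.
  apply: openP => x [Ox [r r0 [rO nr]]]; exists r => // y xy.
  have [s s1 sx] := open_obox (@obox_open R x r) xy.
  split; first exact: rO.
  exists s => //; split; first exact: subset_trans rO.
  by apply: nul_sub nr => //; exact: open_measurable_plane (@obox_open R _ _).
apply/esym/cO.
- by exists x0; split=> //; exists s0.
- by exists A => //; apply/seteqP; split=> [x Ax|x []//]; split=> //; case: Ax.
exists (closure A); first exact: closed_closure.
apply/seteqP; split=> [x Ax|x [Ox cAx]].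
  by split; [case: Ax|exact: subset_closure].
split=> //; have [r r0 rO] := open_obox oO Ox.
exists r => //; split=> //.
have /closureP/(_ _ r0)[y [Oy [s s0' [sO ns]]] xy] := cAx.
have [t t0 tx] := open_obox (@obox_open R x r) xy.
have mt0 : 0 < Num.min s t by rewrite lt_min s0'.
apply: (nul_chain (y := y) r0 rO mt0).
  by apply: subset_trans tx => p /obox_min[].
apply: nul_sub ns => //; try exact: open_measurable_plane (@obox_open R _ _).
by move=> p /obox_min[].
Qed.

End Small.

(** * Curves and crossings *)

Section Curves.
Variable R : realType.
Local Notation P := (R * R)%type.
Implicit Types (O U C : set P) (x y z : P) (gam : R -> P).

(** The retraction of the line onto [0, 1]. Curves are given as continuous within [0, 1] only;
    composing with it makes them continuous everywhere and keeps the trace. *)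
Definition clamp (t : R) : R := Num.max 0 (Num.min t 1).

Lemma clamp01 t : 0 <= clamp t <= 1.
Proof. by rewrite /clamp le_max lexx /= ge_max ler01 ge_min lexx orbT. Qed.

Lemma clamp_id t : 0 <= t <= 1 -> clamp t = t.
Proof. by move=> /andP[t0 t1]; rewrite /clamp min_l// max_r. Qed.

Lemma clampP t : [\/ t <= 0 /\ clamp t = 0, 0 <= t <= 1 /\ clamp t = t | 1 <= t /\ clamp t = 1].
Proof.
have [t0|t0] := leP t 0.
  by apply: Or31; split=> //; rewrite /clamp min_l ?max_l//; lra.
have [t1|t1] := leP t 1.
  by apply: Or32; rewrite clamp_id ltW.
by apply: Or33; split; [exact: ltW|rewrite /clamp min_r ?max_r// ltW].
Qed.

Lemma clamp_homo s t : s <= t -> clamp s <= clamp t.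
Proof. by move=> st; case: (clampP s) => -[? ->]; case: (clampP t) => -[? ->]; lra. Qed.

Lemma clamp_lip s t : `|clamp s - clamp t| <= `|s - t|.
Proof.
rewrite ler_norml; have := ler_norm (s - t); have := ler_norm (t - s); rewrite (distrC t s).
have := normr_ge0 (s - t).
by case: (clampP s) => -[? ->]; case: (clampP t) => -[? ->] *; apply/andP; split; lra.
Qed.

Lemma clamp_continuous : continuous clamp.
Proof.
move=> t; apply/cvgrPdist_lt => e e0; exists e => // s /= h.
by apply: le_lt_trans (clamp_lip _ _) _.
Qed.

Definition chords gam (M : R) := forall (n : nat) (t : nat -> R),
    (forall i, (i < n)%N -> 0 <= t i /\ t i <= t i.+1 /\ t i.+1 <= 1) ->
    \sum_(i < n) edist (gam (t i)) (gam (t i.+1)) <= M.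

Definition joins O x y gam (M : R) :=
  [/\ continuous gam, forall t, 0 <= t <= 1 -> O (gam t), gam 0 = x, gam 1 = y & chords gam M].

Lemma chords_comp gam M (f : R -> R) : chords gam M ->
  (forall s t, 0 <= s -> s <= t -> t <= 1 -> f s <= f t) -> 0 <= f 0 -> f 1 <= 1 ->
  chords (gam \o f) M.
Proof.
move=> gM fh f0 f1 n t ht; apply: (gM n (f \o t)) => i /ht[a [b c]] /=; split; last split.
- by apply: (le_trans f0); apply: fh => //; apply: le_trans c.
- exact: fh.
- by apply: le_trans f1; apply: fh => //; apply: le_trans b.
Qed.

Lemma rect_curveP O x y gam : rect_curve O x y gam ->
  exists gam' M, joins O x y gam' M /\ trace gam' = trace gam.
Proof.
move=> [cg [gO [g0 [g1 [M gM]]]]].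
exists (gam \o clamp), M; split; last first.
  by apply: eq_imagel => t; rewrite /= in_itv /= => /clamp_id tE; rewrite tE.
split.
- move=> t; have ct s : `[0, 1]%classic (clamp s) by rewrite /= in_itv /= clamp01.
  have cl : clamp @ t --> within `[0, 1]%classic (nbhs (clamp t)).
    move=> B nB.
    have nB' : \forall s \near t, `[0, 1]%classic (clamp s) -> B (clamp s).
      exact: (@clamp_continuous t _ nB).
    have nB2 : \forall s \near t, B (clamp s) by apply: filterS nB' => s; apply; exact: ct.
    exact: nB2.
  exact: cvg_comp cl ((subspace_continuousP _ _).1 cg _ (ct t)).
- by move=> t _; apply: gO; exact: clamp01.
- by rewrite /= clamp_id// lexx ler01.
- by rewrite /= clamp_id// lexx ler01.
- apply: chords_comp => //; first by move=> s t _ st _; exact: clamp_homo.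
  + by case/andP: (clamp01 0).
  + by case/andP: (clamp01 1).
Qed.

Lemma joins_rect O x y gam M : joins O x y gam M -> rect_curve O x y gam.
Proof.
by move=> [cg gO g0 g1 gM]; split; [exact: continuous_subspaceT|do 3 split=> //; exists M].
Qed.

Lemma continuous_comp_fun (f : R -> R) (T : topologicalType) (g : R -> T) :
  continuous f -> continuous g -> continuous (fun t => g (f t)).
Proof. by move=> cf cg t; apply: continuous_comp; [exact: cf|exact: cg]. Qed.

Lemma affine_continuous (a b : R) : continuous (fun t : R => a + b * t).
Proof.
by move=> t; apply: cvgD; [exact: cvg_cst|apply: cvgM; [exact: cvg_cst|exact: cvg_id]].
Qed.

Lemma joins_sym O x y gam M : joins O x y gam M ->
  joins O y x (fun t => gam (1 - t)) M /\ trace (fun t => gam (1 - t)) = trace gam.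
Proof.
move=> [cg gO g0 g1 gM]; split; last first.
  apply/seteqP; split=> _ [t t01 <-] /=; exists (1 - t); rewrite /= ?in_itv /=.
  - by move: t01; rewrite /= in_itv /= => /andP[? ?]; apply/andP; split; lra.
  - by [].
  - by move: t01; rewrite /= in_itv /= => /andP[? ?]; apply/andP; split; lra.
  - by congr gam; lra.
split.
- apply: continuous_comp_fun cg => t.
  by apply: cvgB; [exact: cvg_cst|exact: cvg_id].
- by move=> t /andP[? ?]; apply: gO; apply/andP; split; lra.
- by rewrite subr0.
- by rewrite subrr.
move=> n t ht.
(* The chords of the reversed curve are those of the given one in reverse order, with the ends of
   each exchanged. *)
rewrite -(@big_mkord _ _ _ n xpredT (fun i => edist (gam (1 - t i)) (gam (1 - t i.+1)))).
rewrite big_nat_rev /= add0n big_mkord.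
have -> : \sum_(i < n) edist (gam (1 - t (n - i.+1)%N)) (gam (1 - t (n - i.+1).+1)) =
  \sum_(i < n) edist (gam (1 - t (n - i)%N)) (gam (1 - t (n - i.+1)%N)).
  by apply: eq_bigr => i _; rewrite edistC subnSK.
apply: (gM n (fun i => 1 - t (n - i)%N)) => i ni.
have [a [b c]] := ht (n - i.+1)%N ltac:(by rewrite ltn_subrL /= (leq_ltn_trans (leq0n _) ni)).
by move: b c; rewrite subnSK// => b c; split; [|split]; lra.
Qed.

Lemma joins_sub O x y gam M (a b : R) : joins O x y gam M -> 0 <= a -> a <= b -> b <= 1 ->
  joins O (gam a) (gam b) (fun t => gam (a + (b - a) * t)) M /\
  trace (fun t => gam (a + (b - a) * t)) `<=` trace gam.
Proof.
move=> [cg gO g0 g1 gM] a0 ab b1.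
have in01 t : 0 <= t <= 1 -> 0 <= a + (b - a) * t <= 1.
  by move=> /andP[t0 t1]; apply/andP; split; nra.
split; last first.
  move=> _ [t t01 <-]; exists (a + (b - a) * t) => //.
  by move: t01; rewrite /= !in_itv /=; exact: in01.
split.
- by apply: continuous_comp_fun cg; exact: affine_continuous.
- by move=> t t01; apply/gO/in01.
- by rewrite mulr0 addr0.
- by rewrite mulr1 addrC subrK.
apply: (@chords_comp gam M (fun t => a + (b - a) * t)) => //.
- by move=> s t _ st _; rewrite lerD2l ler_wpM2l// subr_ge0.
- by rewrite mulr0 addr0.
- by rewrite mulr1 addrC subrK.
Qed.

Lemma edist_add (p q p' q' c : P) : edist (p + q - c) (p' + q' - c) <= edist p p' + edist q q'.
Proof.
rewrite /edist /=; have := sqrt_sumsq_add (p.1 - p'.1) (p.2 - p'.2) (q.1 - q'.1) (q.2 - q'.2).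
congr (Num.sqrt (_ ^+ 2 + _ ^+ 2) <= _); ring.
Qed.

(** The concatenation is written as a sum of the two curves minus the common point y, each clamped
    to its half of the time. Continuity and the length bound then follow termwise, with no gluing at
    the middle. *)
Lemma joins_cat O x y z gam M gam' M' : joins O x y gam M -> joins O y z gam' M' ->
  exists2 gam'', joins O x z gam'' (M + M') & trace gam'' `<=` trace gam `|` trace gam'.
Proof.
move=> [cg gO g0 g1 gM] [cg' gO' g0' g1' gM'].
pose f t := clamp (0 + 2 * t); pose f' t := clamp (-1 + 2 * t).
pose h t := gam (f t) + gam' (f' t) - y.
have h1 t : t <= 1 / 2 -> h t = gam (f t).
  move=> t1; have -> : h t = gam (f t) + gam' 0 - y.
    by rewrite /h /f'; case: (clampP (-1 + 2 * t)) => -[? ->] //; congr (_ + gam' _ - _); lra.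
  by rewrite g0' addrK.
have h2 t : 1 / 2 <= t -> h t = gam' (f' t).
  move=> t1; have -> : h t = gam 1 + gam' (f' t) - y.
    by rewrite /h /f; case: (clampP (0 + 2 * t)) => -[? ->] //; congr (gam _ + _ - _); lra.
  by rewrite g1 addrAC subrr add0r.
have c01 t : `[0, 1]%classic (clamp t) by rewrite /= in_itv /= clamp01.
exists h; last first.
  move=> _ [t _ <-]; have [/h1->|/ltW/h2->] := leP t (1 / 2); [left|right].
    by exists (f t) => //; exact: c01.
  by exists (f' t) => //; exact: c01.
have cc (g : R -> P) (a b : R) : continuous g -> continuous (fun t => g (clamp (a + b * t))).
  move=> cgg; apply: continuous_comp_fun cgg; apply: continuous_comp_fun clamp_continuous.
  exact: affine_continuous.
split.
- move=> t; apply: cvgB; last exact: cvg_cst.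
  apply: cvgD; last exact: (cc gam' (-1) 2 cg').
  exact: (cc gam 0 2 cg).
- move=> t _; have [/h1->|/ltW/h2->] := leP t (1 / 2).
    by apply: gO; exact: clamp01.
  by apply: gO'; exact: clamp01.
- rewrite h1; last by lra.
  by rewrite /f mulr0 addr0 clamp_id ?lexx ?ler01.
- rewrite h2; last by lra.
  by rewrite /f' mulr1; have -> : -1 + 2 = 1 :> R; [lra|rewrite clamp_id ?lexx ?ler01].
move=> n t ht.
apply: (@le_trans _ _ (\sum_(i < n) (edist (gam (f (t i))) (gam (f (t i.+1))) +
   edist (gam' (f' (t i))) (gam' (f' (t i.+1)))))).
  by apply: ler_sum => i _; exact: edist_add.
rewrite big_split /=; apply: lerD.
  apply: (gM n (f \o t)) => i /ht[a [b c]]; split; first by case/andP: (clamp01 (0 + 2 * t i)).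
  split; first by apply: clamp_homo; lra.
  by case/andP: (clamp01 (0 + 2 * t i.+1)).
apply: (gM' n (f' \o t)) => i /ht[a [b c]]; split; first by case/andP: (clamp01 (-1 + 2 * t i)).
split; first by apply: clamp_homo; lra.
by case/andP: (clamp01 (-1 + 2 * t i.+1)).
Qed.

Lemma joins_segment O c r x y : obox c r `<=` O -> obox c r x -> obox c r y ->
  exists gam M, joins O x y gam M.
Proof.
move=> BO Bx By; pose gam (t : R) : P := (x.1 + t * (y.1 - x.1), x.2 + t * (y.2 - x.2)).
exists gam, (`|x.1 - y.1| + `|x.2 - y.2|); split.
- move=> t A /nbhs_obox[e e0 eA].
  have k1 : 0 < `|y.1 - x.1| + `|y.2 - x.2| + 1 by rewrite ltr_wpDl// addr_ge0.
  exists (e / (`|y.1 - x.1| + `|y.2 - x.2| + 1)); first by rewrite /= divr_gt0.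
  move=> s /=; rewrite ltr_pdivlMr// => hs; apply: eA; apply/oboxP => /=.
  have E (a b : R) : a + t * b - (a + s * b) = (t - s) * b by ring.
  rewrite !E !normrM; move: hs; have := normr_ge0 (t - s).
  have := normr_ge0 (y.1 - x.1); have := normr_ge0 (y.2 - x.2); split; nra.
- move=> t /andP[t0 t1]; apply: BO; move: Bx By => /oboxP[a1 a2] /oboxP[b1 b2].
  have cvx (a u w : R) : `|a - u| < r -> `|a - w| < r -> `|a - (u + t * (w - u))| < r.
    rewrite !ltr_norml => /andP[? ?] /andP[? ?].
    have -> : a - (u + t * (w - u)) = (1 - t) * (a - u) + t * (a - w) by ring.
    have [->|tn0] := eqVneq t 0; first by rewrite subr0 mul1r mul0r addr0; apply/andP.
    have tp : 0 < t by rewrite lt_neqAle eq_sym tn0.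
    have t1' : 0 <= 1 - t by lra.
    by apply/andP; split; nra.
  by apply/oboxP; split; exact: cvx.
- by rewrite /gam !mul0r !addr0; case: x {Bx gam}.
- by rewrite /gam !mul1r ![_ + (_ - _)]addrC !subrK; case: y {By gam}.
move=> n t ht.
apply: (@le_trans _ _ (\sum_(i < n) (t i.+1 - t i) * (`|x.1 - y.1| + `|x.2 - y.2|))).
  apply: ler_sum => i _; apply: le_trans (edist_le _ _) _; rewrite /gam /=.
  have E (a b : R) : a + t i * b - (a + t i.+1 * b) = (t i - t i.+1) * b by ring.
  have [_ [tt _]] := ht i (ltn_ord i).
  by rewrite !E !normrM mulrDr (distrC (t i)) (distrC y.1) (distrC y.2) ger0_norm ?subr_ge0.
rewrite -mulr_suml; apply: ler_piMl; first by rewrite addr_ge0.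
rewrite -(@big_mkord _ _ _ n xpredT (fun i => t i.+1 - t i)) telescope_sumr//.
case: n ht => [|n] ht; first by rewrite subrr.
have [a _] := ht 0%N (ltn0Sn _); have [_ [_ b]] := ht n (ltnSn n); lra.
Qed.

(** The points of U that rectifiable curves in U reach from x form an open set, and so do the
    others, since boxes are convex. The connected set C, which itself need not be open, cannot meet
    both. *)
Lemma joins_connected U C x y : open U -> C `<=` U -> connected C -> C x -> C y ->
  exists gam M, joins U x y gam M.
Proof.
move=> oU CU cC Cx Cy.
pose A := [set z | exists gam M, joins U x z gam M].
have oA : open A.
  apply: openP => z [gam [M gj]].
  have Uz : U z by have [_ gO _ <- _] := gj; apply: gO; rewrite ler01 lexx.
  have [e e0 eU] := open_obox oU Uz; exists e => // w zw.
  have [gam' [M' gj']] := joins_segment eU (obox_center z e0) zw.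
  by have [gam'' gj'' _] := joins_cat gj gj'; exists gam'', (M + M').
have oA' : open (U `\` A).
  apply: openP => z [Uz nAz]; have [e e0 eU] := open_obox oU Uz; exists e => // w zw.
  split; first exact: eU.
  move=> [gam [M gj]]; apply: nAz.
  have [gam' [M' gj']] := joins_segment eU zw (obox_center z e0).
  by have [gam'' gj'' _] := joins_cat gj gj'; exists gam'', (M + M').
have Ax : A x.
  have [e e0 eU] := open_obox oU (CU _ Cx).
  exact: (joins_segment eU (obox_center x e0) (obox_center x e0)).
suff CA : C `&` A = C by have [] : (C `&` A) y by rewrite CA.
apply: cC.
- by exists x.
- by exists A.
- exists (~` (U `\` A)); first exact: open_closedC.
  by apply/seteqP; split=> z [Cz]; [move=> Az; split=> // -[]|move=> nz; split=> //; apply: contrapT => nA; apply: nz; split=> //; exact: CU].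
Qed.

End Curves.

(** * A curve leaving a box against two small potentials *)

Section Crossing.
Variable R : realType.
Local Notation T := (measurableTypeR R).
Local Notation P := (T * T)%type.
Local Notation mu := (@lebesgue_measure R).
Local Notation leb2 := (mu \x mu)%E.
Implicit Types (O U : set (R * R)) (v : R * R -> R) (g : R * R -> R * R).

(** The interval starts at f 0 and points towards f tau. It is open, so it omits the value f tau and
    the times found are strictly before tau, while the curve is still in the box. *)
Lemma hits_interval (f : R -> R) (tau rho : R) : continuous f -> 0 <= tau -> 0 < rho ->
  rho <= `|f 0 - f tau| -> exists a b : R, [/\ b - a = rho,
    `]a, b[ `<=` `]f 0 - rho, f 0 + rho[ & forall y, a < y < b -> exists2 t, 0 <= t < tau & f t = y].
Proof.
move=> cf tau0 rho0 h.
have ivt y : Num.min (f 0) (f tau) <= y <= Num.max (f 0) (f tau) -> y != f tau ->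
    exists2 t, 0 <= t < tau & f t = y.
  move=> hy yn; have [t] := IVT tau0 (continuous_subspaceT cf) hy.
  rewrite in_itv /= => /andP[t0]; rewrite le_eqVlt => /predU1P[->|tt] fE.
    by move: yn; rewrite fE eqxx.
  by exists t => //; rewrite t0.
have [le|le] := leP (f 0) (f tau).
  move: h; rewrite distrC ger0_norm ?subr_ge0// => h.
  exists (f 0), (f 0 + rho); split; first by lra.
    by move=> y; rewrite /= !in_itv /= => /andP[? ?]; apply/andP; split; lra.
  move=> y /andP[y1 y2]; apply: ivt; last by rewrite lt_eqF//; lra.
  by rewrite min_l// max_r//; apply/andP; split; lra.
move: h; rewrite gtr0_norm ?subr_gt0// => h.
exists (f 0 - rho), (f 0); split; first by lra.
  by move=> y; rewrite /= !in_itv /= => /andP[? ?]; apply/andP; split; lra.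
move=> y /andP[y1 y2]; apply: ivt; last by rewrite gt_eqF//; lra.
by rewrite (min_r (ltW le)) (max_l (ltW le)); apply/andP; split; lra.
Qed.

Lemma first_exit (gam : R -> R * R) (U : set (R * R)) (t1 : R) : continuous gam -> open U ->
  0 <= t1 -> ~ U (gam t1) ->
  exists tau, [/\ 0 <= tau <= t1, ~ U (gam tau) & forall t, 0 <= t < tau -> U (gam t)].
Proof.
move=> cg oU t10 n1.
pose S := [set t : R | 0 <= t /\ ~ U (gam t)].
have S1 : S t1 by [].
have lS : lbound S 0 by move=> t [].
have hS : has_inf S by split; [exists t1|exists 0].
have i0 : 0 <= inf S by apply: lb_le_inf => //; exists t1.
have i1 : inf S <= t1 by apply: ge_inf => //; exists 0.
exists (inf S); split; first by rewrite i0.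
  move=> Ui; have /nbhs_ballP[e /= e0 eU] : nbhs (inf S) (gam @^-1` U).
    by apply: cg; exact: open_nbhs_nbhs.
  suff : inf S + e <= inf S by lra.
  apply: lb_le_inf; first by exists t1.
  move=> t [t0 nt]; have it : inf S <= t by apply: ge_inf => //; exists 0.
  rewrite leNgt; apply/negP => te; apply: nt; apply: eU.
  by rewrite /ball /= ler0_norm; lra.
move=> t /andP[t0 ti]; apply: contrapT => nt.
have : inf S <= t by apply: ge_inf => //; exists 0.
by lra.
Qed.

(** The curve leaves the box of radius r/2, so one of its coordinates runs through an interval of
    length r/2, and each line over it meets a point where v or v' is at least 1. Then [cross1] or
    [cross2] gives r^2 <= r^2/8 + r^2/8 + 2r (r/16 + r/16) = r^2/2. *)
Lemma crossing (x : R * R) (r : R) v g v' g' (gam : R -> R * R) : 0 < r ->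
  sob (obox x r) v g -> sob (obox x r) v' g' ->
  (forall p, obox x r p -> 0 <= v p) -> (forall p, obox x r p -> 0 <= v' p) ->
  continuous gam -> gam 0 = x -> (exists2 t, 0 <= t <= 1 & ~ obox x r (gam t)) ->
  (forall t, 0 <= t <= 1 -> obox x r (gam t) -> 1 <= v (gam t) \/ 1 <= v' (gam t)) ->
  (\int[leb2]_(p in obox x r) (v p)%:E <= (r ^+ 2 / 8)%:E)%E ->
  (\int[leb2]_(p in obox x r) (v' p)%:E <= (r ^+ 2 / 8)%:E)%E ->
  (\int[leb2]_(p in obox x r) (`|(g p).1|)%:E <= (r / 16)%:E)%E ->
  (\int[leb2]_(p in obox x r) (`|(g' p).1|)%:E <= (r / 16)%:E)%E ->
  (\int[leb2]_(p in obox x r) (`|(g p).2|)%:E <= (r / 16)%:E)%E ->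
  (\int[leb2]_(p in obox x r) (`|(g' p).2|)%:E <= (r / 16)%:E)%E -> False.
Proof.
move=> r0 sB sB' v0 v0' cg g0 [t1 /andP[t10 t11] n1] hv iv iv' l1 l1' l2 l2'.
have r20 : 0 < r / 2 by rewrite divr_gt0.
have sub : obox x (r / 2) `<=` obox x r.
  by move=> p /oboxP[a b]; apply/oboxP; split; lra.
have n1' : ~ obox x (r / 2) (gam t1) by move=> /sub.
have [tau [/andP[tau0 taut] ntau inB]] := first_exit cg (@obox_open R x (r / 2)) t10 n1'.
have arith (X Y Z W : \bar R) : ((2 * r)%:E * (r / 2)%:E <= X + Y + (2 * r)%:E * (Z + W) ->
  X <= (r ^+ 2 / 8)%:E -> Y <= (r ^+ 2 / 8)%:E -> Z <= (r / 16)%:E -> W <= (r / 16)%:E -> False)%E.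
  move=> h hX hY hZ hW.
  have : ((2 * r)%:E * (r / 2)%:E <= (r ^+ 2 / 8 + r ^+ 2 / 8)%:E + (2 * r)%:E * (r / 16 + r / 16)%:E)%E.
    apply: (le_trans h); rewrite !EFinD; apply: leeD; first exact: leeD.
    by apply: lee_wpmul2l; [rewrite lee_fin mulr_ge0// ltW|exact: leeD].
  rewrite -!EFinM -EFinD lee_fin => h2.
  have : 0 < r * r by exact: mulr_gt0.
  by move: h2; rewrite expr2; lra.
have c1 : continuous (fun t => (gam t).1).
  by move=> t; apply: (@continuous_comp _ _ _ gam fst); [exact: cg|exact: cvg_fst].
have c2 : continuous (fun t => (gam t).2).
  by move=> t; apply: (@continuous_comp _ _ _ gam snd); [exact: cg|exact: cvg_snd].
have hit t : 0 <= t < tau -> obox x r (gam t) /\ (1 <= v (gam t) \/ 1 <= v' (gam t)).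
  move=> /andP[t0 tt]; have B := sub _ (inB t ltac:(by rewrite t0)).
  by split=> //; apply: hv => //; apply/andP; split; lra.
have mi (a b : R) : b - a = r / 2 -> mu `]a, b[ = (r / 2)%:E.
  by move=> h; rewrite lebesgue_measure_itv /= lte_fin ifT; [rewrite -EFinB h|lra].
have [h1|h1] := leP (r / 2) (`|x.1 - (gam tau).1|).
  have [a [b [ba ab hits]]] := hits_interval c1 tau0 r20 ltac:(by rewrite /= g0).
  have AJ : `]a, b[ `<=` xint x r.
    move=> y /ab; rewrite /xint /= g0 !in_itv /= => /andP[? ?]; apply/andP; split; lra.
  have mA : measurable (`]a, b[%classic : set T) by exact: measurable_itv.
  have := @cross2 R x r r0 v g v' g' `]a, b[%classic sB sB' v0 v0' mA AJ.
  rewrite mi// leb_int// => h; apply: (arith _ _ _ _ (h _)) => // s.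
  rewrite /= in_itv /= => /hits[t /hit[B v1] ts].
  exists (gam t).2; first by case: B.
  by rewrite -ts -surjective_pairing.
have [h2|h2] := leP (r / 2) (`|x.2 - (gam tau).2|).
  have [a [b [ba ab hits]]] := hits_interval c2 tau0 r20 ltac:(by rewrite /= g0).
  have AJ : `]a, b[ `<=` yint x r.
    move=> y /ab; rewrite /yint /= g0 !in_itv /= => /andP[? ?]; apply/andP; split; lra.
  have mA : measurable (`]a, b[%classic : set T) by exact: measurable_itv.
  have := @cross1 R x r r0 v g v' g' `]a, b[%classic sB sB' v0 v0' mA AJ.
  rewrite mi// leb_int// => h; apply: (arith _ _ _ _ (h _)) => // s.
  rewrite /= in_itv /= => /hits[t /hit[B v1] ts].
  exists (gam t).1; first by case: B.
  by rewrite -ts -surjective_pairing.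
by apply: ntau; apply/oboxP.
Qed.

End Crossing.

(** * Lower bounds for capacities *)

Section Seeds.
Variable R : realType.
Local Notation T := (measurableTypeR R).
Local Notation P := (T * T)%type.
Local Notation mu := (@lebesgue_measure R).
Local Notation leb2 := (mu \x mu)%E.
Implicit Types (O U F : set (R * R)) (v : R * R -> R) (g : R * R -> R * R).

Definition qcenter (q : (rat * rat) * rat) : R * R := (ratr q.1.1, ratr q.1.2).
Definition qradius (q : (rat * rat) * rat) : R := ratr q.2.

Lemma open_qbox O p : open O -> O p ->
  exists q, [/\ 0 < qradius q, obox (qcenter q) (2 * qradius q) `<=` O & obox (qcenter q) (qradius q) p].
Proof.
move=> oO Op; have [e e0 eO] := open_obox oO Op.
have [a /andP[a1 a2]] : exists q : rat, p.1 - e / 8 < ratr q < p.1 by apply: ratr_between; lra.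
have [b /andP[b1 b2]] : exists q : rat, p.2 - e / 8 < ratr q < p.2 by apply: ratr_between; lra.
have [c /andP[c1 c2]] : exists q : rat, e / 8 < ratr q < e / 4 by apply: ratr_between; lra.
exists ((a, b), c); split; rewrite /qcenter /qradius /=; first by lra.
  apply: subset_trans eO => z /oboxP[/= h1 h2]; apply/oboxP.
  move: h1 h2; rewrite !ltr_norml => /andP[? ?] /andP[? ?].
  by split; apply/andP; split; lra.
by apply/oboxP; rewrite /= !ltr_norml; split; apply/andP; split; lra.
Qed.

(** The image of F contains a nondegenerate interval, and countably many rational boxes cover F; so
    in one of them the piece of F has an image of positive measure. *)
Lemma continuum_projection F O (pr : R * R -> R) : continuous pr -> open O -> compact F ->
  connected F -> F `<=` O -> (exists a b, F a /\ F b /\ pr a <> pr b) ->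
  exists c r, [/\ 0 < r, obox c (2 * r) `<=` O, measurable (pr @` (F `&` cbox c r) : set T) &
     (0 < mu (pr @` (F `&` cbox c r)))%E].
Proof.
move=> cpr oO cF cnF FO [a0 [b0 [Fa0 [Fb0 ab0]]]].
have [a [b [Fa Fb ab]]] : exists a b, [/\ F a, F b & pr a < pr b].
  by have [h|h|//] := ltgtP (pr a0) (pr b0); [exists a0, b0|exists b0, a0].
have cT c r : compact (pr @` (F `&` cbox c r)).
  apply: continuous_compact; first exact: continuous_subspaceT.
  apply: compact_closedI => //; apply: compact_closed_plane; exact: cbox_compact.
have mT c r : measurable (pr @` (F `&` cbox c r) : set T) by apply: compact_measurable; exact: cT.
apply: contrapT => nex.
pose good q := 0 < qradius q /\ obox (qcenter q) (2 * qradius q) `<=` O.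
(* Numbers that do not encode a rational box with its double inside O yield the empty set. *)
pose TT (n : nat) : set T := if unpickle n is Some q then
   (if `[< good q >] then pr @` (F `&` cbox (qcenter q) (qradius q)) else set0) else set0.
have TT0 n : mu.-negligible (TT n).
  rewrite /TT; case: (unpickle n) => [q|]; last exact: negligible_set0.
  case: asboolP => [[g1 g2]|_]; last exact: negligible_set0.
  apply/negligibleP => //; apply: contrapT => /eqP ne0; apply: nex.
  exists (qcenter q), (qradius q); split=> //.
  by rewrite lt_neqAle eq_sym ne0 /=.
have sub : `]pr a, pr b[ `<=` \bigcup_n TT n.
  move=> y; rewrite /= in_itv /= => /andP[y1 y2].
  have : (pr @` F) y.
    have : connected (pr @` F) by apply: connected_continuous_connected => //; exact: continuous_subspaceT.
    move=> /connected_intervalP/(_ (pr a) (pr b)); apply; [by exists a|by exists b|].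
    by rewrite !ltW.
  move=> [p Fp py].
  have [q [q0 qO qp]] := open_qbox oO (FO _ Fp).
  have TTq : TT (pickle q) = pr @` (F `&` cbox (qcenter q) (qradius q)).
    by rewrite /TT pickleK; case: asboolP => // ng; exfalso; apply: ng.
  exists (pickle q); first exact: I.
  by rewrite TTq; exists p => //; split=> //; exact: obox_cbox.
have N : mu.-negligible (`]pr a, pr b[%classic : set T).
  exact: (negligibleS (sub : (_ : set T) `<=` _) (negligible_bigcup TT0)).
have : mu `]pr a, pr b[ = 0%E by apply/negligibleP => //; exact: measurable_itv.
rewrite lebesgue_measure_itv /= lte_fin ab -EFinB => -[/eqP]; rewrite subr_eq0 gt_eqF//.
Qed.

(** Each row over A meets F, where v vanishes, so [seed1] bounds v by its gradient alone. *)
Lemma nul_seed1 F O c r (A : set T) : 0 < r -> obox c r `<=` O -> F `<=` O -> measurable A -> A `<=` yint c r ->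
  (forall y, A y -> exists2 t, xint c r t & F (t, y)) -> nul F O ((xint c r : set T) `*` A).
Proof.
move=> r0 BO FO mA AJ hA e e0.
have d4 : 0 < e / (2 * r) by rewrite divr_gt0// mulr_gt0.
have [d d0 hd] := L1_small (@obox_open R c r) BO (leb2_obox_lty c r0) d4.
exists d => // v g [v0 sO [U [oU FU vU]]] Eg.
have [L1 _] := hd v g sO Eg.
have := @seed1 R c r r0 v g A (sob_sub (@obox_open R c r) BO sO) _ mA AJ.
move=> /(_ (fun p h => v0 p (BO p h))) h.
apply: (le_trans (h _)) => [y /hA[t It Ft]|].
  by exists t => //; apply: vU; [exact: FU|exact: FO].
rewrite leb_int//; apply: (@le_trans _ _ ((2 * r)%:E * (e / (2 * r))%:E)%E).
  by apply: lee_wpmul2l => //; rewrite lee_fin mulr_ge0// ltW.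
by rewrite -EFinM lee_fin le_eqVlt; apply/orP; left; apply/eqP; field; rewrite gt_eqF.
Qed.

Lemma nul_seed2 F O c r (A : set T) : 0 < r -> obox c r `<=` O -> F `<=` O -> measurable A -> A `<=` xint c r ->
  (forall y, A y -> exists2 t, yint c r t & F (y, t)) -> nul F O (A `*` (yint c r : set T)).
Proof.
move=> r0 BO FO mA AJ hA e e0.
have d4 : 0 < e / (2 * r) by rewrite divr_gt0// mulr_gt0.
have [d d0 hd] := L1_small (@obox_open R c r) BO (leb2_obox_lty c r0) d4.
exists d => // v g [v0 sO [U [oU FU vU]]] Eg.
have [_ L1] := hd v g sO Eg.
have := @seed2 R c r r0 v g A (sob_sub (@obox_open R c r) BO sO) _ mA AJ.
move=> /(_ (fun p h => v0 p (BO p h))) h.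
apply: (le_trans (h _)) => [y /hA[t It Ft]|].
  by exists t => //; apply: vU; [exact: FU|exact: FO].
rewrite leb_int//; apply: (@le_trans _ _ ((2 * r)%:E * (e / (2 * r))%:E)%E).
  by apply: lee_wpmul2l => //; rewrite lee_fin mulr_ge0// ltW.
by rewrite -EFinM lee_fin le_eqVlt; apply/orP; left; apply/eqP; field; rewrite gt_eqF.
Qed.

(** Two distinct points of F differ in some coordinate, so the projection to that axis is
    nondegenerate and provides a seed of positive measure. The box is doubled in order that the
    piece of F in the closed box lies in the open one. *)
Lemma nul_continuum F O : domain O -> continuum F -> F `<=` O ->
  forall x, O x -> exists2 r, 0 < r & obox x r `<=` O /\ nul F O (obox x r).
Proof.
move=> [oO [cO _]] [cF [cnF [a [b [Fa [Fb ab]]]]]] FO; apply: nul_connected => //.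
have cs : continuous (snd : R * R -> R) by move=> p; exact: cvg_snd.
have cf : continuous (fst : R * R -> R) by move=> p; exact: cvg_fst.
have cbo (c : R * R) r p : 0 < r -> cbox c r p -> obox c (2 * r) p.
  by move=> r0; apply: cbox_obox; lra.
have [e2|n2] := pselect (a.2 = b.2); last first.
  have [c [r [r0 BO mA A0]]] := continuum_projection cs oO cF cnF FO
    (ex_intro _ a (ex_intro _ b (conj Fa (conj Fb n2)))).
  have r20 : 0 < 2 * r by rewrite mulr_gt0.
  exists c, (2 * r); split=> //; first by apply: BO; exact: obox_center.
  have AJ : snd @` (F `&` cbox c r) `<=` yint c (2 * r).
    by move=> _ [p [_ /(cbo _ _ _ r0)[_ h]] <-].
  apply: (nul_strip2 r20 BO mA AJ _ (@subset_refl _ _) A0); first exact: measurable_itv.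
  apply: nul_seed1 => // y [p [Fp /(cbo _ _ _ r0)[h _]] <-].
  by exists p.1 => //; rewrite -surjective_pairing.
have n1 : a.1 <> b.1 by move=> e1; apply: ab; case: a b e1 e2 {Fa Fb} => ? ? [? ?] /= -> ->.
have [c [r [r0 BO mA A0]]] := continuum_projection cf oO cF cnF FO
  (ex_intro _ a (ex_intro _ b (conj Fa (conj Fb n1)))).
have r20 : 0 < 2 * r by rewrite mulr_gt0.
exists c, (2 * r); split=> //; first by apply: BO; exact: obox_center.
have AJ : fst @` (F `&` cbox c r) `<=` xint c (2 * r).
  by move=> _ [p [_ /(cbo _ _ _ r0)[h _]] <-].
apply: (nul_strip1 r20 BO mA AJ _ (@subset_refl _ _) A0); first exact: measurable_itv.
apply: nul_seed2 => // y [p [Fp /(cbo _ _ _ r0)[_ h]] <-].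
by exists p.2 => //; rewrite -surjective_pairing.
Qed.

(** The last point outside O to the left of (s, y), found as a supremum: [- M] is a candidate
    because O is bounded, and the supremum is outside O because O is open. *)
Lemma row_to_boundary O M (s y : R) : open O -> O `<=` obox (0, 0) M -> O (s, y) ->
  exists2 p, p < s & bdry O (p, y) /\ forall z, p < z <= s -> O (z, y).
Proof.
move=> oO OM Os; pose S := [set z | z <= s /\ ~ O (z, y)].
have [/= a1 a2] := (oboxP _ _ _).1 (OM _ Os).
have S1 : S (- M).
  split; first by move: a1; rewrite ltr_norml => /andP[]; lra.
  move=> /OM/oboxP[/= h _]; move: h; rewrite sub0r opprK => h.
  by have := ler_norm M; lra.
have hS : has_sup S by split; [exists (- M)|exists s => z []].
have ps : sup S <= s by apply: ge_sup; [exists (- M)|move=> z []].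
have up z : S z -> z <= sup S by move=> Sz; apply: ub_le_sup => //; exists s => ? [].
have nO : ~ O (sup S, y).
  move=> Op; have [e e0 eO] := open_obox oO Op.
  have [z Sz hz] := sup_adherent e0 hS.
  have zs := up _ Sz; case: Sz => _; apply; apply: eO; apply/oboxP => /=.
  by rewrite subrr normr0; split => //; rewrite ger0_norm; lra.
have pls : sup S < s.
  by rewrite lt_neqAle ps andbT; apply/eqP => E; apply: nO; rewrite E.
have inO z : sup S < z <= s -> O (z, y).
  move=> /andP[z1 z2]; apply: contrapT => nz; have := up z (conj z2 nz); lra.
exists (sup S) => //; split=> //; split; last by rewrite (interior_id _).1.
apply/closureP => e e0.
exists (Num.min s (sup S + e / 2), y).
  by apply: inO; rewrite lt_min pls ge_min lexx /= andbT; lra.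
apply/oboxP => /=; rewrite subrr normr0; split=> //.
have [h|h] := leP s (sup S + e / 2); first by rewrite ltr0_norm; lra.
by rewrite ltr0_norm; lra.
Qed.

(** Each row reaches bdry O from any of its points through O, and v vanishes near the point reached;
    O has finite measure, so [acl] on all of O bounds v by the row integral. *)
Lemma nul_boundary O M : open O -> O `<=` obox (0, 0) M ->
  forall x, O x -> exists2 r, 0 < r & obox x r `<=` O /\ nul (bdry O) O (obox x r).
Proof.
move=> oO OM x Ox; have [r r0 BO] := open_obox oO Ox; exists r => //; split=> // e e0.
have mO : measurable (O : set P) by exact: open_measurable_plane.
have M0 : 0 < M by have /oboxP[/= a _] := OM _ Ox; apply: le_lt_trans a.
have fO : (leb2 O < +oo)%E.
  apply: (@le_lt_trans _ _ (leb2 (obox (0, 0) M))); last exact: leb2_obox_lty.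
  by apply: le_measure; rewrite ?inE//; exact: open_measurable_plane (@obox_open R _ _).
have d4 : 0 < e / (2 * r) by rewrite divr_gt0// mulr_gt0.
have [d d0 hd] := L1_small oO (@subset_refl _ O) fO d4.
exists d => // v g [v0 sO [U [oU FU vU]]] Eg.
have [L1 _] := hd v g sO Eg.
have [G [mG G0 iG aeG]] := acl sO (sob_L1 sO fO).
have mEG : measurable_fun [set: T] (fun y => (G y)%:E) by exact/measurable_EFinP.
have mB : measurable_fun (obox x r : set P) (fun p => (v p)%:E).
  apply/measurable_EFinP; apply: (@measurable_funS _ _ _ _ O) => //; exact: sob_meas sO.
apply: (@le_trans _ _ (\int[leb2]_(p in obox x r) (G p.2)%:E)%E).
  apply: (@ae_rows_le R (xint x r) (yint x r)) => //.
  - exact: measurable_itv.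
  - exact: measurable_itv.
  - apply: measurable_funTS; exact: (measurableT_comp mEG (@measurable_snd _ _ T T)).
  - by move=> p /BO/v0; rewrite lee_fin.
  - by move=> p _; rewrite lee_fin.
  apply: (@filterS _ _ (ae_filter_ringOfSetsType mu)) aeG => y h Jy s Is.
  have Os : O (s, y) by apply: BO.
  have [p ps [bp inO]] := row_to_boundary oO OM Os.
  have [e1 e10 e1U] := open_obox oU (FU _ bp).
  (* The boundary point p is not in O, so the comparison is made at a point of the row slightly to
     its right, still in the open set where v vanishes. *)
  pose z := Num.min s (p + e1 / 2).
  have z1 : p < z <= s by rewrite /z lt_min ps ge_min lexx /= andbT; lra.
  have vz : v (z, y) = 0.
    apply: vU; last exact: inO.
    apply: e1U; apply/oboxP => /=; rewrite subrr normr0; split=> //.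
    have z2 : z <= p + e1 / 2 by rewrite /z ge_min lexx orbT.
    by move: z1 => /andP[? ?]; rewrite ltr0_norm; lra.
  have := h z s _ _; rewrite vz sub0r normrN lee_fin => h1.
  move: z1 => /andP[pz zs]; apply: le_trans (ler_norm _) (h1 zs _) => w /andP[zw ws].
  by apply: inO; apply/andP; split; lra.
rewrite (int_row (A := xint x r) (B := yint x r) (H := fun y => (G y)%:E))//; last 2 first.
- exact: measurable_itv.
- exact: measurable_itv.
rewrite leb_int//; apply: (@le_trans _ _ ((2 * r)%:E * (e / (2 * r))%:E)%E).
  apply: lee_wpmul2l; first by rewrite lee_fin mulr_ge0// ltW.
  apply: le_trans L1; rewrite -iG; apply: ge0_subset_integral => //; first exact: measurable_itv.
  by move=> y _; rewrite lee_fin.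
by rewrite -EFinM lee_fin le_eqVlt; apply/orP; left; apply/eqP; field; rewrite gt_eqF.
Qed.

End Seeds.

(** * Capacities, and the relation that replaces the metric *)

Section Caps.
Variable R : realType.
Local Notation T := (measurableTypeR R).
Local Notation P := (T * T)%type.
Local Notation mu := (@lebesgue_measure R).
Local Notation leb2 := (mu \x mu)%E.
Implicit Types (O U F V K : set (R * R)) (v : R * R -> R) (g : R * R -> R * R).

Lemma cap_ge0 F0 F1 O : (0 <= @cap R F0 F1 O)%E.
Proof.
apply/ereal_infP => _ [g _ <-]; apply: integral_ge0 => p _.
by rewrite lee_fin addr_ge0 ?sqr_ge0.
Qed.

Lemma cap_lt F0 F1 O (d : R) : (cap F0 F1 O < d%:E)%E -> exists v g,
  [/\ cap_admissible F0 F1 O v, L2_weak_gradient O v g & (energy O g < d%:E)%E].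
Proof.
by move=> /ereal_inf_lt[_ [g [v [av wv]] <-] lt]; exists v, g.
Qed.

Lemma lt_cap F0 F1 O (d : R) v g : cap_admissible F0 F1 O v -> L2_weak_gradient O v g ->
  (energy O g < d%:E)%E -> (cap F0 F1 O < d%:E)%E.
Proof.
by move=> av wv; apply: le_lt_trans; apply: ereal_inf_lbound; exists g => //; exists v.
Qed.

Lemma cap_mono F0 A B O (d : R) : A `<=` B -> (cap F0 B O < d%:E)%E -> (cap F0 A O < d%:E)%E.
Proof.
move=> AB /cap_lt[v [g [[a1 [a2 [a3 [U [oU [BU U1]]]]]] wv Ev]]].
by apply: (lt_cap _ wv Ev); do 3 split => //; exists U; split=> //; split=> //; exact: subset_trans BU.
Qed.

Lemma compact_measurable_plane K : compact K -> measurable (K : set P).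
Proof.
move=> cK; rewrite -(setCK K); apply: measurableC; apply: open_measurable_plane.
by apply: closed_openC; exact: compact_closed_plane.
Qed.

Lemma compact_sub_obox K : compact K -> exists2 M, 0 < M & K `<=` obox (0, 0) M.
Proof.
move=> cK; have [M [Mr hM]] := compact_bounded cK.
exists (`|M| + 2); first by rewrite ltr_wpDl.
move=> p Kp; have := hM (`|M| + 1) ltac:(by have := ler_norm M; lra) p Kp.
rewrite /Num.norm /= ge_max => /andP[n1 n2].
by apply/oboxP => /=; rewrite !sub0r !normrN; split; lra.
Qed.

Lemma hasint_supp O K (f : P -> R) : open O -> compact K -> K `<=` O ->
  measurable_fun (O : set P) (f : P -> T) -> (forall p, ~ K p -> f p = 0) ->
  (exists M, forall p, K p -> `|f p| <= M) -> exists a, hasint leb2 O f a.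
Proof.
move=> oO cK KO mf f0 [M fM].
have mO : measurable (O : set P) by exact: open_measurable_plane.
have mK := compact_measurable_plane cK.
have Koo : (leb2 K < +oo)%E.
  have [M1 M10 KB] := compact_sub_obox cK.
  apply: (@le_lt_trans _ _ (leb2 (obox (0, 0) M1))); last exact: leb2_obox_lty.
  by apply: le_measure; rewrite ?inE//; exact: open_measurable_plane (@obox_open R _ _).
apply: hasint_ex => //; apply/integrableP; split; first exact/measurable_EFinP.
have -> : (\int[leb2]_(p in O) `|(f p)%:E| = \int[leb2]_(p in K) `|(f p)%:E|)%E.
  rewrite integral_supp; last by move=> p np; rewrite f0 ?abse0// => /KO.
  by rewrite [RHS]integral_supp// => p np; rewrite f0 ?abse0.
have mfK : measurable_fun (K : set P) (fun p : P => `|(f p)%:E|%E).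
  apply/measurable_EFinP; apply: (@measurable_funS _ _ _ _ O) => //.
  exact: (measurableT_comp (@normr_measurable R setT) mf).
apply: (@le_lt_trans _ _ (\int[leb2]_(p in K) (cst (`|M|)%:E) p)%E).
  apply: ge0_le_integral => //.
  by move=> p Kp; rewrite lee_fin; apply: le_trans (fM _ Kp) _; exact: ler_norm.
by rewrite integral_cst// lte_mul_pinfty// lee_fin.
Qed.

Lemma compact_bound K O (f : R * R -> R) : compact K -> K `<=` O -> {in O, continuous f} ->
  exists M, forall p, K p -> `|f p| <= M.
Proof.
move=> cK KO cf; have : compact (f @` K).
  apply: continuous_compact => //; apply: continuous_in_subspaceT => p /[!inE] Kp.
  by apply: cf; rewrite inE; exact: KO.
move=> /compact_bounded[M [Mr hM]]; exists (`|M| + 1) => p Kp.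
by apply: (hM (`|M| + 1)); [have := ler_norm M; lra|exists p].
Qed.

(** Weak identities can be added only when all four integrals are finite. For the terms with g this
    comes from |ab| <= a^2 + b^2, since phi is bounded with compact support. *)
Lemma weak_integrable O v g phi : sob O v g -> test_function O phi ->
  [/\ exists a, hasint leb2 O (fun p : P => v p * d1 phi p) a,
      exists a, hasint leb2 O (fun p : P => v p * d2 phi p) a,
      exists a, hasint leb2 O (fun p : P => (g p).1 * phi p) a &
      exists a, hasint leb2 O (fun p : P => (g p).2 * phi p) a].
Proof.
move=> sO tphi; have [oO cv [m1 [m2 [i1 [i2 _]]]]] := sO.
have [c c1 c2 _ [K [cK KO K0]]] := test_facts tphi.
have mO : measurable (O : set P) by exact: open_measurable_plane.
have mv : measurable_fun (O : set P) (v : P -> T) by exact: sob_meas sO.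
have bnd (f : R * R -> R) (cf : {in O, continuous f}) := compact_bound cK KO cf.
have cT (f : R * R -> R) : continuous f -> {in O, continuous f} by move=> cf p _; exact: cf.
have mcf (f : R * R -> R) : continuous f -> measurable_fun (O : set P) (f : P -> T).
  by move=> cf; apply: continuous_measurable_plane => //; exact: cT.
have bint (f : P -> R) M : measurable_fun (O : set P) (f : P -> T) -> (forall p, ~ K p -> f p = 0) ->
   (forall p, K p -> `|f p| <= M) -> exists a, hasint leb2 O f a.
  by move=> mf f0 fM; apply: (hasint_supp oO cK KO mf f0); exists M.
have phi0 p : ~ K p -> phi p = 0 by move=> /K0[].
have d10 p : ~ K p -> d1 phi p = 0 by move=> /K0[].
have d20 p : ~ K p -> d2 phi p = 0 by move=> /K0[].
have [Mv hMv] := bnd v cv; have [Mp hMp] := bnd _ (cT _ c).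
have [M1 hM1] := bnd _ (cT _ c1); have [M2 hM2] := bnd _ (cT _ c2).
have vterm (f : R * R -> R) M : continuous f -> (forall p, ~ K p -> f p = 0) ->
   (forall p, K p -> `|f p| <= M) -> exists a, hasint leb2 O (fun p : P => v p * f p) a.
  move=> cf f0 fM; apply: (bint _ (Mv * M)).
  - by apply: measurable_funM => //; exact: mcf.
  - by move=> p /f0 ->; rewrite mulr0.
  - by move=> p Kp; rewrite normrM; apply: ler_pM => //; [exact: hMv|exact: fM].
have gterm (f : P -> R) : measurable_fun (O : set P) (f : P -> T) ->
   (\int[leb2]_(p in (O : set P)) (f p ^+ 2)%:E < +oo)%E ->
   exists a, hasint leb2 O (fun p : P => f p * phi p) a.
  move=> mf fi.
  have msq : measurable_fun (O : set P) (fun p : P => f p ^+ 2) by exact: measurable_funX.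
  have [a fa a0] := hasint_lty mO msq (fun p _ => sqr_ge0 (f p)) fi.
  have [b hb] : exists b, hasint leb2 O (fun p : P => phi p ^+ 2) b.
    apply: (bint _ (Mp ^+ 2)).
    - by apply: measurable_funX; exact: mcf.
    - by move=> p /phi0 ->; rewrite expr0n.
    - move=> p Kp; rewrite normrX; apply: lerXn2r; rewrite ?nnegrE//; last exact: hMp.
      by apply: le_trans (hMp _ Kp).
  have mfp : measurable_fun (O : set P) (fun p : P => f p * phi p).
    by apply: measurable_funM => //; exact: mcf.
  have [|e he _] := hasint_dom mO mfp (hasintD mO fa hb); last by exists e.
  move=> p _.
  have := sqr_ge0 (`|f p| - `|phi p|); rewrite normrM.
  have := real_normK (num_real (f p)); have := real_normK (num_real (phi p)).
  have := normr_ge0 (f p); have := normr_ge0 (phi p); nra.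
split.
- exact: (vterm _ M1).
- exact: (vterm _ M2).
- exact: (gterm (fun p => (g p).1)).
- exact: (gterm (fun p => (g p).2)).
Qed.

(** The energy of the sum is controlled by |a + b|^2 <= 2|a|^2 + 2|b|^2. *)
Lemma sob_add O v g v' g' (d d' : R) : sob O v g -> sob O v' g' ->
  (energy O g < d%:E)%E -> (energy O g' < d'%:E)%E ->
  L2_weak_gradient O (fun p => v p + v' p) (fun p => ((g p).1 + (g' p).1, (g p).2 + (g' p).2)) /\
  (energy O (fun p => ((g p).1 + (g' p).1, (g p).2 + (g' p).2)%R) < (2 * d + 2 * d')%R%:E)%E.
Proof.
move=> sO sO' E E'.
have [oO cv [m1 [m2 [i1 [i2 wk]]]]] := sO; have [_ cv' [m1' [m2' [i1' [i2' wk']]]]] := sO'.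
have mO : measurable (O : set P) by exact: open_measurable_plane.
have n1 : measurable_fun (O : set P) (fun p : P => (g p).1 : T) by exact: m1.
have n2 : measurable_fun (O : set P) (fun p : P => (g p).2 : T) by exact: m2.
have n1' : measurable_fun (O : set P) (fun p : P => (g' p).1 : T) by exact: m1'.
have n2' : measurable_fun (O : set P) (fun p : P => (g' p).2 : T) by exact: m2'.
have sq (a b : P -> R) : measurable_fun (O : set P) (a : P -> T) -> measurable_fun (O : set P) (b : P -> T) ->
  (\int[leb2]_(p in (O : set P)) (a p ^+ 2)%:E < +oo)%E -> (\int[leb2]_(p in (O : set P)) (b p ^+ 2)%:E < +oo)%E ->
  (\int[leb2]_(p in (O : set P)) ((a p + b p) ^+ 2)%:E < +oo)%E.
  move=> ma mb ia ib.
  have [x hx _] := hasint_lty mO (measurable_funX 2 ma) (fun p _ => sqr_ge0 (a p)) ia.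
  have [y hy _] := hasint_lty mO (measurable_funX 2 mb) (fun p _ => sqr_ge0 (b p)) ib.
  have ms : measurable_fun (O : set P) (fun p : P => (a p + b p) ^+ 2).
    by apply: measurable_funX; exact: measurable_funD.
  have [|z [_ hz] _] := hasint_dom mO ms (hasintD mO (hasintZ 2 mO hx) (hasintZ 2 mO hy)); last by rewrite hz ltry.
  move=> p _.
  rewrite ger0_norm ?sqr_ge0//; have := sqr_ge0 (a p - b p); nra.
split.
  split; first exact: measurable_funD n1 n1'.
  split; first exact: measurable_funD n2 n2'.
  split; first exact: sq n1 n1' i1 i1'.
  split; first exact: sq n2 n2' i2 i2'.
  move=> phi tphi.
  have [[a1 h1] [a2 h2] [a3 h3] [a4 h4]] := weak_integrable sO tphi.
  have [[b1 k1] [b2 k2] [b3 k3] [b4 k4]] := weak_integrable sO' tphi.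
  have [w1 w2] := wk _ tphi; have [w1' w2'] := wk' _ tphi.
  have add (f f' e e' h h' : P -> R) (a b c d0 : R) :
    hasint leb2 O f a -> hasint leb2 O f' b -> hasint leb2 O e c -> hasint leb2 O e' d0 ->
    (\int[leb2]_(p in (O : set P)) (f p)%:E = - \int[leb2]_(p in (O : set P)) (e p)%:E)%E ->
    (\int[leb2]_(p in (O : set P)) (f' p)%:E = - \int[leb2]_(p in (O : set P)) (e' p)%:E)%E ->
    (forall p, h p = f p + f' p) -> (forall p, h' p = e p + e' p) ->
    (\int[leb2]_(p in (O : set P)) (h p)%:E = - \int[leb2]_(p in (O : set P)) (h' p)%:E)%E.
    move=> hf hf' he he' ww ww' hh hh'.
    have [_ I1] := hasintD mO hf hf'; have [_ I2] := hasintD mO he he'.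
    rewrite (eq_integral (fun p => (f p + f' p)%:E)); last by move=> p _; rewrite hh.
    rewrite [X in (- X)%E](eq_integral (fun p => (e p + e' p)%:E)); last by move=> p _; rewrite hh'.
    rewrite I1 I2; case: hf => _ ef; case: hf' => _ ef'; case: he => _ ee; case: he' => _ ee'.
    move: ww ww'; rewrite ef ef' ee ee' -!EFinN => -[->] [->].
    by congr EFin; ring.
  split.
  - by apply: (add _ _ _ _ _ _ _ _ _ _ h1 k1 h3 k3 w1 w1') => p /=; ring.
  - by apply: (add _ _ _ _ _ _ _ _ _ _ h2 k2 h4 k4 w2 w2') => p /=; ring.
have me (a b : P -> R) : measurable_fun (O : set P) (a : P -> T) -> measurable_fun (O : set P) (b : P -> T) ->
   measurable_fun (O : set P) (fun p : P => a p ^+ 2 + b p ^+ 2).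
  by move=> ma mb; apply: measurable_funD; exact: measurable_funX.
have pe (a b : P -> R) p : 0 <= a p ^+ 2 + b p ^+ 2 by rewrite addr_ge0 ?sqr_ge0.
have [x hx _] := hasint_lty mO (me _ _ n1 n2) (fun p _ => pe _ _ p) (lt_trans E (ltry _)).
have [y hy _] := hasint_lty mO (me _ _ n1' n2') (fun p _ => pe _ _ p) (lt_trans E' (ltry _)).
have [|z [_ hz] zle] := hasint_dom mO (me _ _ (measurable_funD n1 n1') (measurable_funD n2 n2'))
   (hasintD mO (hasintZ 2 mO hx) (hasintZ 2 mO hy)); last first.
  move: E E'; rewrite /energy; case: hx => _ ->; case: hy => _ ->; rewrite hz !lte_fin.
  by have := ler_norm z; lra.
move=> p _; rewrite ger0_norm ?addr_ge0 ?sqr_ge0//=.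
have := sqr_ge0 ((g p).1 - (g' p).1); have := sqr_ge0 ((g p).2 - (g' p).2); nra.
Qed.

Lemma cap_union F0 A B O (a b : R) : open O -> (cap F0 A O < a%:E)%E -> (cap F0 B O < b%:E)%E ->
  (cap F0 (A `|` B) O < (2 * a + 2 * b)%R%:E)%E.
Proof.
move=> oO /cap_lt[v [g [[v0 [cv [[U [oU [FU U0]]] [W [oW [AW W1]]]]]] wv Ev]]].
move=> /cap_lt[v' [g' [[v0' [cv' [[U' [oU' [FU' U0']]] [W' [oW' [BW' W1']]]]]] wv' Ev']]].
have [wa Ea] := sob_add (And3 oO cv wv) (And3 oO cv' wv') Ev Ev'.
apply: (lt_cap _ wa Ea).
split; first by move=> p Op; rewrite addr_ge0 ?v0 ?v0'.
split; first by move=> p Op; apply: cvgD; [exact: cv|exact: cv'].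
split.
  exists (U `&` U'); split; first exact: openI.
  by split=> [p Fp|p [/U0 h /U0' h'] Op]; [split; [exact: FU|exact: FU']|rewrite h// h'// addr0].
exists ((W `|` W')); split; first exact: openU.
split; first by move=> p [/AW|/BW']; [left|right].
move=> p [/W1 h|/W1' h] Op; first by rewrite -[leLHS]addr0 lerD ?h ?v0'.
by rewrite -[leLHS]add0r lerD ?h ?v0.
Qed.

(** A form of [rho] < d with the capacities bounded separately: it follows from [rho] < d and
    implies [rho] < 2d. *)
Definition capclose O F V (d : R) (x y : R * R) := exists gam M, [/\ joins O x y gam M,
  (cap F (trace gam `\` V) O < (d ^+ 2)%:E)%E & (cap (bdry O) (trace gam `&` V) O < (d ^+ 2)%:E)%E].

Lemma sqrte_lt (X : \bar R) (d : R) : 0 < d -> (0 <= X)%E -> (sqrte X < d%:E)%E = (X < (d ^+ 2)%:E)%E.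
Proof.
move=> d0; case: X => [r| |]//=; rewrite ?lee_fin ?lte_fin// => r0.
by rewrite -[in LHS](ger0_norm (ltW d0)) -sqrtr_sqr ltr_sqrt// exprn_gt0.
Qed.

Lemma rho_capclose O F V (d : R) x y : 0 < d -> (rho O F V x y < d%:E)%E -> capclose O F V d x y.
Proof.
move=> d0 /ereal_inf_lt[_ [gam rg <-] lt].
have [gam' [M [jg tr]]] := rect_curveP rg.
exists gam', M; rewrite tr; split=> //.
  rewrite -sqrte_lt ?cap_ge0//; apply: le_lt_trans lt; rewrite leeDl// sqrte_ge0//.
by rewrite -sqrte_lt ?cap_ge0//; apply: le_lt_trans lt; rewrite leeDr// sqrte_ge0.
Qed.

Lemma capclose_rho O F V (d : R) x y : 0 < d -> capclose O F V d x y -> (rho O F V x y < (2 * d)%:E)%E.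
Proof.
move=> d0 [gam [M [jg c1 c2]]].
apply: (@le_lt_trans _ _ (sqrte (cap F (trace gam `\` V) O) + sqrte (cap (bdry O) (trace gam `&` V) O))%E).
  by apply: ereal_inf_lbound; exists gam => //; exact: joins_rect jg.
have -> : (2 * d)%:E = (d%:E + d%:E)%E by rewrite -EFinD; congr EFin; ring.
by apply: lteD; rewrite sqrte_lt ?cap_ge0.
Qed.

Lemma capclose_sym O F V (d : R) x y : capclose O F V d x y -> capclose O F V d y x.
Proof.
move=> [gam [M [jg c1 c2]]]; have [jg' tr] := joins_sym jg.
by exists (fun t => gam (1 - t)), M; rewrite tr.
Qed.

(** A triangle inequality with factor 2, exactly fitted to [cap_union]: (2d)^2 = 2d^2 + 2d^2. *)
Lemma capclose_trans O F V (d : R) x y z : open O -> capclose O F V d x y -> capclose O F V d y z ->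
  capclose O F V (2 * d) x z.
Proof.
move=> oO [gam [M [jg c1 c2]]] [gam' [M' [jg' c1' c2']]].
have [gam'' jg'' tr] := joins_cat jg jg'.
have E : (2 * d) ^+ 2 = 2 * d ^+ 2 + 2 * d ^+ 2 by ring.
exists gam'', (M + M'); split=> //; rewrite E.
- apply: cap_mono (cap_union oO c1 c1'); rewrite -setDUl; exact: setSD.
- apply: cap_mono (cap_union oO c2 c2'); rewrite -setIUl; exact: setSI.
Qed.

Lemma capclose_le O F V (d d' : R) x y : 0 <= d -> d <= d' -> capclose O F V d x y -> capclose O F V d' x y.
Proof.
move=> d0 dd [gam [M [jg c1 c2]]]; exists gam, M.
have le : ((d ^+ 2)%:E <= (d' ^+ 2)%:E)%E.
  by rewrite lee_fin lerXn2r// ?nnegrE//; exact: le_trans dd.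
by split=> //; [exact: lt_le_trans c1 le|exact: lt_le_trans c2 le].
Qed.

(* Points on the curve are as close to [x] as its endpoint, which makes rho-balls connected. *)
Lemma capclose_meet O F V (d : R) x y U : capclose O F V d x y -> open U -> U x -> ~ U y ->
  exists z, [/\ O z, capclose O F V d x z, ~ U z & closure U z].
Proof.
move=> [gam [M [jg c1 c2]]] oU Ux nUy.
have [cg gO g0 g1 gM] := jg.
have [tau [/andP[t0 t1] nt ht]] := first_exit cg oU ler01 ltac:(by rewrite g1).
have [js tr] := joins_sub jg (lexx 0) t0 t1.
exists (gam tau); split=> //; first by apply: gO; rewrite t0.
- exists (fun t => gam (0 + (tau - 0) * t)), M; split.
  + by rewrite -g0.
  + by apply: cap_mono c1; exact: setSD.
  + by apply: cap_mono c2; exact: setSI.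
- have tp : 0 < tau.
    by rewrite lt_neqAle t0 andbT; apply/eqP => E; apply: nt; rewrite -E g0.
  apply/closureP => e e0.
  have /nbhs_ballP[h /= h0 hB] : nbhs tau (gam @^-1` obox (gam tau) e).
    by apply: cg; apply: open_nbhs_nbhs; split; [exact: obox_open|exact: obox_center].
  have [s1 s2] : tau - h < Num.max 0 (tau - h / 2) /\ Num.max 0 (tau - h / 2) < tau.
    by split; [rewrite lt_max; apply/orP; right; lra|rewrite gt_max tp /=; lra].
  exists (gam (Num.max 0 (tau - h / 2))); last first.
    by apply: hB; rewrite /ball /= gtr0_norm; lra.
  by apply: ht; rewrite le_max lexx.
Qed.

(** F makes the first potential small in mean near y. The alternative deals with the second: either
    bdry O does the same for it, or V is absent near y, and then the first potential alone is at
    least 1 on the curve. *)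
Lemma capclose_local O F V y : domain O -> continuum F -> F `<=` O -> O y ->
  (exists2 r, 0 < r & obox y r `<=` O /\ nul (bdry O) O (obox y r)) \/
  (exists2 r : R, 0 < r & forall p, obox y r p -> ~ V p) ->
  forall e, 0 < e -> exists2 d, 0 < d & forall z, capclose O F V d y z -> obox y e z.
Proof.
move=> dO cF FO Oy alt e e0.
have [oO _] := dO.
have mb c r : measurable (obox c r : set P) by exact: open_measurable_plane (@obox_open R _ _).
have [r1 r10 [B1 n1]] := nul_continuum dO cF FO Oy.
have [r2 r20 alt2] : exists2 r2 : R, 0 < r2 & 
  (obox y r2 `<=` O /\ nul (bdry O) O (obox y r2)) \/ (forall p, obox y r2 p -> ~ V p).
  by case: alt => -[r2 r20 h]; exists r2 => //; [left|right].
pose r := Num.min e (Num.min r1 r2).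
have r0 : 0 < r by rewrite !lt_min e0 r10.
have sub s : r <= s -> obox y r `<=` obox y s.
  by move=> rs p /oboxP[a b]; apply/oboxP; split; exact: lt_le_trans rs.
have re : r <= e by rewrite ge_min lexx.
have rr1 : r <= r1 by rewrite !ge_min lexx orbT.
have rr2 : r <= r2 by rewrite !ge_min lexx !orbT.
have BO : obox y r `<=` O by apply: subset_trans B1; exact: sub.
have e1 : 0 < r ^+ 2 / 8 by rewrite divr_gt0// exprn_gt0.
have e2 : 0 < r / 16 by rewrite divr_gt0.
have [d1 d10 h1] := nul_sub oO (mb _ _) (mb _ _) (sub _ rr1) B1 n1 e1.
have [d2 d20 h2] := L1_small (@obox_open R y r) BO (leb2_obox_lty y r0) e2.
have [d3 d30 h3] : exists2 d3 : R, 0 < d3 & (forall p, obox y r p -> ~ V p) \/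
   forall v g, small_class (bdry O) O v g -> (energy O g < d3%:E)%E ->
     (\int[leb2]_(p in obox y r) (v p)%:E <= (r ^+ 2 / 8)%:E)%E.
  case: alt2 => [[B2 n2]|nV].
    have [d3 d30 h3] := nul_sub oO (mb _ _) (mb _ _) (sub _ rr2) B2 n2 e1.
    by exists d3 => //; right.
  by exists 1 => //; left => p /(sub _ rr2); exact: nV.
(* The minimum with 1 gives m^2 <= m, so an energy below m^2 is below each of the three
   thresholds. *)
pose m := Num.min 1 (Num.min d1 (Num.min d2 d3)).
have m0 : 0 < m by rewrite !lt_min ltr01 d10 d20.
have mm : m ^+ 2 <= m by rewrite expr2 ler_piMl ?(ltW m0)// ge_min lexx.
have md1 : m ^+ 2 <= d1 by apply: (le_trans mm); rewrite !ge_min lexx !orbT.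
have md2 : m ^+ 2 <= d2 by apply: (le_trans mm); rewrite !ge_min lexx !orbT.
have md3 : m ^+ 2 <= d3 by apply: (le_trans mm); rewrite !ge_min lexx !orbT.
exists m => // z [gam [M [[cg gO g0 g1 gM] c1 c2]]].
apply: contrapT => nz.
have [v [g [[v0 [cv [[U [oU [FU U0]]] [W [oW [AW W1]]]]]] wv Ev]]] := cap_lt c1.
have [v' [g' [[v0' [cv' [[U' [oU' [FU' U0']]] [W' [oW' [BW' W1']]]]]] wv' Ev']]] := cap_lt c2.
have sO : sob O v g by [].
have sO' : sob O v' g' by [].
have sB := sob_sub (@obox_open R y r) BO sO.
have sB' := sob_sub (@obox_open R y r) BO sO'.
have K1 : small_class F O v g by split=> //; exists U.
have K1' : small_class (bdry O) O v' g' by split=> //; exists U'.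
have lt d w : m ^+ 2 <= d -> (energy O w < (m ^+ 2)%:E)%E -> (energy O w < d%:E)%E.
  by move=> md /lt_le_trans; apply; rewrite lee_fin.
have iv := h1 _ _ K1 (lt _ _ md1 Ev).
have [l1 l2] := h2 _ _ sO (lt _ _ md2 Ev).
have [l1' l2'] := h2 _ _ sO' (lt _ _ md2 Ev').
have ex : exists2 t, 0 <= t <= 1 & ~ obox y r (gam t).
  by exists 1; [rewrite ler01 lexx|rewrite g1 => /(sub _ re)].
have tr t : 0 <= t <= 1 -> trace gam (gam t) by move=> t01; exists t => //; rewrite /= in_itv.
have v0B p : obox y r p -> 0 <= v p by move=> /BO/v0.
have v0B' p : obox y r p -> 0 <= v' p by move=> /BO/v0'.
case: h3 => [nV|h3].
  (* With V absent, v plays the part of both potentials. *)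
  apply: (crossing r0 sB sB v0B v0B cg g0 ex) => // t t01 Bt; left.
  apply: W1; last exact: BO.
  by apply: AW; split; [exact: tr|exact: nV].
apply: (crossing r0 sB sB' v0B v0B' cg g0 ex) => //; last exact: h3 K1' (lt _ _ md3 Ev').
move=> t t01 Bt; have [Vt|nVt] := pselect (V (gam t)); [right|left].
  by apply: W1'; [apply: BW'; split=> //; exact: tr|exact: BO].
by apply: W1; [apply: AW; split=> //; exact: tr|exact: BO].
Qed.

End Caps.

(** * The logarithmic cut-off *)

Section Cutoff.
Variable R : realType.
Local Notation T := (measurableTypeR R).
Local Notation P := (T * T)%type.
Local Notation mu := (@lebesgue_measure R).
Local Notation leb2 := (mu \x mu)%E.
Implicit Types (O U F K : set (R * R)) (v : R * R -> R) (g : R * R -> R * R).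

Lemma slice1_continuous (f : R * R -> R) (y : R) : continuous f -> continuous (fun x : R => f (x, y)).
Proof.
move=> cf x A /cf /nbhs_obox[e e0 eA]; apply/nbhs_ballP; exists e => // z zx.
by apply: eA; apply/oboxP => /=; rewrite subrr normr0.
Qed.

(** On each row the fundamental theorem is applied to v * phi, which vanishes at both ends of
    [- M, M]; the compact support supplies the integrability for Fubini. *)
Lemma ibp1 v w phi psi K : continuous v -> continuous w -> continuous phi -> continuous psi ->
  (forall p : R * R, is_derive (p.1 : R) 1 (fun x : R => v (x, p.2)) (w p)) ->
  (forall p : R * R, is_derive (p.1 : R) 1 (fun x : R => phi (x, p.2)) (psi p)) ->
  compact K -> (forall p, ~ K p -> phi p = 0) -> (forall p, ~ K p -> psi p = 0) ->
  (\int[leb2]_(p in [set: P]) (v p * psi p)%:E = - \int[leb2]_(p in [set: P]) (w p * phi p)%:E)%E.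
Proof.
move=> cv cw cphi cpsi dv dphi cK phi0 psi0.
have cT (f : R * R -> R) : continuous f -> {in setT, continuous f} by move=> cf p _; exact: cf.
have mT (f : R * R -> R) : continuous f -> measurable_fun [set: P] (f : P -> T).
  by move=> cf; apply: continuous_measurable_plane; [exact: openT|exact: cT].
have cM (f h : R * R -> R) : continuous f -> continuous h -> continuous (fun p => f p * h p).
  by move=> cf ch p; apply: continuousM; [exact: cf|exact: ch].
have hi (f h : R * R -> R) : continuous f -> continuous h -> (forall p, ~ K p -> h p = 0) ->
   exists a, hasint leb2 setT (fun p : P => f p * h p) a.
  move=> cf ch h0; apply: (hasint_supp openT cK) => //.
  - by apply: mT; exact: cM.
  - by move=> p /h0 ->; rewrite mulr0.
  - by apply: (compact_bound (O := setT) cK) => //; apply: cT; exact: cM.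
have [a ha] := hi _ _ cv cpsi psi0; have [b hb] := hi _ _ cw cphi phi0.
have hab := hasintD measurableT ha hb.
suff ab0 : a + b = 0.
  by have [_ ->] := ha; have [_ ->] := hb; rewrite -EFinN; congr EFin; lra.
have [M M0 KM] := compact_sub_obox cK.
have [iab eab] := hab; apply: EFin_inj; rewrite -eab.
have := integral21_prod_meas1 iab; rewrite /fubini_G /= => <-.
rewrite integral0_eq// => y _.
rewrite -(@integral_supp R _ _ mu `[- M, M]%classic); last first.
  move=> x nx; have nK : ~ K (x, y).
    move=> /KM/oboxP[/=]; rewrite sub0r normrN ltr_norml => /andP[? ?] _; apply: nx.
    by rewrite /= in_itv /=; apply/andP; split; exact: ltW.
  by rewrite phi0// psi0// !mulr0 addr0.
have out x : M <= `|x| -> phi (x, y) = 0.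
  by move=> Mx; apply: phi0 => /KM/oboxP[/=]; rewrite sub0r normrN; lra.
have D (x : R) : is_derive x 1 (fun x => v (x, y) * phi (x, y)) (v (x, y) * psi (x, y) + w (x, y) * phi (x, y)).
  apply: is_derive_eq (is_deriveM (dv (x, y)) (dphi (x, y))) _.
  by rewrite /GRing.scale /= [phi _ * _]mulrC.
have C : continuous (fun x => v (x, y) * psi (x, y) + w (x, y) * phi (x, y)).
  apply: (@slice1_continuous (fun p => v p * psi p + w p * phi p)) => p.
  by apply: cvgD; apply: cM.
have le : - M <= M by lra.
have [oM oN] : phi (M, y) = 0 /\ phi (- M, y) = 0.
  by split; apply: out; rewrite ?normrN; exact: ler_norm.
by have := FTC le D C; rewrite oM oN !mulr0 subrr.
Qed.

(** A classical gradient, expressed by one-variable derivatives along lines as [ibp1] uses it. *)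
Definition gradient v g := [/\ continuous v, continuous (fun p => (g p).1), continuous (fun p => (g p).2),
  forall p : R * R, is_derive (p.1 : R) 1 (fun x : R => v (x, p.2)) (g p).1 &
  forall p : R * R, is_derive (p.2 : R) 1 (fun x : R => v (p.1, x)) (g p).2].

Lemma gradient_weak O v g (E : R) : open O -> gradient v g -> (energy O g < E%:E)%E -> L2_weak_gradient O v g.
Proof.
move=> oO [cv c1 c2 e1 e2] fE.
have mO : measurable (O : set P) by exact: open_measurable_plane.
have mc (f : R * R -> R) : continuous f -> measurable_fun (O : set P) (f : P -> T).
  by move=> cf; apply: continuous_measurable_plane => // p _; exact: cf.
have m1 := mc _ c1; have m2 := mc _ c2.
have msum : measurable_fun (O : set P) (fun p : P => (((g p).1) ^+ 2 + ((g p).2) ^+ 2)%:E).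
  by apply/measurable_EFinP; apply: measurable_funD; exact: measurable_funX.
split; first exact: m1.
split; first exact: m2.
split.
  apply: le_lt_trans (lt_trans fE (ltry _)); apply: ge0_le_integral => //.
  + by move=> p _; rewrite lee_fin sqr_ge0.
  + by apply/measurable_EFinP; exact: measurable_funX.
  + by move=> p _; rewrite lee_fin lerDl sqr_ge0.
split.
  apply: le_lt_trans (lt_trans fE (ltry _)); apply: ge0_le_integral => //.
  + by move=> p _; rewrite lee_fin sqr_ge0.
  + by apply/measurable_EFinP; exact: measurable_funX.
  + by move=> p _; rewrite lee_fin lerDr sqr_ge0.
move=> phi tphi; have [c d1c d2c dv [K [cK KO K0]]] := test_facts tphi.
have phi0 p : ~ K p -> phi p = 0 by move=> /K0[].
have d10 p : ~ K p -> d1 phi p = 0 by move=> /K0[].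
have d20 p : ~ K p -> d2 phi p = 0 by move=> /K0[].
have dp1 (p : R * R) : is_derive (p.1 : R) 1 (fun x : R => phi (x, p.2)) (d1 phi p).
  by apply/derive_slice1; apply: DeriveDef => //; case: (dv p).
have dp2 (p : R * R) : is_derive (p.2 : R) 1 (fun x : R => phi (p.1, x)) (d2 phi p).
  by apply/derive_slice2; apply: DeriveDef => //; case: (dv p).
have sO (f h : R * R -> R) : (forall p, ~ K p -> h p = 0) ->
   (\int[leb2]_(p in (O : set P)) (f p * h p)%:E = \int[leb2]_(p in [set: P]) (f p * h p)%:E)%E.
  by move=> h0; apply: integral_supp => p np; rewrite h0 ?mulr0// => /KO.
split.
  by rewrite !sO//; apply: (ibp1 cv c1 c d1c e1 dp1 cK).
rewrite !sO//.
have cs (f : R * R -> R) : continuous f -> continuous (f \o @pswap R).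
  by move=> cf p; apply: continuous_comp; [exact: pswap_continuous|exact: cf].
have cM (f h : R * R -> R) : continuous f -> continuous h -> measurable_fun [set: P] (fun p : P => (f p * h p)%:E).
  move=> cf ch; apply/measurable_EFinP; apply: continuous_measurable_plane; first exact: openT.
  by move=> p _; apply: continuousM; [exact: cf|exact: ch].
rewrite -(integral_pswapT (cM _ _ cv d2c)) -(integral_pswapT (cM _ _ c2 c)).
apply: (@ibp1 (v \o @pswap R) _ (phi \o @pswap R) (d2 phi \o @pswap R) (@pswap R @` K)).
- exact: cs.
- exact: (cs _ c2).
- exact: cs.
- exact: cs.
- by move=> p; exact: (e2 (pswap p)).
- by move=> p; exact: (dp2 (pswap p)).
- by apply: continuous_compact => //; apply: continuous_subspaceT; exact: pswap_continuous.
- by move=> p np; apply: phi0 => Kp; apply: np; exists (pswap p) => //; exact: pswapK.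
- by move=> p np; apply: d20 => Kp; apply: np; exists (pswap p) => //; exact: pswapK.
Qed.

Lemma gradient_onem v g : gradient v g -> gradient (fun p => 1 - v p) (fun p => (- (g p).1, - (g p).2)).
Proof.
move=> [cv c1 c2 e1 e2]; split.
- by move=> p; apply: cvgB; [exact: cvg_cst|exact: cv].
- by move=> p; apply: cvgN; exact: c1.
- by move=> p; apply: cvgN; exact: c2.
- move=> p; apply: is_derive_eq (is_deriveB (is_derive_cst _ _ _) (e1 p)) _; exact: sub0r.
- move=> p; apply: is_derive_eq (is_deriveB (is_derive_cst _ _ _) (e2 p)) _; exact: sub0r.
Qed.

Section LogCutoff.
Variables (c : R * R) (s : R) (s0 : 0 < s).

Definition sqdist (p : R * R) : R := (p.1 - c.1) ^+ 2 + (p.2 - c.2) ^+ 2.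
(** A multiple of this density dominates the squared gradient of the cut-off. Its integral grows
    only logarithmically with the box, which is why points have zero capacity. *)
Definition green (p : R * R) : R := (s ^+ 2 + sqdist p)^-1.

Lemma sqdist_ge0 p : 0 <= sqdist p. Proof. by rewrite addr_ge0 ?sqr_ge0. Qed.

Let s20 : 0 < s ^+ 2. Proof. by rewrite exprn_gt0. Qed.
Let sq0 p : 0 < s ^+ 2 + sqdist p. Proof. by rewrite ltr_wpDr ?sqdist_ge0. Qed.

Lemma sqdist_continuous : continuous sqdist.
Proof.
move=> p; rewrite /sqdist; apply: cvgD.
  have h : (fun q : R * R => q.1 - c.1) q @[q --> p] --> p.1 - c.1.
    by apply: cvgB; [exact: cvg_fst|exact: cvg_cst].
  by rewrite expr2; under [X in X @ _ --> _]eq_fun do rewrite expr2; exact: cvgM.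
have h : (fun q : R * R => q.2 - c.2) q @[q --> p] --> p.2 - c.2.
  by apply: cvgB; [exact: cvg_snd|exact: cvg_cst].
by rewrite expr2; under [X in X @ _ --> _]eq_fun do rewrite expr2; exact: cvgM.
Qed.

Lemma green_gt0 p : 0 < green p. Proof. by rewrite invr_gt0. Qed.

Lemma green_continuous : continuous green.
Proof.
move=> p; apply: cvgV; first by rewrite gt_eqF.
by apply: cvgD; [exact: cvg_cst|exact: sqdist_continuous].
Qed.

Lemma out_obox_sqdist p (r : R) : 0 <= r -> ~ obox c r p -> r ^+ 2 <= sqdist p.
Proof.
move=> r0 np; rewrite leNgt; apply/negP => h; apply: np; apply/oboxP.
have k (a : R) : a ^+ 2 < r ^+ 2 -> `|a| < r.
  by move=> h'; rewrite -ltr_sqr ?nnegrE// real_normK ?num_real.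
rewrite (distrC c.1) (distrC c.2); split; apply: k; apply: le_lt_trans h.
  by rewrite lerDl sqr_ge0.
by rewrite lerDr sqr_ge0.
Qed.

(** By dyadic shells: between the boxes of radius r and 2r the density is at most r^-2 and the area
    at most (4r)^2, so each shell costs at most 16. *)
Lemma green_integral (m : nat) :
  (\int[leb2]_(p in (obox c (2 ^+ m * s) : set P)) (green p)%:E <= (16 * m.+1%:R)%:E)%E.
Proof.
have mb r : measurable (obox c r : set P) by exact: open_measurable_plane (@obox_open R c r).
have mg A : measurable A -> measurable_fun (A : set P) (fun p : P => (green p)%:E).
  move=> mA; apply/measurable_EFinP; apply: (@measurable_funS _ _ _ _ setT) => //.
  by apply: continuous_measurable_plane; [exact: openT|move=> p _; exact: green_continuous].
have g0 (p : P) : (0 <= (green p)%:E)%E by rewrite lee_fin ltW// green_gt0.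
have cstb (A : set P) r (k : R) : measurable A -> 0 <= k -> 0 < r -> A `<=` obox c r -> (forall p, A p -> green p <= k) ->
    (\int[leb2]_(p in A) (green p)%:E <= (k * ((2 * r) * (2 * r)))%:E)%E.
  move=> mA k0 r0 Ar hk.
  apply: (@le_trans _ _ (\int[leb2]_(p in A) (cst k%:E) p)%E).
    by apply: ge0_le_integral => //; exact: mg.
  rewrite integral_cst// EFinM; apply: lee_wpmul2l; first by rewrite lee_fin.
  by rewrite -(leb2_obox c r0); apply: le_measure; rewrite ?inE.
elim: m => [|m IH].
  apply: (le_trans (cstb _ (2 ^+ 0 * s) (s ^+ 2)^-1 (mb _) _ _ (@subset_refl _ _) _)).
  - by rewrite invr_ge0 ltW.
  - by rewrite expr0 mul1r.
  - by move=> p _; rewrite lef_pV2 ?posrE// lerDl sqdist_ge0.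
  rewrite lee_fin expr0 mul1r.
  have -> : (s ^+ 2)^-1 * (2 * s * (2 * s)) = 4 by field; rewrite gt_eqF.
  by lra.
have r0 : 0 < 2 ^+ m * s by rewrite mulr_gt0// exprn_gt0.
set r := 2 ^+ m * s in IH r0.
have rS : 2 ^+ m.+1 * s = 2 * r by rewrite exprS -mulrA.
rewrite rS.
have sub : obox c r `<=` obox c (2 * r).
  by move=> p /oboxP[a b]; apply/oboxP; split; lra.
have -> : obox c (2 * r) = obox c r `|` (obox c (2 * r) `\` obox c r).
  by rewrite setDUK.
rewrite ge0_integral_setU//=; last 3 first.
- by apply: measurableD; exact: mb.
- by apply: mg; apply: measurableU; [exact: mb|apply: measurableD; exact: mb].
- by apply/disj_setPS => p [? []].
apply: (@le_trans _ _ ((16 * m.+1%:R)%:E + 16%:E)%E); last first.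
  by rewrite -EFinD lee_fin -[m.+2%:R]natr1; lra.
apply: leeD; first exact: IH.
apply: (le_trans (cstb _ (2 * r) (r ^+ 2)^-1 _ _ _ _ _)).
- by apply: measurableD; exact: mb.
- by rewrite invr_ge0 sqr_ge0.
- by rewrite mulr_gt0.
- by move=> p [].
- move=> p [_ np]; rewrite lef_pV2 ?posrE ?exprn_gt0//.
  by apply: le_trans (out_obox_sqdist (ltW r0) np) _; rewrite lerDr ltW.
rewrite lee_fin; have -> : (r ^+ 2)^-1 * (2 * (2 * r) * (2 * (2 * r))) = 16 by field; rewrite gt_eqF.
by [].
Qed.

Variable n : nat.
Hypothesis n0 : (0 < n)%N.

Let nR : 0 < n%:R :> R. Proof. by rewrite ltr0n. Qed.

(** Equal to -1 at c. The shift by 1 leaves it nonpositive, hence the cut-off equal to 1, as long as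
    ln (1 + |p - c|^2/s^2) <= n, in particular on a box about c. *)
Definition logarg (p : R * R) : R := n%:R^-1 * (ln (s ^+ 2 + sqdist p) - ln (s ^+ 2)) - 1.
Definition cutoff p := 1 - step (logarg p).
Definition dcutoff p : R * R :=
  (- (dstep (logarg p) * (n%:R^-1 * (green p * (2 * (p.1 - c.1))))),
   - (dstep (logarg p) * (n%:R^-1 * (green p * (2 * (p.2 - c.2)))))).

(** On a horizontal or vertical line s^2 + |p - c|^2 has the form k + (z - a)^2 with k constant, so
    one computation serves both partial derivatives. *)
Lemma is_derive_cutoff_line (a k x : R) : (forall z : R, 0 < k + (z - a) ^+ 2) ->
  is_derive x 1 (fun z : R => 1 - step (n%:R^-1 * (ln (k + (z - a) ^+ 2) - ln (s ^+ 2)) - 1))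
   (- (dstep (n%:R^-1 * (ln (k + (x - a) ^+ 2) - ln (s ^+ 2)) - 1) *
     (n%:R^-1 * ((k + (x - a) ^+ 2)^-1 * (2 * (x - a)))))).
Proof.
move=> k0.
have D1 : is_derive x 1 (fun z : R => k + (z - a) ^+ 2) (2 * (x - a)).
  have h : is_derive x 1 (fun z : R => z - a) 1.
    by apply: is_derive_eq (is_deriveB (is_derive_id _ _) (is_derive_cst _ _ _)) _; rewrite subr0.
  have h2 : is_derive x 1 (fun z : R => (z - a) * (z - a)) ((x - a) * 1 + (x - a) * 1).
    exact: (is_deriveM h h).
  have -> : (fun z : R => k + (z - a) ^+ 2) = (fun z => k + (z - a) * (z - a)).
    by apply/funext => z; rewrite expr2.
  have h3 : is_derive x 1 (fun z : R => k + (z - a) * (z - a)) (0 + ((x - a) * 1 + (x - a) * 1)).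
    exact: (is_deriveD (is_derive_cst k x 1) h2).
  by apply: is_derive_eq h3 _; ring.
have D2 : is_derive x 1 (fun z : R => ln (k + (z - a) ^+ 2)) ((k + (x - a) ^+ 2)^-1 * (2 * (x - a))).
  exact: (@is_derive1_comp _ (@ln R) (fun z : R => k + (z - a) ^+ 2) x _ _ (is_derive1_ln (k0 x)) D1).
have D3 : is_derive x 1 (fun z : R => n%:R^-1 * (ln (k + (z - a) ^+ 2) - ln (s ^+ 2)) - 1)
    (n%:R^-1 * ((k + (x - a) ^+ 2)^-1 * (2 * (x - a)))).
  set L := fun z : R => ln (k + (z - a) ^+ 2) in D2 *.
  set l := _ * (2 * _) in D2 *.
  have h : is_derive x 1 (fun z : R => L z - ln (s ^+ 2)) (l - 0).
    exact: (is_deriveB D2 (is_derive_cst (ln (s ^+ 2)) x 1)).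
  have h2 : is_derive x 1 (fun z : R => n%:R^-1 * (L z - ln (s ^+ 2)))
      (n%:R^-1 * (l - 0) + (L x - ln (s ^+ 2)) * 0).
    exact: (is_deriveM (is_derive_cst (n%:R^-1 : R) x 1) h).
  have h3 : is_derive x 1 (fun z : R => n%:R^-1 * (L z - ln (s ^+ 2)) - 1)
      (n%:R^-1 * (l - 0) + (L x - ln (s ^+ 2)) * 0 - 0).
    exact: (is_deriveB h2 (is_derive_cst (1 : R) x 1)).
  by apply: is_derive_eq h3 _; ring.
have D4 := @is_derive1_comp _ (@step R) _ x _ _ (is_derive_step _) D3.
by apply: is_derive_eq (is_deriveB (is_derive_cst (1 : R) x 1) D4) _; rewrite sub0r.
Qed.

Lemma logarg_continuous : continuous logarg.
Proof.
move=> p; apply: cvgB; last exact: cvg_cst.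
apply: cvgM; first exact: cvg_cst.
apply: cvgB; last exact: cvg_cst.
apply: (@continuous_comp _ _ _ (fun p => s ^+ 2 + sqdist p) (@ln R)).
  by apply: cvgD; [exact: cvg_cst|exact: sqdist_continuous].
exact: continuous_ln.
Qed.

Lemma gradient_cutoff : gradient cutoff dcutoff.
Proof.
have cst1 : continuous (@step R) by exact: smooth_continuous (@smooth_step R).
have cds : continuous (@dstep R) by exact: smooth_continuous (@smooth_dstep R).
have cg (f : R * R -> R) (a : R) : continuous f ->
  continuous (fun p => - (dstep (logarg p) * (n%:R^-1 * (green p * (2 * (f p - a)))))).
  move=> cf p; apply: cvgN; apply: cvgM.
    by apply: (@continuous_comp _ _ _ logarg (@dstep R)); [exact: logarg_continuous|exact: cds].
  apply: cvgM; first exact: cvg_cst.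
  apply: cvgM; first exact: green_continuous.
  apply: cvgM; first exact: cvg_cst.
  by apply: cvgB; [exact: cf|exact: cvg_cst].
have line (q : R -> R * R) (a k x : R) : (forall z, s ^+ 2 + sqdist (q z) = k + (z - a) ^+ 2) ->
    is_derive x 1 (fun z => cutoff (q z))
      (- (dstep (logarg (q x)) * (n%:R^-1 * (green (q x) * (2 * (x - a)))))).
  move=> E; have D := @is_derive_cutoff_line a k x.
  have -> : (fun z => cutoff (q z)) =
      (fun z => 1 - step (n%:R^-1 * (ln (k + (z - a) ^+ 2) - ln (s ^+ 2)) - 1)).
    by apply/funext => z; rewrite /cutoff /logarg E.
  by rewrite /logarg /green E; apply: D => z; rewrite -E.
split.
- move=> p; apply: cvgB; first exact: cvg_cst.
  by apply: (@continuous_comp _ _ _ logarg (@step R)); [exact: logarg_continuous|exact: cst1].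
- by apply: (cg fst) => p; exact: cvg_fst.
- by apply: (cg snd) => p; exact: cvg_snd.
- move=> p; have := line (fun z => (z, p.2)) c.1 (s ^+ 2 + (p.2 - c.2) ^+ 2) p.1.
  by rewrite -surjective_pairing; apply => z; rewrite /sqdist /=; ring.
- move=> p; have := line (fun z => (p.1, z)) c.2 (s ^+ 2 + (p.1 - c.1) ^+ 2) p.2.
  by rewrite -surjective_pairing; apply => z; rewrite /sqdist /=; ring.
Qed.

(** There q = |p - c|^2/s^2 is at most 1, and ln (1 + q) <= q <= 1 <= n. *)
Lemma cutoff_in p : obox c (s / 2) p -> cutoff p = 1.
Proof.
move=> /oboxP[a b]; rewrite /cutoff step0 ?subr0// /logarg.
rewrite subr_le0 ler_pdivrMl// mulr1 -ln_div ?posrE//.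
have qs : sqdist p <= s ^+ 2.
  have k (u : R) : `|u| < s / 2 -> u ^+ 2 <= s ^+ 2 / 4.
    rewrite ltr_norml => /andP[? ?]; nra.
  have := k _ a; have := k _ b; rewrite /sqdist -(sqrrN (p.1 - _)) -(sqrrN (p.2 - _)) !opprB.
  have := s20; lra.
have -> : (s ^+ 2 + sqdist p) / s ^+ 2 = 1 + sqdist p / s ^+ 2.
  by rewrite mulrDl divff// gt_eqF.
have q0 : 0 <= sqdist p / s ^+ 2 by rewrite divr_ge0 ?sqdist_ge0// ltW.
apply: (le_trans (le_ln1Dx _)); first by lra.
apply: (@le_trans _ _ 1); first by rewrite ler_pdivrMr// mul1r.
by rewrite ler1n.
Qed.

Lemma expR1_le4 : expR 1 <= 4 :> R.
Proof.
have h : expR (1 / 2) <= 2 :> R.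
  have := @expR_ge1Dx R (- (1 / 2)); rewrite expRN => h.
  have := expR_gt0 (1 / 2 : R); set x := expR _ in h * => x0.
  by move: h; rewrite -(ler_pM2l x0) mulfV ?gt_eqF//; lra.
have -> : 1 = 1 / 2 + 1 / 2 :> R by lra.
by rewrite expRD; have := expR_gt0 (1 / 2 : R); nra.
Qed.

(** There |p - c|^2/s^2 >= 4^(2n) >= e^(2n), because e <= 4; the logarithm divided by n is at least
    2. *)
Lemma logarg_out p : ~ obox c (2 ^+ (2 * n) * s) p -> 1 <= logarg p.
Proof.
move=> np; have r0 : 0 <= 2 ^+ (2 * n) * s by rewrite mulr_ge0 ?exprn_ge0// ltW.
have := out_obox_sqdist r0 np => h.
rewrite /logarg lerBrDr ler_pdivlMl// -ln_div ?posrE//.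
rewrite -(expRK (n%:R * (1 + 1))) ler_ln ?posrE ?expR_gt0 ?divr_gt0//.
have -> : (s ^+ 2 + sqdist p) / s ^+ 2 = 1 + sqdist p / s ^+ 2.
  by rewrite mulrDl divff// gt_eqF.
apply: (@le_trans _ _ (sqdist p / s ^+ 2)); last by rewrite lerDr.
rewrite ler_pdivlMr//; apply: le_trans h.
rewrite exprMn; apply: ler_wpM2r; first exact: ltW.
have -> : n%:R * (1 + 1) = (2 * n)%:R * 1 :> R by rewrite natrM; ring.
rewrite expRM_natl exprAC; have -> : 2 ^+ 2 = 4 :> R by ring.
by apply: lerXn2r; rewrite ?nnegrE ?expR_ge0// expR1_le4.
Qed.

Lemma cutoff_out p : ~ obox c (2 ^+ (2 * n) * s) p -> cutoff p = 0.
Proof. by move=> /logarg_out h; rewrite /cutoff step1// subrr. Qed.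

Lemma cutoff_ge0 p : 0 <= cutoff p <= 1.
Proof. by rewrite /cutoff subr_ge0 step_le1 lerBlDr lerDl step_ge0. Qed.

(** The squared gradient is at most 4 C^2/n^2 times [green], because [green] times |p - c|^2 is at
    most 1. It vanishes off the box of radius 2^(2n) s, over which [green] integrates to at most 16
    (2n + 1) <= 48 n; and 4 * 48 = 192. *)
Lemma energy_cutoff O (C : R) : open O -> (forall x : R, dstep x <= C) ->
  (energy O dcutoff <= (192 * C ^+ 2 / n%:R)%:E)%E.
Proof.
move=> oO hC.
have mO : measurable (O : set P) by exact: open_measurable_plane.
have [_ c1 c2 _ _] := gradient_cutoff.
have C0 : 0 <= C by apply: le_trans (hC 0); exact: dstep_ge0.
have pt p : (dcutoff p).1 ^+ 2 + (dcutoff p).2 ^+ 2 <= 4 * C ^+ 2 / n%:R ^+ 2 * green p.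
  have -> : (dcutoff p).1 ^+ 2 + (dcutoff p).2 ^+ 2 =
     (4 / n%:R ^+ 2 * green p) * (dstep (logarg p) ^+ 2 * (green p * sqdist p)).
    by rewrite /dcutoff /sqdist /=; field; rewrite gt_eqF.
  have -> : 4 * C ^+ 2 / n%:R ^+ 2 * green p = (4 / n%:R ^+ 2 * green p) * (C ^+ 2 * 1) by ring.
  apply: ler_wpM2l; first by rewrite mulr_ge0 ?divr_ge0 ?sqr_ge0// ltW// green_gt0.
  apply: ler_pM; rewrite ?sqr_ge0// ?mulr_ge0 ?sqdist_ge0 ?(ltW (green_gt0 p))//.
    by apply: lerXn2r; rewrite ?nnegrE ?dstep_ge0.
  by rewrite /green mulrC ler_pdivrMr// mul1r lerDr ltW.
have msum (A : set P) : measurable A -> measurable_fun (A : set P) (fun p : P => ((dcutoff p).1 ^+ 2 + (dcutoff p).2 ^+ 2)%:E).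
  move=> mA; apply: (@measurable_funS _ _ _ _ setT) => //.
  apply/measurable_EFinP; apply: continuous_measurable_plane; first exact: openT.
  move=> p _; apply: cvgD; rewrite expr2; under [X in X @ _ --> _]eq_fun do rewrite expr2;
    apply: cvgM; by [exact: c1|exact: c2].
have pos p : (0 <= ((dcutoff p).1 ^+ 2 + (dcutoff p).2 ^+ 2)%:E)%E by rewrite lee_fin addr_ge0 ?sqr_ge0.
have mB : measurable (obox c (2 ^+ (2 * n) * s) : set P) by exact: open_measurable_plane (@obox_open R _ _).
have mgr : measurable_fun (obox c (2 ^+ (2 * n) * s) : set P) (fun p : P => (green p)%:E).
  apply/measurable_EFinP; apply: (@measurable_funS _ _ _ _ setT) => //.
  by apply: continuous_measurable_plane; [exact: openT|move=> p _; exact: green_continuous].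
have k0 : 0 <= 4 * C ^+ 2 / n%:R ^+ 2 by rewrite divr_ge0 ?mulr_ge0 ?sqr_ge0.
apply: (@le_trans _ _ (\int[leb2]_(p in [set: P]) ((dcutoff p).1 ^+ 2 + (dcutoff p).2 ^+ 2)%:E)%E).
  by apply: ge0_subset_integral => //; exact: msum.
rewrite -(@integral_supp R _ _ leb2 (obox c (2 ^+ (2 * n) * s))); last first.
  by move=> p /logarg_out h; rewrite /dcutoff /= dstep_out ?mul0r ?oppr0 ?expr0n /= ?addr0//; right.
apply: (@le_trans _ _ (\int[leb2]_(p in obox c (2 ^+ (2 * n) * s)) ((4 * C ^+ 2 / n%:R ^+ 2)%:E * (green p)%:E))%E).
  apply: ge0_le_integral => //; first exact: msum.
  - exact: emeasurable_funM.
  - by move=> p _; rewrite -EFinM lee_fin.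
rewrite ge0_integralZl//; last by move=> p _; rewrite lee_fin ltW// green_gt0.
apply: (@le_trans _ _ ((4 * C ^+ 2 / n%:R ^+ 2)%:E * (16 * (2 * n).+1%:R)%:E)%E).
  by apply: lee_wpmul2l; [rewrite lee_fin|exact: green_integral].
rewrite -EFinM lee_fin.
have -> : 192 * C ^+ 2 / n%:R = 4 * C ^+ 2 / n%:R ^+ 2 * (48 * n%:R) by field; rewrite gt_eqF.
apply: ler_wpM2l => //.
have n1 : 1 <= n%:R :> R by rewrite ler1n.
by rewrite -[(2 * n).+1%:R]natr1 natrM; lra.
Qed.

End LogCutoff.

(** The energy bound is scale invariant, so the factor N depends on eps only and s stays free. *)
Lemma exists_cutoff (eps : R) : 0 < eps -> exists2 N : R, 1 <= N & forall (c : R * R) (s : R), 0 < s ->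
  exists v g, [/\ gradient v g, forall p, 0 <= v p <= 1, forall p, obox c (s / 2) p -> v p = 1,
    forall p, ~ obox c (N * s) p -> v p = 0 & forall O, open O -> (energy O g < eps%:E)%E].
Proof.
move=> eps0; have [C C0 hC] := dstep_bounded R.
pose n := (Num.truncn (192 * C ^+ 2 / eps)).+1.
have nn : 192 * C ^+ 2 / eps < n%:R by rewrite truncnS_gt.
have n0 : (0 < n)%N by [].
exists (2 ^+ (2 * n)); first by rewrite exprn_ege1// ler1n.
move=> c s s0; exists (cutoff c s n), (dcutoff c s n); split.
- exact: gradient_cutoff.
- by move=> p; exact: cutoff_ge0.
- by move=> p; exact: cutoff_in.
- by move=> p; exact: cutoff_out.
- move=> O oO; apply: le_lt_trans (energy_cutoff c s0 n0 oO hC) _.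
  rewrite lte_fin ltr_pdivrMr ?ltr0n//. by rewrite [ltRHS]mulrC -ltr_pdivrMr.
Qed.

Lemma energyN O g : energy O (fun p => (- (g p).1, - (g p).2)) = energy O g.
Proof. by apply: eq_integral => p _; rewrite !sqrrN. Qed.

(** A cut-off about c at the scale s = e/(2N): its support has radius N s = e/2 and keeps away from
    F0. *)
Lemma cap_point O F0 c (eps : R) : open O -> closed F0 -> ~ F0 c -> 0 < eps ->
  exists2 r : R, 0 < r & forall F1, F1 `<=` obox c r -> (cap F0 F1 O < eps%:E)%E.
Proof.
move=> oO cF nF eps0; have [N N1 hN] := exists_cutoff eps0.
have [e e0 eF] := open_obox (closed_openC cF) nF.
have N0 : 0 < N by lra.
pose s := e / (2 * N).
have s0 : 0 < s by rewrite divr_gt0// mulr_gt0.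
have Ns : N * s = e / 2 by rewrite /s; field; rewrite gt_eqF.
have [v [g [gr v01 v1 v0 Eg]]] := hN c s s0.
exists (s / 2); first by rewrite divr_gt0.
move=> F1 F1s; apply: (lt_cap _ (gradient_weak oO gr (Eg O oO)) (Eg O oO)).
have [cv _ _ _ _] := gr.
split; first by move=> p _; case/andP: (v01 p).
split; first by move=> p _; exact: cv.
split.
  exists (~` cbox c (e / 2)); split.
    by apply: closed_openC; apply: compact_closed_plane; exact: cbox_compact.
  split; first by move=> p Fp /(@cbox_obox _ c (e / 2) e) h; apply: (eF p) => //; apply: h; lra.
  by move=> p np _; apply: v0; rewrite Ns => /obox_cbox.
exists (obox c (s / 2)); split; first exact: obox_open.
by split=> // p /v1 ->.
Qed.

(** One minus a cut-off: with s/2 = |M| + 1 it vanishes on a box around F0, and it is 1 off the box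
    of radius N s. *)
Lemma cap_infty O F0 M (eps : R) : open O -> F0 `<=` obox (0, 0) M -> 0 < eps ->
  exists2 r : R, 0 < r & forall F1, (forall p, F1 p -> ~ obox (0, 0) r p) -> (cap F0 F1 O < eps%:E)%E.
Proof.
move=> oO FM eps0; have [N N1 hN] := exists_cutoff eps0.
pose s := 2 * (`|M| + 1).
have s0 : 0 < s by rewrite /s; have := normr_ge0 M; lra.
have [v [g [gr v01 v1 v0 Eg]]] := hN (0, 0) s s0.
have Ns : 0 < N * s by rewrite mulr_gt0//; lra.
exists (2 * (N * s)); first by rewrite mulr_gt0.
move=> F1 F1s.
have gr' := gradient_onem gr.
have E : (energy O (fun p => (- (g p).1, - (g p).2)%R) < eps%:E)%E by rewrite energyN; exact: Eg.
apply: (lt_cap _ (gradient_weak oO gr' E) E).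
have [cv _ _ _ _] := gr'.
split; first by move=> p _; case/andP: (v01 p) => _; rewrite subr_ge0.
split; first by move=> p _; exact: cv.
split.
  exists (obox (0, 0) (s / 2)); split; first exact: obox_open.
  split; last by move=> p /v1 -> _; rewrite subrr.
  move=> p /FM/oboxP[a b]; apply/oboxP; have h := ler_norm M.
  have -> : s / 2 = `|M| + 1 by rewrite /s; field.
  by split; lra.
exists (~` cbox (0, 0) (N * s)); split.
  by apply: closed_openC; apply: compact_closed_plane; exact: cbox_compact.
split; first by move=> p /F1s h /(@cbox_obox _ _ _ (2 * (N * s))) h2; apply: h; apply: h2; lra.
by move=> p np _; rewrite v0 ?subr0// => /obox_cbox.
Qed.

End Cutoff.

(** * The completion *)

Section Metric.
Variable R : realType.
Local Notation P := (R * R)%type.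
Variables (O F V : set P).
Hypotheses (dO : domain O) (lcO : forall x, bdry O x -> locally_connected_at O x).
Hypotheses (cF : continuum F) (FO : F `<=` O) (oV : open V) (FV : F `<=` V).
Hypotheses (VO : closure V `<=` O) (cV : compact (closure V)).
Implicit Types (x y z p : P) (u w : nat -> P).

Let oO : open O. Proof. by case: dO. Qed.

Lemma bdry_closed : closed (bdry O).
Proof.
rewrite /bdry setDE; apply: closedI; first exact: closed_closure.
by apply: open_closedC; exact: open_interior.
Qed.

Lemma bdry_notin x : O x -> ~ bdry O x.
Proof. by move=> Ox [_]; apply; rewrite (interior_id O).1. Qed.

Lemma closure_bdry x : closure O x -> ~ O x -> bdry O x.
Proof. by move=> cx nx; split=> // /interior_subset. Qed.

(** For each capacity, either x is off the fixed plate and [cap_point] applies, or the set to be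
    measured is empty near x: V is a neighbourhood of F, and closure V does not meet bdry O. *)
Lemma caps_small x (eta : R) : closure O x -> 0 < eta -> exists2 r : R, 0 < r & forall A, A `<=` obox x r ->
  (cap F (A `\` V) O < eta%:E)%E /\ (cap (bdry O) (A `&` V) O < eta%:E)%E.
Proof.
move=> cx eta0; have [cmF [_ [a [_ [Fa _]]]]] := cF.
have clF : closed F by exact: compact_closed_plane.
have [r2 r20 h2] : exists2 r : R, 0 < r & forall A, A `<=` obox x r -> (cap (bdry O) (A `&` V) O < eta%:E)%E.
  have [Ox|nO] := pselect (O x).
    have [r r0 h] := cap_point oO bdry_closed (bdry_notin Ox) eta0.
    by exists r => // A Ar; apply: h => p [/Ar].
  have nV : (~` closure V) x by move=> /VO.
  have [r r0 hr] := open_obox (closed_openC (@closed_closure _ V)) nV.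
  (* Needed only for the capacity of the empty set, as A does not meet V. *)
  have [r' _ h] := cap_point oO bdry_closed (bdry_notin (FO Fa)) eta0.
  exists r => // A Ar; apply: h => p [/Ar/hr nVp Vp]; exfalso; apply: nVp.
  exact: subset_closure.
have [r1 r10 h1] : exists2 r : R, 0 < r & forall A, A `<=` obox x r -> (cap F (A `\` V) O < eta%:E)%E.
  have [Fx|nF] := pselect (F x).
    have [r r0 hr] := open_obox oV (FV Fx).
    have [M _ FM] := compact_sub_obox cmF.
    have [r' _ h] := cap_infty oO FM eta0.
    by exists r => // A Ar; apply: h => p [/Ar/hr].
  have [r r0 h] := cap_point oO clF nF eta0.
  by exists r => // A Ar; apply: h => p [/Ar].
exists (Num.min r1 r2); first by rewrite lt_min r10.
move=> A Ar; split; [apply: h1|apply: h2]; by move=> p /Ar/obox_min[].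
Qed.

(** A segment inside O, and local connectedness at a boundary point, where the connected set U [&] O
    is joined up within the open set O [&] obox x r. *)
Lemma local_join x (r : R) : closure O x -> 0 < r -> exists2 d : R, 0 < d & forall y z, O y -> O z ->
  obox x d y -> obox x d z -> exists gam M, joins (O `&` obox x r) y z gam M.
Proof.
move=> cx r0; have oB : open (O `&` obox x r) by apply: openI => //; exact: obox_open.
have [Ox|nO] := pselect (O x).
  have [d d0 hd] := open_obox oB (conj Ox (obox_center x r0)).
  by exists d => // y z _ _ yd zd; exact: joins_segment hd yd zd.
have [U [nU [Ur cU]]] := lcO (closure_bdry cx nO) r0.
have [d d0 dU] := (nbhs_obox _ _).1 nU.
exists d => // y z Oy Oz /dU Uy /dU Uz.
apply: (joins_connected oB _ cU) => // p [/Ur h Op]; split=> //; exact: edist_obox.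
Qed.

Lemma capclose_near x (e : R) : closure O x -> 0 < e -> exists2 d : R, 0 < d & forall y z, O y -> O z ->
  obox x d y -> obox x d z -> capclose O F V e y z.
Proof.
move=> cx e0; have [r r0 hr] := caps_small cx (exprn_gt0 2 e0).
have [d d0 hd] := local_join cx r0; exists d => // y z Oy Oz yd zd.
have [gam [M jg]] := hd y z Oy Oz yd zd.
have tr : trace gam `<=` obox x r.
  by have [_ gO _ _ _] := jg; move=> _ [t t01 <-]; move: t01; rewrite /= in_itv /= => /gO[].
have [c1 c2] := hr _ tr.
exists gam, M; split=> //; case: jg => cg gO g0 g1 gM; split=> //.
by move=> t /gO[].
Qed.

Lemma capclose_refl x (e : R) : O x -> 0 < e -> capclose O F V e x x.
Proof.
move=> Ox e0; have [d d0 h] := capclose_near (subset_closure Ox) e0.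
by apply: h => //; exact: obox_center.
Qed.

Definition cauchy u := (forall n, O (u n)) /\ forall e : R, 0 < e ->
  exists N, forall n m, (N <= n)%N -> (N <= m)%N -> capclose O F V e (u n) (u m).

Definition equiv u w := forall e : R, 0 < e -> exists N, forall n, (N <= n)%N -> capclose O F V e (u n) (w n).

Lemma half_gt0 (e : R) : 0 < e -> 0 < e / 2. Proof. by move=> ?; rewrite divr_gt0. Qed.

Lemma rho_half (e : R) x y : 0 < e -> capclose O F V (e / 2) x y -> (rho O F V x y < e%:E)%E.
Proof.
move=> e0 /(capclose_rho (half_gt0 e0)); have -> // : 2 * (e / 2) = e by field.
Qed.

Lemma cauchyE u : rho_cauchy O F V u <-> cauchy u.
Proof.
split=> -[Ou h]; split=> // e e0.
  by have [N hN] := h e e0; exists N => n m Nn Nm; apply: rho_capclose => //; exact: hN.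
by have [N hN] := h _ (half_gt0 e0); exists N => n m Nn Nm; apply: rho_half => //; exact: hN.
Qed.

Lemma equivE u w : rho_equiv O F V u w <-> equiv u w.
Proof.
split=> h e e0.
  by have [N hN] := h e e0; exists N => n Nn; apply: rho_capclose => //; exact: hN.
by have [N hN] := h _ (half_gt0 e0); exists N => n Nn; apply: rho_half => //; exact: hN.
Qed.

Lemma equiv_sym u w : equiv u w -> equiv w u.
Proof. by move=> h e /h[N hN]; exists N => n /hN/capclose_sym. Qed.

Lemma equiv_trans u w t : equiv u w -> equiv w t -> equiv u t.
Proof.
move=> h1 h2 e e0; have [N1 k1] := h1 _ (half_gt0 e0); have [N2 k2] := h2 _ (half_gt0 e0).
exists (maxn N1 N2) => n; rewrite geq_max => /andP[/k1 a /k2 b].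
by have := capclose_trans oO a b; have -> : 2 * (e / 2) = e by field.
Qed.

Lemma equiv_refl u : cauchy u -> equiv u u.
Proof. by move=> [_ h] e /h[N hN]; exists N => n Nn; exact: hN. Qed.

Lemma cclassP u w : cclass O F V u w <-> cauchy w /\ equiv u w.
Proof. by split=> -[/cauchyE ? /equivE ?]. Qed.

Lemma cclass_eq u w : cauchy u -> cauchy w -> equiv u w -> cclass O F V u = cclass O F V w.
Proof.
move=> cu cw uw; apply/seteqP; split=> t /cclassP[ct h]; apply/cclassP; split=> //.
  exact: equiv_trans (equiv_sym uw) h.
exact: equiv_trans uw h.
Qed.

Lemma cclass_self u : cauchy u -> cclass O F V u u.
Proof. by move=> cu; apply/cclassP; split=> //; exact: equiv_refl. Qed.

Lemma cauchy_cst x : O x -> cauchy (fun=> x).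
Proof. by move=> Ox; split=> // e e0; exists 0%N => *; exact: capclose_refl. Qed.

(** The infimum selects other representatives u' and w'; the path u, u', w', w takes two
    concatenations, hence the factor 4. *)
Lemma crho_close u w (e : R) : cauchy u -> cauchy w -> 0 < e ->
  (crho O F V (cclass O F V u) (cclass O F V w) < e%:E)%E ->
  exists N, forall n, (N <= n)%N -> capclose O F V (4 * e) (u n) (w n).
Proof.
move=> cu cw e0 /ereal_inf_lt[_ [u' [w' [/cclassP[cu' uu'] [/cclassP[cw' ww'] ->]]]]].
rewrite /limn_esup /limf_esup => /ereal_inf_lt[_ [A [N0 _ NA] <-] sA].
have [N1 k1] := uu' e e0; have [N2 k2] := ww' e e0.
exists (maxn N0 (maxn N1 N2)) => n; rewrite !geq_max => /and3P[n0 n1 n2].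
have c : capclose O F V e (u' n) (w' n).
  apply: rho_capclose => //; apply: le_lt_trans sA; apply: ereal_sup_ubound.
  by exists n => //; exact: NA.
have -> : 4 * e = 2 * (2 * e) by ring.
apply: (capclose_trans oO (capclose_trans oO (k1 n n1) c)).
apply: (@capclose_le _ O F V e); [exact: ltW|lra|].
by apply: capclose_sym; exact: k2.
Qed.

(** Each [rho] is below 2e, but their upper limit only at most 2e, so 3e restores a strict
    inequality. *)
Lemma close_crho u w (e : R) : cauchy u -> cauchy w -> 0 < e ->
  (exists N, forall n, (N <= n)%N -> capclose O F V e (u n) (w n)) ->
  (crho O F V (cclass O F V u) (cclass O F V w) < (3 * e)%:E)%E.
Proof.
move=> cu cw e0 [N hN].
apply: (@le_lt_trans _ _ (2 * e)%:E); last by rewrite lte_fin; lra.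
apply: (@le_trans _ _ (limn_esup (fun n => rho O F V (u n) (w n)))).
  by apply: ereal_inf_lbound; exists u, w; split; [exact: cclass_self|split=> //; exact: cclass_self].
rewrite /limn_esup /limf_esup; apply: ge_ereal_inf.
exists (ereal_sup ((fun n => rho O F V (u n) (w n)) @` [set n | (N <= n)%N])).
  by exists [set n | (N <= n)%N] => //; exists N.
by apply: ge_ereal_sup => _ [n Nn <-]; apply: ltW; apply: capclose_rho => //; exact: hN.
Qed.

Definition tends u x := forall e : R, 0 < e -> exists N, forall n, (N <= n)%N -> obox x e (u n).

Lemma tends_closure u x : (forall n, O (u n)) -> tends u x -> closure O x.
Proof.
move=> Ou ux; apply/closureP => e /ux[N hN]; exists (u N) => //; exact: hN.
Qed.

Lemma tends_cauchy u x : (forall n, O (u n)) -> tends u x -> cauchy u.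
Proof.
move=> Ou ux; split=> // e e0; have [d d0 hd] := capclose_near (tends_closure Ou ux) e0.
by have [N hN] := ux _ d0; exists N => n m Nn Nm; apply: hd => //; exact: hN.
Qed.

Lemma tends_equiv u w x : (forall n, O (u n)) -> (forall n, O (w n)) -> tends u x -> tends w x -> equiv u w.
Proof.
move=> Ou Ow ux wx e e0; have [d d0 hd] := capclose_near (tends_closure Ou ux) e0.
have [N1 k1] := ux _ d0; have [N2 k2] := wx _ d0.
exists (maxn N1 N2) => n; rewrite geq_max => /andP[n1 n2].
by apply: hd => //; [exact: k1|exact: k2].
Qed.

Lemma tends_cst x : tends (fun=> x) x.
Proof. by move=> e e0; exists 0%N => n _; exact: obox_center. Qed.

Lemma obox_triangle x y z (a b : R) : obox x a y -> obox y b z -> obox x (a + b) z.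
Proof.
move=> /oboxP[a1 a2] /oboxP[b1 b2]; apply/oboxP; split.
  by have := ler_distD y.1 x.1 z.1; lra.
by have := ler_distD y.2 x.2 z.2; lra.
Qed.

Lemma obox_sym x y (a : R) : obox x a y -> obox y a x.
Proof. by move=> /oboxP[? ?]; apply/oboxP; rewrite (distrC y.1) (distrC y.2). Qed.

Lemma obox_eq x y : (forall e, 0 < e -> obox x e y) -> x = y.
Proof.
move=> h; apply: contrapT => /edist_gt0_neq d0.
have := obox_edist (h _ (half_gt0 d0)); lra.
Qed.

Lemma tends_unique u x y : tends u x -> tends u y -> x = y.
Proof.
move=> ux uy; apply: obox_eq => e e0.
have [N1 k1] := ux _ (half_gt0 e0); have [N2 k2] := uy _ (half_gt0 e0).
have -> : e = e / 2 + e / 2 by field.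
apply: obox_triangle (k1 (maxn N1 N2) (leq_maxl _ _)) _; apply: obox_sym.
exact: k2 (leq_maxr _ _).
Qed.

Lemma seq_of_closure : exists s : P -> nat -> P, forall x, closure O x ->
  (forall n, O (s x n)) /\ tends (s x) x.
Proof.
suff : forall x, exists s : nat -> P, closure O x -> (forall n, O (s n)) /\ tends s x.
  by move=> /choice[s hs]; exists s.
move=> x; have [cx|nx] := pselect (closure O x); last by exists (fun=> x).
have : forall n : nat, exists y, O y /\ obox x n.+1%:R^-1 y.
  move=> n; have /closureP/(_ n.+1%:R^-1)[|y Oy xy] := cx; first by rewrite invr_gt0 ltr0n.
  by exists y.
move=> /choice[s hs]; exists s => _; split; first by move=> n; have [] := hs n.
move=> e e0; exists (Num.truncn e^-1) => n Nn.
have [_ /oboxP[a b]] := hs n; apply/oboxP.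
have le : n.+1%:R^-1 <= e.
  rewrite -[leRHS]invrK lef_pV2 ?posrE ?invr_gt0 ?ltr0n//.
  by apply/ltW/(lt_le_trans (truncnS_gt _)); rewrite ler_nat ltnS.
by split; exact: lt_le_trans le.
Qed.

Lemma cluster_seq (S : set P) (s : nat -> P) : compact S -> (forall n, S (s n)) ->
  exists2 z, S z & forall e N, 0 < e -> exists2 n, (N <= n)%N & obox z e (s n).
Proof.
move=> cS Ss.
have Fs : (s @ \oo) S by exists 0%N => // n _; exact: Ss.
have [z [Sz clz]] := cS (s @ \oo) _ Fs.
exists z => // e N e0.
have nz : nbhs z (obox z e) by apply/nbhs_obox; exists e.
have sN : (s @ \oo) [set s n | n in [set n | (N <= n)%N]] by exists N => // n Nn; exists n.
by have [_ [[n Nn <-] h]] := clz _ _ sN nz; exists n.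
Qed.

Lemma inv_small (e : R) : 0 < e -> exists N : nat, forall n, (N <= n)%N -> n.+1%:R^-1 < e.
Proof.
move=> e0; exists (Num.truncn e^-1) => n Nn.
rewrite -[ltRHS]invrK ltf_pV2 ?posrE ?invr_gt0 ?ltr0n//.
by apply: (lt_le_trans (truncnS_gt _)); rewrite ler_nat ltnS.
Qed.

Lemma realization_shrink u x : cauchy u -> realization O F V (cclass O F V u) = [set x] ->
  forall e, 0 < e -> exists2 d, 0 < d & forall y, O y ->
    (crho O F V (cclass O F V u) (embed O F V y) < d%:E)%E -> obox x e y.
Proof.
move=> cu rx e e0; apply: contrapT => nex.
have far d : 0 < d -> exists y, [/\ O y, (crho O F V (cclass O F V u) (embed O F V y) < d%:E)%E & ~ obox x e y].
  move=> d0; apply: contrapT => h; apply: nex; exists d => // y Oy cy.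
  by apply: contrapT => ny; apply: h; exists y.
have xr : realization O F V (cclass O F V u) x by rewrite rx.
have sph d : 0 < d -> exists z, [/\ O z, cbox x e z, ~ obox x e z &
    (crho O F V (cclass O F V u) (embed O F V z) < d%:E)%E].
  (* 48 = 4 * 2 * 2 * 3: [crho_close], two concatenations, and [close_crho]. *)
  move=> d0; pose d' := d / 48; have d'0 : 0 < d' by rewrite divr_gt0.
  have [y [Oy cy ny]] := far d' d'0.
  have /closureP/(_ _ e0)[y' [Oy' cy'] xy'] := xr d' d'0.
  have [N1 k1] := crho_close cu (cauchy_cst Oy) d'0 cy.
  have [N2 k2] := crho_close cu (cauchy_cst Oy') d'0 cy'.
  have c : capclose O F V (2 * (4 * d')) y' y.
    apply: (capclose_trans oO (capclose_sym (k2 (maxn N1 N2) (leq_maxr _ _)))).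
    exact: k1 (leq_maxl _ _).
  have [z [Oz cz nz clz]] := capclose_meet c (@obox_open R x e) xy' ny.
  exists z; split=> //.
    have : closed (cbox x e) by apply: compact_closed_plane; exact: cbox_compact.
    by apply; apply: closureS clz; exact: obox_cbox.
  have -> : d = 3 * (2 * (2 * (4 * d'))) by rewrite /d'; field.
  apply: close_crho => //; [exact: cauchy_cst|by rewrite !mulr_gt0|].
  exists N2 => n /k2 h; apply: (capclose_trans oO _ cz).
  by apply: capclose_le h; lra.
have sphn (n : nat) : exists z, [/\ O z, cbox x e z, ~ obox x e z &
    (crho O F V (cclass O F V u) (embed O F V z) < (n.+1%:R^-1)%:E)%E].
  by apply: sph; rewrite invr_gt0 ltr0n.
have [s hs] := choice sphn.
have cS : compact (cbox x e `\` obox x e).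
  rewrite setDE; apply: compact_closedI; first exact: cbox_compact.
  by apply: open_closedC; exact: obox_open.
have [z [_ nz] hz] := cluster_seq cS (fun n => let: And4 _ b c _ := hs n in conj b c).
(* The points s n on the boundary of the box come arbitrarily close to the class of u, so their
   cluster point lies in the realization; but it is not x. *)
suff : realization O F V (cclass O F V u) z by rewrite rx => zx; apply: nz; rewrite zx; exact: obox_center.
move=> d /= d0; apply/closureP => e' e'0.
have [N kN] := inv_small d0; have [n Nn zn] := hz e' N e'0.
have [On _ _ cn] := hs n; exists (s n) => //; split=> //.
by apply: lt_trans cn _; rewrite lte_fin; exact: kN.
Qed.

(** A collar of uniform width. It makes the boundary of W a compact set of points of O outside
    closure V, where separation is already available. *)
Lemma compact_nbhd : exists W, [/\ open W, closure V `<=` W, closure W `<=` O & compact (closure W)].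
Proof.
have [s s0 hs] : exists2 s : R, 0 < s & forall x, closure V x -> obox x (2 * s) `<=` O.
  have nc : \forall h \near (0:R)^'+, forall x, closure V x -> obox x (2 * h) `<=` O.
    have /compact_near_coveringP := cV.
    move=> /(_ R (0:R)^'+ (fun h x => obox x (2 * h) `<=` O) _); apply => x /VO Ox.
    have [e e0 eO] := open_obox oO Ox.
    exists (obox x (e / 2), [set h : R | h < e / 4]) => /=; first split.
    - by apply/nbhs_obox; exists (e / 2); rewrite ?divr_gt0.
    - by apply: nbhs_right_lt; rewrite divr_gt0.
    - move=> [x' h] /= [bx hh] q qx; apply: eO.
      have /oboxP[a b] := obox_triangle bx qx.
      by apply/oboxP; split; lra.
  near (0:R)^'+ => h; exists h => //; by near: h.
pose W := \bigcup_(x in closure V) obox x s.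
have WO : closure W `<=` O.
  move=> p /closureP/(_ _ s0)[w [x Vx xw] pw]; apply: (hs x Vx).
  by have := obox_triangle xw (obox_sym pw); have -> : s + s = 2 * s by ring.
have [M M0 hM] := compact_sub_obox cV.
exists W; split=> //.
- by apply: bigcup_open => x _; exact: obox_open.
- by move=> x Vx; exists x => //; exact: obox_center.
- apply: (@subclosed_compact _ _ (cbox (0, 0) (M + s))).
  + exact: closed_closure.
  + exact: cbox_compact.
  + have : closed (cbox ((0:R), (0:R)) (M + s)) by apply: compact_closed_plane; exact: cbox_compact.
    move=> cl; rewrite [X in _ `<=` X](closure_id _).1//; apply: closureS => p [x /hM Mx xp].
    by apply: obox_cbox; exact: obox_triangle xp.
Unshelve. all: end_near. Qed.

(** A small box about y has no points of V, so F alone separates; this is available before O is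
    known to be bounded. *)
Lemma capclose_outside y : O y -> ~ closure V y ->
  forall e, 0 < e -> exists2 d, 0 < d & forall z, capclose O F V d y z -> obox y e z.
Proof.
move=> Oy nV; apply: capclose_local => //; right.
have [r r0 hr] := open_obox (closed_openC (@closed_closure _ V)) nV.
by exists r => // p /hr nVp Vp; apply: nVp; exact: subset_closure.
Qed.

Definition escapes u := forall M : R, exists N, forall n, (N <= n)%N -> ~ obox (0, 0) M (u n).

Lemma escapes_obox u x (e : R) : escapes u -> ~ (exists N, forall n, (N <= n)%N -> obox x e (u n)).
Proof.
move=> eu [N hN]; have [N' hN'] := eu (`|x.1| + `|x.2| + e).
apply: (hN' (maxn N N')); first exact: leq_maxr.
have /oboxP[a b] := hN (maxn N N') (leq_maxl _ _).
apply/oboxP => /=; rewrite !sub0r !normrN.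
have := ler_distD x.1 0 (u (maxn N N')).1; have := ler_distD x.2 0 (u (maxn N N')).2.
rewrite !sub0r !normrN; have := normr_ge0 x.1; have := normr_ge0 x.2.
by split; lra.
Qed.

(** Outside closure V this is separation by F. From y in closure V, curves to the sequence cross the
    boundary of W at points ever closer to y for [rho]; a cluster point z of these is equivalent to
    y and lies outside closure V, so the first case applies to z. *)
Lemma escapes_not_embed u y : O y -> cauchy u -> escapes u -> ~ equiv (fun=> y) u.
Proof.
move=> Oy cu eu yu.
have out x : O x -> ~ closure V x -> ~ equiv (fun=> x) u.
  move=> Ox nV xu; have [d d0 hd] := capclose_outside Ox nV ltr01.
  by apply: (@escapes_obox u x 1 eu); have [N hN] := xu _ d0; exists N => n /hN/hd.
have [Vy|nV] := pselect (closure V y); last exact: out yu.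
have [W [oW VW WO cW]] := compact_nbhd.
have [M M0 WM] := compact_sub_obox cW.
have meet n : exists z, [/\ closure W z, ~ W z & capclose O F V n.+1%:R^-1 y z].
  have n0 : 0 < n.+1%:R^-1 :> R by rewrite invr_gt0 ltr0n.
  have [N1 k1] := yu _ n0; have [N2 k2] := eu M.
  have nW : ~ W (u (maxn N1 N2)).
    by move=> /subset_closure/WM; apply: k2; exact: leq_maxr.
  have [z [_ cz nz clz]] := capclose_meet (k1 _ (leq_maxl N1 N2)) oW (VW _ Vy) nW.
  by exists z.
have [s hs] := choice meet.
have cS : compact (closure W `\` W).
  by rewrite setDE; apply: compact_closedI => //; exact: open_closedC.
have [z [Wz nWz] hz] := cluster_seq cS (fun n => let: And3 a b _ := hs n in conj a b).
have Oz := WO _ Wz.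
apply: (out z Oz); first by move=> /VW.
apply: equiv_trans yu => e e0; exists 0%N => _ _.
have e2 := half_gt0 e0.
have [d d0 hd] := capclose_near (subset_closure Oz) e2.
have [N kN] := inv_small e2; have [n Nn zn] := hz d N d0.
have [Wn _ cn] := hs n.
have -> : e = 2 * (e / 2) by field.
apply: (capclose_trans oO (hd z (s n) Oz (WO _ Wn) (obox_center z d0) zn)).
apply: capclose_sym; apply: capclose_le cn; first by rewrite invr_ge0.
exact/ltW/kN.
Qed.

(** A curve from p to b is stopped when it first enters the closed box of radius r + 1; up to that
    time it avoids the open box of radius r. *)
Lemma exit_point (r : R) (b p : P) : 0 < r -> O b -> obox (0, 0) (r + 1) b -> O p -> ~ cbox (0, 0) (r + 1) p ->
  exists q, [/\ O q, cbox (0, 0) (r + 1) q, ~ obox (0, 0) (r + 1) q &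
    exists gam M, joins (O `&` ~` obox (0, 0) r) p q gam M].
Proof.
move=> r0 Ob bb Op np; have [_ [cO _]] := dO.
have [gam [M jg]] := joins_connected oO (@subset_refl _ O) cO Op Ob.
have [cg gO g0 g1 gM] := jg.
have oU : open (~` cbox ((0:R), (0:R)) (r + 1)).
  by apply: closed_openC; apply: compact_closed_plane; exact: cbox_compact.
have nb : ~ (~` cbox (0, 0) (r + 1)) (gam 1) by rewrite g1; apply; exact: obox_cbox.
have [tau [/andP[t0 t1] nt ht]] := first_exit cg oU ler01 nb.
have tp : 0 < tau.
  by rewrite lt_neqAle t0 andbT; apply/eqP => E; apply: nt; rewrite -E g0.
have nq : ~ obox (0, 0) (r + 1) (gam tau).
  move=> oq.
  have /nbhs_ballP[h /= h0 hB] : nbhs tau (gam @^-1` obox (0, 0) (r + 1)).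
    by apply: cg; apply: open_nbhs_nbhs; split=> //; exact: obox_open.
  have [s1 s2] : tau - h < Num.max 0 (tau - h / 2) /\ Num.max 0 (tau - h / 2) < tau.
    by split; [rewrite lt_max; apply/orP; right; lra|rewrite gt_max tp /=; lra].
  apply: (ht (Num.max 0 (tau - h / 2))); first by rewrite le_max lexx.
  by apply: obox_cbox; apply: hB; rewrite /ball /= gtr0_norm; lra.
exists (gam tau); split=> //; [by apply: gO; rewrite t0|exact: contrapT|].
have [js tr] := joins_sub jg (lexx 0) t0 t1.
exists (fun t => gam (0 + (tau - 0) * t)), M.
have [a1 a2 a3 a4 a5] := js; split=> //; last by rewrite a3 g0.
move=> t t01; split; first exact: a2.
have sub : obox (0, 0) r `<=` obox ((0:R), (0:R)) (r + 1).
  by move=> z /oboxP[? ?]; apply/oboxP; split; lra.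
move: t01 => /andP[tt0 tt1]; rewrite add0r subr0 => /sub; move: tt1; rewrite le_eqVlt => /predU1P[->|tt1].
  by rewrite mulr1.
move=> /obox_cbox; apply: ht; rewrite mulr_ge0//=.
by rewrite -[ltRHS]mulr1 ltr_pM2l.
Qed.

(* An ultrafilter picks, for every [k], the component of [O] minus the box of
   radius [k] in which the sequence eventually stays. *)
Lemma unbounded_end : (forall M, exists2 p, O p & ~ obox (0, 0) M p) ->
  exists u, cauchy u /\ escapes u.
Proof.
move=> unb; have [_ [_ [b Ob]]] := dO.
pose R0 := `|b.1| + `|b.2| + 1.
have R00 : 0 < R0 by rewrite ltr_wpDl// addr_ge0.
pose rad (k : nat) := R0 + k%:R.
have rad0 k : 0 < rad k by rewrite ltr_wpDr.
have bb k : obox (0, 0) (rad k + 1) b.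
  apply/oboxP => /=; rewrite !sub0r !normrN /rad /R0.
  have := normr_ge0 b.1; have := normr_ge0 b.2; have : 0 <= k%:R :> R by [].
  by split; lra.
(* The neighbourhoods of infinity, traced on O. *)
pose B : set_system P := filter_from [set: R] (fun M => O `\` cbox (0, 0) M).
have pB : ProperFilter B.
  apply: filter_from_proper.
    apply: filter_from_filter; first by exists 0.
    move=> M M' _ _; exists (Num.max M M') => // p [Op np]; split; split=> // /cboxP[h1 h2];
      by apply: np; apply/cboxP; rewrite !le_max h1 h2 ?orbT.
  move=> M _; have [p Op np] := unb (M + 1); exists p; split=> // /(@cbox_obox _ (0, 0) M (M + 1)) h.
  by apply: np; apply: h; lra.
have [G [uG BG]] := ultraFilterLemma pB.
have fG : ProperFilter G by exact: ultra_proper.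
have GM M : G (O `\` cbox (0, 0) M) by apply: BG; exists M.
have ex (k : nat) (p : P) : exists q, O p -> ~ cbox (0, 0) (rad k + 1) p ->
  [/\ O q, cbox (0, 0) (rad k + 1) q, ~ obox (0, 0) (rad k + 1) q &
    exists gam M, joins (O `&` ~` obox (0, 0) (rad k)) p q gam M].
  have [h|nh] := pselect (O p /\ ~ cbox (0, 0) (rad k + 1) p); last by exists p => a c; exfalso; apply: nh.
  have [q hq] := exit_point (rad0 k) Ob (bb k) h.1 h.2.
  by exists q.
pose far (k : nat) (p q : P) := O p /\ ~ cbox (0, 0) (rad k) p /\
  exists gam M, joins (O `&` ~` obox (0, 0) (rad k)) p q gam M.
have comp (k : nat) : exists2 C, G C & forall p q, C p -> C q -> far k p q.
  (* [ww] sends a far point to the place where its curve reaches the boundary of the box of radius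
     rad k + 1. That boundary is compact, so [ww] has a cluster point x along the ultrafilter, and
     [local_join] at x connects the values of [ww] near x. *)
  have [ww hww] := choice (ex k).
  have cK : compact (closure O `&` (cbox ((0:R), (0:R)) (rad k + 1) `\` obox (0, 0) (rad k + 1))).
    rewrite setIC setDE -setIA; apply: compact_closedI; first exact: cbox_compact.
    apply: closedI; first by apply: open_closedC; exact: obox_open.
    exact: closed_closure.
  have FK : (ww @ G) (closure O `&` (cbox ((0:R), (0:R)) (rad k + 1) `\` obox (0, 0) (rad k + 1))).
    rewrite /fmap /=; apply: (@filterS _ G _ _ _ _ (GM (rad k + 1))) => p [Op np].
    by have [q1 q2 q3 _] := hww p Op np; split; [exact: subset_closure|split].
  have [x [[cx [_ nx]] clx]] := cK (ww @ G) _ FK.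
  have [d d0 hd] := local_join cx ltr01.
  have GN : G (ww @^-1` obox x d).
    have nd : nbhs x (obox x d) by apply/nbhs_obox; exists d.
    have [//|Gn] := in_ultra_setVsetC (ww @^-1` obox x d) uG.
    by have /clx/(_ nd)[y []] : (ww @ G) (~` obox x d) by exact: Gn.
  exists ((ww @^-1` obox x d) `&` (O `\` cbox (0, 0) (rad k + 1))).
    by apply: filterI => //; exact: GM.
  move=> p q [wp [Op np]] [wq [Oq nq]].
  have [p1 p2 p3 [g1 [M1 j1]]] := hww p Op np.
  have [q1 q2 q3 [g2 [M2 j2]]] := hww q Oq nq.
  have [g3 [M3 j3]] := hd _ _ p1 q1 wp wq.
  (* x lies outside the open box of radius rad k + 1, so the box of radius 1 about x misses the one
     of radius rad k. *)
  have sub : O `&` obox x 1 `<=` O `&` ~` obox (0, 0) (rad k).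
    move=> z [Oz xz]; split=> // z0; apply: nx.
    by have := obox_triangle z0 (obox_sym xz).
  have j3' : joins (O `&` ~` obox (0, 0) (rad k)) (ww p) (ww q) g3 M3.
    by case: j3 => ? h ? ? ?; split=> // t /h/sub.
  have [j2' _] := joins_sym j2.
  have [g4 j4 _] := joins_cat j1 j3'.
  have [g5 j5 _] := joins_cat j4 j2'.
  split=> //; split; last by exists g5, (M1 + M3 + M2).
  by move=> /(@cbox_obox _ (0, 0) (rad k) (rad k + 1)) h; apply: np; apply: obox_cbox; apply: h; lra.
have [C hC] : exists C : nat -> set P, forall k, G (C k) /\ forall p q, C k p -> C k q -> far k p q.
  have h k : exists D, G D /\ forall p q, D p -> D q -> far k p q.
    by have [D GD hD] := comp k; exists D.
  by have [C hC] := choice h; exists C.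
(* Finite intersections of members of the ultrafilter are nonempty, so u k can be taken in the first
   k + 1 sets at once. *)
have Gall k : G [set p | forall j, (j <= k)%N -> C j p].
  elim: k => [|k IH].
    by apply: filterS (hC 0%N).1 => p Cp j; rewrite leqn0 => /eqP ->.
  apply: filterS (filterI IH (hC k.+1).1) => p [h1 h2] j.
  by rewrite leq_eqVlt => /predU1P[->//|]; rewrite ltnS; exact: h1.
have [u hu] := choice (fun k => filter_ex (Gall k)).
have big (M : R) : exists N : nat, M <= rad N.
  exists (Num.truncn M).+1; apply: ltW; apply: (lt_le_trans (truncnS_gt M)).
  by rewrite /rad lerDr ltW.
have mono k M : M <= rad k -> obox (0, 0) M `<=` obox ((0:R), (0:R)) (rad k).
  by move=> h z /oboxP[? ?]; apply/oboxP; split; lra.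
have Ou n : O (u n) by have [] := (hC n).2 _ _ (hu n n (leqnn _)) (hu n n (leqnn _)).
exists u; split; last first.
  move=> M; have [N hN] := big M; exists N => n Nn /(mono _ _ hN)/obox_cbox.
  by have [_ []] := (hC N).2 _ _ (hu n N Nn) (hu n N Nn).
split=> // e e0.
have [cmF [_ [a [_ [Fa _]]]]] := cF.
have [MF _ hMF] := compact_sub_obox cmF.
have [MV _ hMV] := compact_sub_obox cV.
have [r1 _ c1] := cap_infty oO hMF (exprn_gt0 2 e0).
have [r2 _ c2] := cap_point oO bdry_closed (bdry_notin Ob) (exprn_gt0 2 e0).
have [N hN] := big (Num.max r1 MV).
move: hN; rewrite ge_max => /andP[hN1 hN2].
exists N => n m Nn Nm.
have [_ [_ [gam [M jg]]]] := (hC N).2 _ _ (hu n N Nn) (hu m N Nm).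
have [cg gO g0 g1 gM] := jg.
have tr p : trace gam p -> ~ obox (0, 0) (rad N) p.
  by move=> [t t01 <-]; move: t01; rewrite /= in_itv /= => /gO[].
exists gam, M; split.
- by split=> // t /gO[].
- by apply: c1 => p [/tr h _] /(mono _ _ hN1).
(* The box of radius rad N contains V, so the curve misses V and only the capacity of the empty set
   is left. *)
- apply: c2 => p [/tr h Vp]; exfalso; apply: h; apply: (mono _ _ hN2).
  by apply: hMV; exact: subset_closure.
Qed.

(** For i x = h, continuity of the inverse at h confines the realization to x, and continuity of i
    at x puts x into it. *)
Lemma extends_realization : identity_extends_homeo O F V ->
  forall h, Hrho O F V h -> exists z, realization O F V h = [set z].
Proof.
move=> [i [iO [ic [iinj [isurj [icont iinv]]]]]] h [ch nh].
have [x cx ix] := isurj h ch; exists x; apply/seteqP; split=> [z rz|_ -> e /= e0].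
  apply: esym; apply: obox_eq => e e0.
  have e2 := half_gt0 e0; have [d d0 hd] := iinv x cx _ e2.
  have /closureP/(_ _ e2)[y [Oy cy] zy] := rz d d0.
  have := hd y (subset_closure Oy); rewrite ix iO// => /(_ cy)/edist_obox xy.
  by have -> : e = e / 2 + e / 2 by [field]; apply: obox_triangle xy (obox_sym zy).
apply/closureP => e' e'0; have [d d0 hd] := icont x cx e e0.
have m0 : 0 < Num.min (d / 2) e' by rewrite lt_min e'0 half_gt0.
have [y Oy xy] := (closureP _ _).1 cx _ m0; exists y.
  split=> //; rewrite -ix -iO//; apply: hd; first exact: subset_closure.
  by apply: obox_edist; case: (obox_min xy).
by case: (obox_min xy).
Qed.

(** * From one-point realizations to the homeomorphism *)

Section Converse.
Hypothesis sing : forall h, Hrho O F V h -> exists z, realization O F V h = [set z].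

Lemma completion_cclass u : cauchy u -> completion O F V (cclass O F V u).
Proof. by move=> /cauchyE cu; exists u. Qed.

(** The class of an escaping Cauchy sequence is no point of O by [escapes_not_embed]; as a boundary
    element its balls would shrink to a point and hold the sequence in a box. *)
Lemma bounded_domain : exists M, O `<=` obox (0, 0) M.
Proof.
apply: contrapT => nb.
have unb M : exists2 p, O p & ~ obox (0, 0) M p.
  apply: contrapT => h; apply: nb; exists M => p Op; apply: contrapT => np.
  by apply: h; exists p.
have [u [cu eu]] := unbounded_end unb.
have [[y Oy ey]|nh] := pselect ((embed O F V @` O) (cclass O F V u)).
  apply: (escapes_not_embed Oy cu eu).
  have : cclass O F V u u by exact: cclass_self.
  by rewrite -ey => /cclassP[].
have [z rz] := sing (conj (completion_cclass cu) nh).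
have [d d0 hd] := realization_shrink cu rz ltr01.
apply: (@escapes_obox u z 1 eu).
have d3 : 0 < d / 3 by rewrite divr_gt0.
have [N hN] := cu.2 _ d3; exists N => n Nn; apply: hd; first exact: cu.1.
have -> : d = 3 * (d / 3) by field.
apply: close_crho => //; first by apply: cauchy_cst; exact: cu.1.
by exists N => m Nm; exact: hN.
Qed.

(** With O bounded, bdry O controls means near every point, so points of V are separated too. *)
Lemma capclose_inside y : O y ->
  forall e, 0 < e -> exists2 d, 0 < d & forall z, capclose O F V d y z -> obox y e z.
Proof.
move=> Oy; have [M OM] := bounded_domain.
by apply: capclose_local => //; left; exact: (nul_boundary oO OM Oy).
Qed.

Lemma realization_extends : identity_extends_homeo O F V.
Proof.
have [s hs] := seq_of_closure.
pose i x := cclass O F V (s x).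
have cs x : closure O x -> cauchy (s x) by move=> /hs[Os tx]; exact: tends_cauchy tx.
have iE x u : (forall n, O (u n)) -> tends u x -> i x = cclass O F V u.
  move=> Ou ux; have cx := tends_closure Ou ux; have [Os sx] := hs x cx.
  by apply: cclass_eq; [exact: cs|exact: tends_cauchy ux|exact: tends_equiv ux].
have iO x : O x -> i x = embed O F V x.
  by move=> Ox; apply: iE => //; exact: tends_cst.
have cont x : closure O x -> forall e : R, 0 < e -> exists2 d : R, 0 < d &
    forall y, closure O y -> obox x d y -> (crho O F V (i x) (i y) < e%:E)%E.
  move=> cx e e0; have e3 : 0 < e / 3 by rewrite divr_gt0.
  have [d d0 hd] := capclose_near cx e3.
  exists (d / 2); first exact: half_gt0.
  move=> y cy xy; have -> : e = 3 * (e / 3) by field.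
  apply: close_crho => //; [exact: cs|exact: cs|].
  have [Ox tx] := hs x cx; have [Oy ty] := hs y cy.
  have [N1 k1] := tx _ d0; have [N2 k2] := ty _ (half_gt0 d0).
  exists (maxn N1 N2) => n; rewrite geq_max => /andP[n1 n2].
  apply: hd => //; first exact: k1.
  have -> : d = d / 2 + d / 2 by field.
  exact: obox_triangle xy (k2 n n2).
have sep x : closure O x -> forall e : R, 0 < e -> exists2 d : R, 0 < d &
    forall z, O z -> (crho O F V (i x) (embed O F V z) < d%:E)%E -> obox x e z.
  move=> cx e e0; have [Ox tx] := hs x cx.
  (* Either i x is the class of some y0 in O, and separation at y0 gives x = y0; or it is a boundary
     element, whose realization contains x by continuity and is therefore {x}. *)
  have [[y0 Oy0 ey]|nh] := pselect ((embed O F V @` O) (i x)).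
    have xy : x = y0.
      apply: (tends_unique tx) => d d0; have [d' d'0 hd'] := capclose_inside Oy0 d0.
      have : cclass O F V (s x) (s x) by apply: cclass_self; exact: cs.
      by rewrite -/(i x) -ey => /cclassP[_ /(_ _ d'0)[N hN]]; exists N => n /hN/hd'.
    have [d d0 hd] := capclose_inside Oy0 e0.
    exists (d / 4); first by rewrite divr_gt0.
    move=> z Oz; rewrite -ey xy => cz.
    have d4 : 0 < d / 4 by rewrite divr_gt0.
    have [N hN] := crho_close (cauchy_cst Oy0) (cauchy_cst Oz) d4 cz.
    by apply: hd; have := hN N (leqnn _); have -> : 4 * (d / 4) = d by field.
  have [z rz] := sing (conj (completion_cclass (cs x cx)) nh).
  suff zx : z = x by rewrite zx in rz; exact: (realization_shrink (cs x cx) rz e0).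
  suff : realization O F V (i x) x by rewrite rz => ->.
  move=> d /= d0; apply/closureP => e' e'0; have [d' d'0 hd'] := cont x cx d d0.
  have m0 : 0 < Num.min d' e' by rewrite lt_min d'0.
  have [y Oy] := (closureP _ _).1 cx _ m0.
  move=> /obox_min[xy xy']; exists y => //.
  by split=> //; rewrite -iO//; apply: hd' => //; exact: subset_closure.
have inv x : closure O x -> forall e : R, 0 < e -> exists2 d : R, 0 < d &
    forall y, closure O y -> (crho O F V (i x) (i y) < d%:E)%E -> obox x e y.
  move=> cx e e0; have [d d0 hd] := sep x cx _ (half_gt0 e0).
  (* A late term of s y replaces y, being close to y in the plane and to i y for [crho]; 24 = 4 * 2
     * 3 accounts for [crho_close], a concatenation and [close_crho]. *)
  have d24 : 0 < d / 24 by rewrite divr_gt0.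
  exists (d / 24) => // y cy cxy; have [Ox tx] := hs x cx; have [Oy ty] := hs y cy.
  have [N1 k1] := crho_close (cs x cx) (cs y cy) d24 cxy.
  have [N2 k2] := (cs y cy).2 _ d24.
  have [N3 k3] := ty _ (half_gt0 e0).
  pose m := maxn N1 (maxn N2 N3).
  have m3 : (N3 <= m)%N by rewrite !leq_max leqnn !orbT.
  have m2 : (N2 <= m)%N by rewrite !leq_max leqnn !orbT.
  have -> : e = e / 2 + e / 2 by field.
  apply: obox_triangle (obox_sym (k3 m m3)); apply: hd => //.
  have -> : d = 3 * (2 * (4 * (d / 24))) by field.
  apply: close_crho; [exact: cs|exact: cauchy_cst|by rewrite !mulr_gt0|].
  exists (maxn N1 N2) => n; rewrite geq_max => /andP[n1 n2].
  apply: (capclose_trans oO (k1 n n1)).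
  by apply: capclose_le (k2 n m n2 m2); lra.
exists i; split=> //; split; first by move=> x cx; exact: completion_cclass (cs x cx).
split.
  move=> x y cx cy xy; apply: obox_eq => e e0; have [d d0 hd] := inv x cx e e0.
  apply: hd => //; rewrite -xy; have -> : d = 3 * (d / 3) by field.
  have d3 : 0 < d / 3 by rewrite divr_gt0.
  apply: close_crho; [exact: cs|exact: cs|exact: d3|].
  exact: equiv_refl (cs x cx) _ d3.
split.
  move=> h ch; have [[y Oy ey]|nh] := pselect ((embed O F V @` O) h).
    by exists y; [exact: subset_closure|rewrite iO].
  have [z rz] := sing (conj ch nh); have [u [/cauchyE cu hu]] := ch.
  (* A Cauchy sequence that represents the boundary element converges to the point of its
     realization, so h is the value of i there. *)
  have tz : tends u z.
    move=> e e0; rewrite hu in rz; have [d d0 hd] := realization_shrink cu rz e0.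
    have d3 : 0 < d / 3 by rewrite divr_gt0.
    have [N hN] := cu.2 _ d3; exists N => n Nn; apply: hd; first exact: cu.1.
    have -> : d = 3 * (d / 3) by field.
    apply: close_crho => //; first by apply: cauchy_cst; exact: cu.1.
    by exists N => m Nm; exact: hN.
  by exists z; [exact: tends_closure cu.1 tz|rewrite hu; exact: iE cu.1 tz].
split.
  move=> x cx e e0; have [d d0 hd] := cont x cx e e0; exists d => // y cy /edist_obox.
  exact: hd.
move=> x cx e e0; have [d d0 hd] := inv x cx _ (half_gt0 e0); exists d => // y cy /hd h.
by apply: obox_edist; exact: h.
Qed.

End Converse.
End Metric.

Theorem theorem2p16 (R : realType) (O F V : set (R * R)%type) :
  domain O ->
  (forall x, bdry O x -> locally_connected_at O x) ->
  continuum F -> F `<=` O ->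
  domain V -> F `<=` V -> closure V `<=` O -> compact (closure V) ->
  quasicircle (bdry V) ->
  (identity_extends_homeo O F V <->
   forall h, Hrho O F V h -> exists z, realization O F V h = [set z]).
Proof.
move=> dO lcO cF FO [oV _] FV VO cV _; split.
  exact: extends_realization.
exact: realization_extends.
Qed.
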